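(* Let $0<p,\lambda<1$ and let $g$ be an analytic function on the unit disc $\mathbb{D}$. If the operator $J_g:\mathcal{D}_p^{\lambda}\to\mathcal{D}_p^{\lambda}$, $J_g(f)(z)=\int_0^z f(w)g'(w)\,dw$, is bounded, then $g\in\mathcal{Q}_p$.
   Context: $\mathbb{D}$ is the open unit disc in $\mathbb{C}$, $dm$ is planar Lebesgue measure normalized so that $m(\mathbb{D})=1$, and $\mathcal{H}ol(\mathbb{D})$ is the space of analytic functions on $\mathbb{D}$. For $a\in\mathbb{D}$, $\varphi_a(z)=\frac{a-z}{1-\bar a z}$. For $p\ge 0$, the weighted Dirichlet space $\mathcal{D}_p$ consists of all $f\in\mathcal{H}ol(\mathbb{D})$ with $\|f\|_{\mathcal{D}_p}^2=|f(0)|^2+\int_{\mathbb{D}}|f'(z)|^2(1-|z|^2)^p\,dm(z)<\infty$. For $0<p<1$, $\mathcal{Q}_p$ is the space of all $f\in\mathcal{H}ol(\mathbb{D})$ with $\|f\|_{\mathcal{Q}_p}=|f(0)|+\sup_{a\in\mathbb{D}}\|f\circ\varphi_a-f(a)\|_{\mathcal{D}_p}<\infty$. For $\lambda,p\in[0,1]$, the Dirichlet-Morrey space $\mathcal{D}_p^{\lambda}$ consists of all $f\in\mathcal{H}ol(\mathbb{D})$ with $$\|f\|_{\mathcal{D}_p^{\lambda}}=|f(0)|+\sup_{a\in\mathbb{D}}(1-|a|^2)^{\frac p2(1-\lambda)}\|f\circ\varphi_a-f(a)\|_{\mathcal{D}_p}<\infty ;$$ it is a Banach space under this norm. ''Bounded''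 means that the operator maps $\mathcal{D}_p^{\lambda}$ into itself and is a bounded linear operator for this norm. *)

(* Defs.v *)
From HB Require Import structures.
From mathcomp Require Import all_boot all_order all_algebra.
From mathcomp Require Import complex.
From mathcomp Require Import all_classical all_reals all_analysis.

Set Implicit Arguments.
Unset Strict Implicit.
Unset Printing Implicit Defensive.

Import Order.TTheory GRing.Theory Num.Theory.
Import numFieldNormedType.Exports.

Local Open Scope classical_set_scope.
Local Open Scope ring_scope.
Local Open Scope complex_scope.

(* [R[i]] is packed as a bare [numFieldType] so that its topology and derivative
   are the generic ones: [derivable f z 1] is then complex differentiability at
   [z], and [derive1 f] the complex derivative. Packing it as a richer structure
   makes unification with the lemmas on derivatives diverge. *)
Definition Cx (R : realType) : numFieldType := R[i].

Section DirichletMorrey.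
Context {R : realType}.
Local Notation C := (Cx R).
Implicit Types (p lam : R) (f g : C -> C) (a z : C).

(* [normc] is the modulus with values in [R]; the library norm [`|z|] takes its
   values in [R[i]]. *)
Definition cmod z : R := Normc.normc (z : R[i]).

Definition disc : set C := [set z | cmod z < 1].

(* A function on the disc is represented by a total function on the plane; its
   values off the disc are never used. *)
Definition Hol : set (C -> C) := [set f | forall z, disc z -> derivable f z 1].

Definition phi a z : C := (a - z) / (1 - conjc (a : R[i]) * z).

Definition plane (w : R * R) : C := w.1 +i* w.2.

(* Integral over the disc for planar Lebesgue measure divided by [pi], the area
   of the disc. *)
Definition disc_integral (u : C -> R) : \bar R :=
  ((pi^-1)%:E * \int[lebesgue_measure \x lebesgue_measure]_(w in plane @^-1` disc)
      (u (plane w))%:E)%E.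

Definition dirichlet_norm p f : \bar R :=
  (((cmod (f 0) ^+ 2)%:E
    + disc_integral
        (fun z => cmod (derive1 f z) ^+ 2 * (1 - cmod z ^+ 2) `^ p)%R)
   `^ (2^-1))%E.

Definition Qp_norm p f : \bar R :=
  ((cmod (f 0))%:E
   + ereal_sup [set dirichlet_norm p (fun z => (f (phi a z) - f a)%R)
               | a in disc])%E.

Definition Qp p : set (C -> C) :=
  [set f | Hol f /\ (Qp_norm p f < +oo)%E].

Definition dirichlet_morrey_norm p lam f : \bar R :=
  ((cmod (f 0))%:E
   + ereal_sup [set ((1 - cmod a ^+ 2) `^ (p / 2 * (1 - lam)))%:E
                    * dirichlet_norm p (fun z => (f (phi a z) - f a)%R)
               | a in disc])%E.

Definition dirichlet_morrey p lam : set (C -> C) :=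
  [set f | Hol f /\ (dirichlet_morrey_norm p lam f < +oo)%E].

Definition integral01 (u : R -> C) : C :=
  (\int[lebesgue_measure]_(t in `[0, 1]) complex.Re (u t : R[i]))
  +i* (\int[lebesgue_measure]_(t in `[0, 1]) complex.Im (u t : R[i])).

(* The integral of [f * g'] from 0 to [z], along the segment [t |-> t z]. *)
Definition Jop g f z : C :=
  integral01 (fun t => f (t%:C * z) * derive1 g (t%:C * z) * z).

Definition bounded_linear_on (X : set (C -> C)) (N : (C -> C) -> \bar R)
    (T : (C -> C) -> (C -> C)) : Prop :=
  [/\ forall f, X f -> X (T f),
      forall (c : C) f h, X f -> X h -> forall z, disc z ->
        T (fun w => c * f w + h w) z = c * T f z + T h z &
      exists M : R, forall f, X f -> (N (T f) <= M%:E * N f)%E].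

End DirichletMorrey.

(* Main.v *)
(* Write d_a = 1 - |a|^2 and s = p (1 - lam). The functions
   f_a(w) = d_a^(1 - s/2) / (1 - conj a w) are bounded in the Dirichlet-Morrey
   space, by the Forelli-Rudin estimate; applying J_g to f_a and testing its norm
   at the same point a bounds the integral of
     |g'(w)|^2 (d_a / |1 - conj a w|)^2 (1 - |phi_a(w)|^2)^p
   uniformly in a. The additional weight is small only for w far from a. There, for
   the point a' on the radius of a with 1 - |a'| = 32 (1 - |a|), one has
   1 - |phi_a(w)|^2 <= (1 - |phi_a'(w)|^2) / 4. Hence the Q_p energies satisfy
   Q(a) <= C + 4^-p Q(a'), and finitely many such steps lead to a point at a fixed
   distance from the circle, where the weight is bounded below.

   Since holomorphy is pointwise differentiability, (J_g f)' = f g' requires the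
   continuity of g', which comes from Goursat's lemma and Cauchy's formula on
   squares. The conformal change of variables is obtained from Tonelli's theorem by
   factoring phi_a into shears, dilations and one inversion. *)
Require Import Defs.
From HB Require Import structures.
From mathcomp Require Import all_boot all_order all_algebra.
From mathcomp Require Import complex.
From mathcomp Require Import ring lra.
From mathcomp Require Import all_classical all_reals all_analysis.
From mathcomp Require Import measurable_realfun.
Import Order.TTheory GRing.Theory Num.Theory.
Import numFieldNormedType.Exports.
Set Implicit Arguments.
Unset Strict Implicit.
Unset Printing Implicit Defensive.
Local Open Scope classical_set_scope.
Local Open Scope ring_scope.
Local Open Scope complex_scope.

(** The exponent of [f_a] is chosen so that its numerator and the factor [d_a^(s/2)] of the Morrey
    norm at [a] multiply to [d_a]: the tested weight is then scale invariant, and [lam] disappears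
    from the rest of the argument.

    The recursion cannot be closed by taking suprema on both sides, because the supremum of [Q] may
    be infinite a priori. It is run along a finite chain instead, with the fixed point [K] of
    [K = C + 4^-p K] as invariant bound; [p > 0] makes the factor smaller than 1.

    The norms are defined through [f o phi_a], whereas the recursion compares different points. The
    change of variables moves all dependence on [a] into the weight [(1 - |phi_a|^2)^p], after which
    the comparison is a pointwise inequality between weights. Integrals take values in the extended
    reals, so these comparisons require measurability but no finiteness; the continuity of [g']
    provides the measurability of [|g'|]. *)

Section Modulus.
Context {R : realType}.
Implicit Types (x y z w : R[i]) (a b : R).

Lemma normcE_cmod z : `|z| = (cmod z)%:C.
Proof. by rewrite normc_def; case: z. Qed.

Lemma cmodM z w : cmod (z * w) = cmod z * cmod w.
Proof. exact: Normc.normcM. Qed.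

Lemma cmodV z : cmod (z^-1) = (cmod z)^-1.
Proof. exact: Normc.normcV. Qed.

Lemma cmodf z w : cmod (z / w) = cmod z / cmod w.
Proof. by rewrite cmodM cmodV. Qed.

Lemma cmodN z : cmod (- z) = cmod z.
Proof. by apply: complexI; rewrite -!normcE_cmod normrN. Qed.

Lemma cmod0 : cmod (0 : R[i]) = 0.
Proof. exact: Normc.normc0. Qed.

Lemma cmod1 : cmod (1 : R[i]) = 1.
Proof. exact: Normc.normc1. Qed.

Lemma cmod_ge0 z : 0 <= cmod z.
Proof. by case: z => a b; exact: sqrtr_ge0. Qed.

Lemma cmodD z w : cmod (z + w) <= cmod z + cmod w.
Proof. by rewrite -lecR rmorphD /= -!normcE_cmod ler_normD. Qed.

Lemma cmodB z w : cmod (z - w) <= cmod z + cmod w.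
Proof. by rewrite -(cmodN w) cmodD. Qed.

Lemma cmodBC z w : cmod (z - w) = cmod (w - z).
Proof. by rewrite -cmodN opprB. Qed.

Lemma cmod_ge_sub z w : cmod z - cmod w <= cmod (z + w).
Proof. by have := cmodB (z + w) w; rewrite addrK; lra. Qed.

Lemma cmod_eq0 z : (cmod z == 0) = (z == 0).
Proof.
apply/eqP/eqP => [|->]; last exact: cmod0.
exact: Normc.eq0_normc.
Qed.

Lemma cmod_gt0 z : (0 < cmod z) = (z != 0).
Proof. by rewrite lt_def cmod_ge0 andbT cmod_eq0. Qed.

Lemma cmodR a : cmod (a%:C) = `|a|.
Proof. by rewrite /cmod /= expr0n /= addr0 sqrtr_sqr. Qed.

Lemma cmodi : cmod ('i%C : R[i]) = 1.
Proof. by rewrite /cmod /= expr0n /= add0r expr1n sqrtr1. Qed.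

Lemma cmodJ z : cmod (conjc z) = cmod z.
Proof. by case: z => a b; rewrite /cmod /= sqrrN. Qed.

Lemma cmod_sqr z : cmod z ^+ 2 = complex.Re z ^+ 2 + complex.Im z ^+ 2.
Proof.
by case: z => a b; rewrite /cmod /= sqr_sqrtr // addr_ge0 // sqr_ge0.
Qed.

Lemma cmodX z n : cmod (z ^+ n) = cmod z ^+ n.
Proof. by elim: n => [|n IH]; rewrite ?expr0 ?cmod1 // !exprS cmodM IH. Qed.

Lemma ler_Re_cmod z : `|complex.Re z| <= cmod z.
Proof.
rewrite -ler_sqr ?nnegrE ?cmod_ge0 // cmod_sqr.
by rewrite real_normK ?num_real // lerDl sqr_ge0.
Qed.

Lemma ler_Im_cmod z : `|complex.Im z| <= cmod z.
Proof.
rewrite -ler_sqr ?nnegrE ?cmod_ge0 // cmod_sqr.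
by rewrite real_normK ?num_real // lerDr sqr_ge0.
Qed.

Lemma cmod_le_ReIm z : cmod z <= `|complex.Re z| + `|complex.Im z|.
Proof.
rewrite -ler_sqr ?nnegrE ?cmod_ge0 ?addr_ge0 // cmod_sqr sqrrD.
rewrite !real_normK ?num_real //.
have : 0 <= `|complex.Re z| * `|complex.Im z| by rewrite mulr_ge0.
by lra.
Qed.

Lemma conj_mul_cmod z : conjc z * z = ((cmod z) ^+ 2)%:C.
Proof.
rewrite cmod_sqr; case: z => a b; apply/eqP; rewrite eq_complex /=.
by apply/andP; split; apply/eqP; ring.
Qed.

End Modulus.

(** Differentiability with real radii and real moduli, so that estimates stay within the ordered
    field [R]. The form multiplied out by [h] includes [h = 0]. [cdiff_cvg] and [derivable_cdiff]
    pass to and from the derivative on [Cx R]. *)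
Definition cdiff {R : realType} (f : R[i] -> R[i]) (z d : R[i]) :=
  forall e : R, 0 < e -> exists2 r : R, 0 < r &
    forall h : R[i], cmod h < r -> cmod (f (z + h) - f z - d * h) <= e * cmod h.

Section Derivative.
Context {R : realType}.
Implicit Types (f g : R[i] -> R[i]) (z d : R[i]).

Lemma cdiff_cvg f z d : cdiff f z d ->
  (fun h : Cx R => h^-1 *: ((f : Cx R -> Cx R) (h *: (1 : Cx R) + z) - f z)) @ 0^'
    --> (d : Cx R).
Proof.
move=> fd; apply/cvgrPdist_le => e e0.
(* A positive element of [R[i]] is real, so the epsilon supplied by the topology of [Cx R] equals
   its real part. *)
have eE : e = (complex.Re (e : R[i]))%:C.
  by rewrite RRe_real // gtr0_real.
have er0 : 0 < complex.Re (e : R[i]) by rewrite -ltcR -eE.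
have [r r0 fr] := fd _ er0.
apply/nbhs_ballP; exists (r%:C : Cx R); first by rewrite /= ltcR.
move=> h; rewrite /ball /= sub0r normrN => hr h0.
have {}hr : cmod h < r by rewrite -ltcR -normcE_cmod.
rewrite -[X in (_ <= X)%O]/e [X in (_ <= X)%O]eE.
have -> : (`|d - h^-1 *: ((f : Cx R -> Cx R) (h *: (1 : Cx R) + z) - f z)|)%R
    = (cmod (d - h^-1 * (f (h * 1 + z) - f z)) : R)%:C by exact: normcE_cmod.
rewrite lecR.
have hp : 0 < cmod h by rewrite cmod_gt0.
rewrite -(ler_pM2r hp) -cmodM -cmodN.
apply: le_trans (fr h hr); rewrite le_eqVlt; apply/orP; left; apply/eqP.
congr cmod; rewrite mulr1 (addrC h z).
have h0' : (h : R[i]) != 0 by [].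
by field.
Qed.

Lemma cdiff_derivable f z d : cdiff f z d -> derivable (f : Cx R -> Cx R) z 1.
Proof. by move=> /cdiff_cvg fd; apply: cvgP fd. Qed.

Lemma cdiff_derive1 f z d : cdiff f z d -> derive1 (f : Cx R -> Cx R) z = d.
Proof.
move=> /cdiff_cvg fd; rewrite derive1E.
exact: (cvg_lim (@norm_hausdorff _ _) fd).
Qed.

Lemma derivable_cdiff f z : derivable (f : Cx R -> Cx R) z 1 ->
  cdiff f z (derive1 (f : Cx R -> Cx R) z).
Proof.
move=> fd e e0.
have : (fun h : Cx R => h^-1 *: ((f : Cx R -> Cx R) (h *: (1 : Cx R) + z) - f z)) @ 0^'
    --> derive1 (f : Cx R -> Cx R) z by rewrite derive1E; exact: fd.
move=> /cvgrPdist_le /(_ (e%:C : Cx R)).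
have -> : (0 < (e%:C : Cx R))%R by rewrite ltcR.
move=> /(_ isT) /nbhs_ballP [r /= r0 fr].
have rE : r = (complex.Re (r : R[i]))%:C by rewrite RRe_real // gtr0_real.
exists (complex.Re (r : R[i])); first by rewrite -ltcR -rE.
move=> h hr; have [->|h0] := eqVneq h 0.
  by rewrite addr0 mulr0 subrr subr0 cmod0 mulr0.
have hp : 0 < cmod h by rewrite cmod_gt0.
have := fr (h : Cx R); rewrite /ball /= sub0r normrN.
have -> : `|(h : Cx R)| < r.
  by have : (`|h| < r :> R[i])%R by rewrite normcE_cmod rE ltcR.
move=> /(_ isT h0).
set D := derive1 _ _.
have -> : (`|D - h^-1 *: ((f : Cx R -> Cx R) (h *: (1 : Cx R) + z) - f z)|)%R
    = (cmod (D - h^-1 * (f (h * 1 + z) - f z)) : R)%:C by exact: normcE_cmod.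
move=> Hc; have H : cmod (D - h^-1 * (f (h * 1 + z) - f z)) <= e.
  by rewrite -lecR; exact: Hc.
rewrite -(ler_pM2r hp) -cmodM -cmodN in H.
apply: le_trans H; rewrite le_eqVlt; apply/orP; left; apply/eqP.
congr cmod; rewrite mulr1 (addrC h z).
by move: {Hc} D => D; field.
Qed.

Lemma cdiff_unique f z d d' : cdiff f z d -> cdiff f z d' -> d = d'.
Proof. by move=> /cdiff_derive1 <- /cdiff_derive1. Qed.

End Derivative.

(** * Integrals of complex functions over real segments *)

Section SegmentIntegral.
Context {R : realType}.
Implicit Types (u v : R -> R[i]) (a b t : R) (c : R[i]).

(** Here [s] is not confined to the segment: continuity is that of a function on the whole line, at
    the points of the segment, and no one-sided arguments occur at the endpoints. *)
Definition ccont a b u := forall t, a <= t <= b -> forall e : R, 0 < e ->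
  exists2 r : R, 0 < r & forall s, `|s - t| < r -> cmod (u s - u t) <= e.

Definition cint a b u : R[i] :=
  (\int[lebesgue_measure]_(t in `[a, b]) complex.Re (u t))
  +i* (\int[lebesgue_measure]_(t in `[a, b]) complex.Im (u t)).

Lemma ccontW a b a' b' u : a <= a' -> b' <= b -> ccont a b u -> ccont a' b' u.
Proof. by move=> aa bb cu t tab; apply: cu; lra. Qed.

Lemma ccontD a b u v : ccont a b u -> ccont a b v -> ccont a b (fun t => u t + v t).
Proof.
move=> cu cv t tab e e0.
have e2 : 0 < e / 2 by lra.
have [r r0 ur] := cu t tab _ e2; have [q q0 vq] := cv t tab _ e2.
exists (Num.min r q); first by rewrite lt_min r0.
move=> s; rewrite lt_min => /andP[sr sq].
have -> : u s + v s - (u t + v t) = (u s - u t) + (v s - v t) by ring.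
by apply: le_trans (cmodD _ _) _; have := ur _ sr; have := vq _ sq; lra.
Qed.

Lemma ccontZ a b c u : ccont a b u -> ccont a b (fun t => c * u t).
Proof.
move=> cu t tab e e0.
have c0 := cmod_ge0 c.
have e2 : 0 < e / (cmod c + 1) by rewrite divr_gt0 //; lra.
have [r r0 ur] := cu t tab _ e2.
exists r => // s sr; rewrite -mulrBr cmodM.
apply: le_trans (_ : cmod c * (e / (cmod c + 1)) <= _).
  by rewrite ler_wpM2l // ur.
rewrite mulrCA ger_pMr // ler_pdivrMr; lra.
Qed.

Lemma ccontN a b u : ccont a b u -> ccont a b (fun t => - u t).
Proof.
move=> cu t tab e e0; have [r r0 ur] := cu t tab _ e0.
by exists r => // s sr; rewrite -opprD cmodN ur.
Qed.

Lemma ccontB a b u v : ccont a b u -> ccont a b v -> ccont a b (fun t => u t - v t).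
Proof. by move=> cu cv; apply: ccontD => //; apply: ccontN. Qed.

Lemma ccont_cst a b c : ccont a b (fun=> c).
Proof.
by move=> t _ e e0; exists 1 => // s _; rewrite subrr cmod0 ltW.
Qed.

Lemma ccont_bounded a b u : ccont a b u ->
  exists2 M, 0 <= M & forall t, a <= t <= b -> cmod (u t) <= M.
Proof.
move=> cu; have [ab|ba] := leP a b; last by exists 0 => // t; lra.
have cc : {within `[a, b], continuous (fun t : R => cmod (u t))}.
  apply: continuous_in_subspaceT => t; rewrite inE /= in_itv /= => tab.
  apply/cvgrPdist_le => e e0; have [r r0 ur] := cu t tab e e0.
  apply/nbhs_ballP; exists r => // s; rewrite /ball /= distrC => st.
  rewrite distrC; apply: le_trans (ur s st).
  rewrite ler_norml; have := cmod_ge_sub (u s) (- u t).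
  have := cmod_ge_sub (u t) (- u s); rewrite !cmodN (cmodBC (u t)); lra.
have [c _ Hc] := EVT_max ab cc.
by exists (cmod (u c)); [exact: cmod_ge0|move=> t tab; apply: Hc; rewrite in_itv].
Qed.

Lemma ccont_within_Re a b u : ccont a b u ->
  {within `[a, b], continuous (fun t => complex.Re (u t))}.
Proof.
move=> cu; apply: continuous_in_subspaceT => t; rewrite inE /= in_itv /= => tab.
apply/cvgrPdist_le => e e0; have [r r0 ur] := cu t tab e e0.
apply/nbhs_ballP; exists r => // s; rewrite /ball /= distrC => st.
rewrite distrC; apply: le_trans (ur s st).
by rewrite -raddfB ler_Re_cmod.
Qed.

Lemma ccont_within_Im a b u : ccont a b u ->
  {within `[a, b], continuous (fun t => complex.Im (u t))}.
Proof.
move=> cu; apply: continuous_in_subspaceT => t; rewrite inE /= in_itv /= => tab.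
apply/cvgrPdist_le => e e0; have [r r0 ur] := cu t tab e e0.
apply/nbhs_ballP; exists r => // s; rewrite /ball /= distrC => st.
rewrite distrC; apply: le_trans (ur s st).
by rewrite -raddfB ler_Im_cmod.
Qed.

Lemma ccont_Re_integrable a b u : ccont a b u ->
  lebesgue_measure.-integrable `[a, b] (EFin \o (fun t => complex.Re (u t))).
Proof.
move=> cu; apply: continuous_compact_integrable; first exact: segment_compact.
exact: ccont_within_Re.
Qed.

Lemma ccont_Im_integrable a b u : ccont a b u ->
  lebesgue_measure.-integrable `[a, b] (EFin \o (fun t => complex.Im (u t))).
Proof.
move=> cu; apply: continuous_compact_integrable; first exact: segment_compact.
exact: ccont_within_Im.
Qed.

Lemma eq_cint a b u v : (forall t, a <= t <= b -> u t = v t) ->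
  cint a b u = cint a b v.
Proof.
move=> uv; rewrite /cint; congr (_ +i* _); apply: eq_Rintegral => t;
by rewrite inE /= in_itv /= => /uv ->.
Qed.

Lemma cintD a b u v : ccont a b u -> ccont a b v ->
  cint a b (fun t => u t + v t) = cint a b u + cint a b v.
Proof.
move=> cu cv; apply/eqP; rewrite eq_complex /=; apply/andP; split; apply/eqP.
  rewrite -RintegralD //; [|exact: ccont_Re_integrable..].
  by apply: eq_Rintegral => t _; rewrite raddfD.
rewrite -RintegralD //; [|exact: ccont_Im_integrable..].
by apply: eq_Rintegral => t _; rewrite raddfD.
Qed.

Lemma cintZ a b c u : ccont a b u ->
  cint a b (fun t => c * u t) = c * cint a b u.
Proof.
move=> cu; have rI := ccont_Re_integrable cu; have iI := ccont_Im_integrable cu.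
have rZ k : lebesgue_measure.-integrable `[a, b]
    (EFin \o (fun t => k * complex.Re (u t))).
  by apply: eq_integrable (integrableZl _ k rI).
have iZ k : lebesgue_measure.-integrable `[a, b]
    (EFin \o (fun t => k * complex.Im (u t))).
  by apply: eq_integrable (integrableZl _ k iI).
case: c => x y; apply/eqP; rewrite eq_complex /=.
apply/andP; split; apply/eqP.
  rewrite -!RintegralZl // -RintegralB //.
  by apply: eq_Rintegral => t _; case: (u t).
rewrite -!RintegralZl // -RintegralD //.
by apply: eq_Rintegral => t _; case: (u t).
Qed.

Lemma cintN a b u : ccont a b u -> cint a b (fun t => - u t) = - cint a b u.
Proof.
move=> cu; rewrite -mulN1r -cintZ //; apply: eq_cint => t _.
by rewrite mulN1r.
Qed.

Lemma cintB a b u v : ccont a b u -> ccont a b v ->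
  cint a b (fun t => u t - v t) = cint a b u - cint a b v.
Proof. by move=> cu cv; rewrite cintD ?cintN //; apply: ccontN. Qed.

Lemma cint_cst a b c : a <= b -> cint a b (fun=> c) = c * (b - a)%:C.
Proof.
move=> ab; rewrite /cint !Rintegral_cst //= lebesgue_measure_itv /=.
rewrite lte_fin; case: ltP => [ltab|ba] /=.
  by case: c => x y; apply/eqP; rewrite eq_complex /=; apply/andP; split;
    apply/eqP; ring.
have -> : b - a = 0 by lra.
by case: c => x y; apply/eqP; rewrite eq_complex /=; apply/andP; split;
    apply/eqP; ring.
Qed.

Lemma cint_split a m b u : a <= m -> m <= b -> ccont a b u ->
  cint a b u = cint a m u + cint m b u.
Proof.
move=> am mb cu.
have rI := ccont_Re_integrable cu; have iI := ccont_Im_integrable cu.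
have key (f : R -> R) : lebesgue_measure.-integrable `[a, b] (EFin \o f) ->
    \int[lebesgue_measure]_(t in `[a, b]) f t =
    \int[lebesgue_measure]_(t in `[a, m]) f t +
    \int[lebesgue_measure]_(t in `[m, b]) f t.
  move=> fi; have /= := @Rintegral_itvB R f (BLeft a) (BRight b) m fi.
  rewrite !bnd_simp => /(_ am mb) H.
  have <- : \int[lebesgue_measure]_(t in `]m, b]) f t =
      \int[lebesgue_measure]_(t in `[m, b]) f t.
    apply: Rintegral_itv_obnd_cbnd.
    apply: integrableS fi => //; apply: subset_itvr.
    by rewrite bnd_simp.
  by rewrite -H addrC subrK.
by apply/eqP; rewrite eq_complex /= -!key // !eqxx.
Qed.

Lemma Rint_bound a b (f : R -> R) M : a <= b ->
  lebesgue_measure.-integrable `[a, b] (EFin \o f) ->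
  (forall t, a <= t <= b -> `|f t| <= M) ->
  `|\int[lebesgue_measure]_(t in `[a, b]) f t| <= M * (b - a).
Proof.
move=> ab fi fM; apply: le_trans (le_normr_Rintegral _ fi) _ => //.
have -> : M * (b - a) = \int[lebesgue_measure]_(t in `[a, b]) M.
  rewrite Rintegral_cst //= lebesgue_measure_itv /= lte_fin.
  by case: ltP => //= ba; have -> : b - a = 0 by lra.
apply: le_Rintegral => //.
- exact: (integrable_norm fi).
- apply: continuous_compact_integrable; first exact: segment_compact.
  by apply: continuous_subspaceT => ?; exact: cvg_cst.
Qed.

(** Real and imaginary parts are bounded separately, at the price of the factor 2. *)
Lemma cint_bound a b u M : a <= b -> ccont a b u ->
  (forall t, a <= t <= b -> cmod (u t) <= M) ->
  cmod (cint a b u) <= 2 * M * (b - a).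
Proof.
move=> ab cu uM; apply: le_trans (cmod_le_ReIm _) _ => /=.
have -> : 2 * M * (b - a) = M * (b - a) + M * (b - a) by ring.
apply: lerD; apply: Rint_bound => //.
- exact: ccont_Re_integrable.
- by move=> t tab; apply: le_trans (ler_Re_cmod _) (uM t tab).
- exact: ccont_Im_integrable.
- by move=> t tab; apply: le_trans (ler_Im_cmod _) (uM t tab).
Qed.

End SegmentIntegral.

(** * Bisection of rectangles *)

Section NestedBisection.
Context {R : realType}.

Lemma halving_small (s r : R) : 0 <= s -> 0 < r -> exists n, s / 2 ^+ n < r.
Proof.
move=> s0 r0; have [n ns] : exists n, s / r < n%:R.
  by exists (Num.bound (s / r)); apply: archi_boundP; rewrite divr_ge0 // ltW.
exists n; rewrite ltr_pdivrMr ?exprn_gt0 //.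
move: ns; rewrite ltr_pdivrMr // => ns; apply: lt_le_trans ns _.
by rewrite mulrC ler_pM2l // -natrX ler_nat ltnW // ltn_expl.
Qed.

Lemma nested_halves (a b : nat -> R) : a 0 <= b 0 ->
  (forall n, let m := (a n + b n) / 2 in
     (a n.+1 = a n /\ b n.+1 = m) \/ (a n.+1 = m /\ b n.+1 = b n)) ->
  (forall n, b n - a n = (b 0 - a 0) / 2 ^+ n) /\
  exists p, forall n, a n <= p <= b n.
Proof.
move=> ab0 H.
have W n : b n - a n = (b 0 - a 0) / 2 ^+ n.
  elim: n => [|n IH]; first by rewrite expr0 divr1.
  rewrite exprS invfM mulrCA -IH.
  by case: (H n) => -[-> ->] /=; lra.
have ab n : a n <= b n by rewrite -subr_ge0 W divr_ge0 ?exprn_ge0 //; lra.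
have mono n m : (n <= m)%N -> a n <= a m /\ b m <= b n.
  elim: m => [|m IH]; first by rewrite leqn0 => /eqP ->.
  rewrite leq_eqVlt => /predU1P[-> //|/IH[h1 h2]].
  by have := ab m; case: (H m) => -[-> ->] /=; lra.
(* The common point is the supremum of the left endpoints, since each right endpoint bounds them
   all. *)
split=> //; exists (sup (range a)) => n.
have ub m : a m <= b n.
  case: (leqP n m) => [/mono[_]|/ltnW/mono[+ _]].
    by have := ab m; lra.
  by have := ab n; lra.
apply/andP; split.
  apply: ub_le_sup; last by exists n.
  by exists (b n) => _ [m _ <-].
by apply: ge_sup; [exists (a 0); exists 0|move=> _ [m _ <-]].
Qed.

(** Compactness in the form of an induction on rectangles: if [A] failed on the large one, a quarter
    on which it fails could be chosen again and again, and these quarters would shrink to a point,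
    where the last hypothesis gives [A]. *)
Lemma bisection2 (A : R -> R -> R -> R -> Prop) (X0 X1 Y0 Y1 : R) :
  X0 <= X1 -> Y0 <= Y1 ->
  (forall (x0 x1 y0 y1 : R), let x := (x0 + x1) / 2 in let y := (y0 + y1) / 2 in
     X0 <= x0 -> x0 <= x1 -> x1 <= X1 -> Y0 <= y0 -> y0 <= y1 -> y1 <= Y1 ->
     A x0 x y0 y -> A x x1 y0 y -> A x0 x y y1 -> A x x1 y y1 -> A x0 x1 y0 y1) ->
  (forall (px py : R), X0 <= px <= X1 -> Y0 <= py <= Y1 -> exists2 r, 0 < r &
     forall (x0 x1 y0 y1 : R), X0 <= x0 -> x1 <= X1 -> Y0 <= y0 -> y1 <= Y1 ->
       x0 <= px <= x1 -> y0 <= py <= y1 ->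
       x1 - x0 + (y1 - y0) < r -> A x0 x1 y0 y1) ->
  A X0 X1 Y0 Y1.
Proof.
move=> X01 Y01 split4 local; apply: contrapT => nA.
pose sub (q : (R * R) * (R * R)) :=
  [/\ X0 <= q.1.1, q.1.1 <= q.1.2 & q.1.2 <= X1] /\
  [/\ Y0 <= q.2.1, q.2.1 <= q.2.2 & q.2.2 <= Y1].
pose bad (q : (R * R) * (R * R)) := sub q /\ ~ A q.1.1 q.1.2 q.2.1 q.2.2.
pose half (i j : R * R) := let m := (i.1 + i.2) / 2 in
  (j.1 = i.1 /\ j.2 = m) \/ (j.1 = m /\ j.2 = i.2).
(* The implication sits under the existential so that [choice] yields a total function on
   rectangles, arbitrary on those that are not bad. *)
have step q : exists q', bad q -> bad q' /\ half q.1 q'.1 /\ half q.2 q'.2.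
  case: (pselect (bad q)) => [bq|nb]; last by exists q.
  case: q bq => -[x0 x1] [y0 y1] [[[/= a1 a2 a3] [/= b1 b2 b3]] nAq].
  set x := (x0 + x1) / 2; set y := (y0 + y1) / 2.
  have sx : x0 <= x <= x1 by rewrite /x; lra.
  have sy : y0 <= y <= y1 by rewrite /y; lra.
  have [hA|h1] := pselect (A x0 x y0 y); last first.
    exists ((x0, x), (y0, y)) => _; rewrite /bad /sub /half /=.
    by split; [split=> //; split; split; lra|split; left].
  have [hB|h2] := pselect (A x x1 y0 y); last first.
    exists ((x, x1), (y0, y)) => _; rewrite /bad /sub /half /=.
    by split; [split=> //; split; split; lra|split; [right|left]].
  have [hC|h3] := pselect (A x0 x y y1); last first.
    exists ((x0, x), (y, y1)) => _; rewrite /bad /sub /half /=.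
    by split; [split=> //; split; split; lra|split; [left|right]].
  have [hD|h4] := pselect (A x x1 y y1); last first.
    exists ((x, x1), (y, y1)) => _; rewrite /bad /sub /half /=.
    by split; [split=> //; split; split; lra|split; right].
  by case: nAq; apply: split4.
have [F HF] := choice step.
pose u n := iter n F ((X0, X1), (Y0, Y1)).
have bu n : bad (u n).
  elim: n => [|n IH]; last by have [] := HF _ IH.
  by split.
have hu n := (HF _ (bu n)).2.
have [Wx [px Px]] := @nested_halves (fun n => (u n).1.1) (fun n => (u n).1.2)
  X01 (fun n => (hu n).1).
have [Wy [py Py]] := @nested_halves (fun n => (u n).2.1) (fun n => (u n).2.2)
  Y01 (fun n => (hu n).2).
have [r r0 Hr] := local px py (Px 0) (Py 0).
have [n Hn] : exists n, (X1 - X0 + (Y1 - Y0)) / 2 ^+ n < r.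
  by apply: halving_small => //; lra.
have [[[a1 a2 a3] [b1 b2 b3]] nAn] := bu n.
apply: nAn; apply: Hr => //.
by rewrite Wx Wy /= -mulrDl.
Qed.

End NestedBisection.

(** * Goursat's lemma for rectangles *)

Section Goursat.
Context {R : realType}.
Implicit Types (f g : R[i] -> R[i]) (z w d p : R[i]) (x y : R).

Definition contat f w := forall e : R, 0 < e -> exists2 r : R, 0 < r &
  forall v : R[i], cmod (v - w) < r -> cmod (f v - f w) <= e.

Lemma cdiff_contat f z d : cdiff f z d -> contat f z.
Proof.
move=> fd e e0; have [r r0 fr] := fd 1 ltr01.
have d0 := cmod_ge0 d.
have q0 : 0 < e / (1 + cmod d) by rewrite divr_gt0 //; lra.
exists (Num.min r (e / (1 + cmod d))); first by rewrite lt_min r0.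
move=> v; rewrite lt_min => /andP[vr ve].
have := fr (v - z) vr; rewrite (addrC z) subrK => H.
have -> : f v - f z = (f v - f z - d * (v - z)) + d * (v - z) by ring.
apply: le_trans (cmodD _ _) _; rewrite cmodM.
move: ve; rewrite ltr_pdivlMr; last by lra.
by nra.
Qed.

Lemma ccont_hline f y a b : (forall x, a <= x <= b -> contat f (x +i* y)) ->
  ccont a b (fun x => f (x +i* y)).
Proof.
move=> fc x xab e e0; have [r r0 fr] := fc x xab e e0.
exists r => // s sx; apply: fr.
suff -> : (s +i* y) - (x +i* y) = (s - x)%:C :> R[i] by rewrite cmodR.
by apply/eqP; rewrite eq_complex /= subrr !eqxx.
Qed.

Lemma ccont_vline f x a b : (forall y, a <= y <= b -> contat f (x +i* y)) ->
  ccont a b (fun y => f (x +i* y)).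
Proof.
move=> fc y yab e e0; have [r r0 fr] := fc y yab e e0.
exists r => // s sy; apply: fr.
suff -> : (x +i* s) - (x +i* y) = 'i * (s - y)%:C :> R[i].
  by rewrite cmodM cmodR cmodi mul1r.
by apply/eqP; rewrite eq_complex /=; apply/andP; split; apply/eqP; ring.
Qed.

(** The counterclockwise boundary integral of a rectangle; opposite edges share their parameter
    interval and are put under one integral. *)
Definition contour f (x0 x1 y0 y1 : R) : R[i] :=
  cint x0 x1 (fun x => f (x +i* y0) - f (x +i* y1)) +
  'i * cint y0 y1 (fun y => f (x1 +i* y) - f (x0 +i* y)).

Lemma contour_splitx f x0 m x1 y0 y1 : x0 <= m -> m <= x1 -> y0 <= y1 ->
  ccont x0 x1 (fun x => f (x +i* y0)) -> ccont x0 x1 (fun x => f (x +i* y1)) ->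
  ccont y0 y1 (fun y => f (x0 +i* y)) -> ccont y0 y1 (fun y => f (m +i* y)) ->
  ccont y0 y1 (fun y => f (x1 +i* y)) ->
  contour f x0 x1 y0 y1 = contour f x0 m y0 y1 + contour f m x1 y0 y1.
Proof.
move=> xm mx y01 h0 h1 v0 vm v1; rewrite /contour.
rewrite (@cint_split _ x0 m x1) //; last exact: ccontB.
by rewrite !(cintB (a := y0)) //; ring.
Qed.

Lemma contour_splity f x0 x1 y0 m y1 : y0 <= m -> m <= y1 -> x0 <= x1 ->
  ccont y0 y1 (fun y => f (x0 +i* y)) -> ccont y0 y1 (fun y => f (x1 +i* y)) ->
  ccont x0 x1 (fun x => f (x +i* y0)) -> ccont x0 x1 (fun x => f (x +i* m)) ->
  ccont x0 x1 (fun x => f (x +i* y1)) ->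
  contour f x0 x1 y0 y1 = contour f x0 x1 y0 m + contour f x0 x1 m y1.
Proof.
move=> xm mx y01 h0 h1 v0 vm v1; rewrite /contour.
rewrite (@cint_split _ y0 m y1) //; last exact: ccontB.
by rewrite !(cintB (a := x0)) //; ring.
Qed.

Lemma contour_bound f x0 x1 y0 y1 M : x0 <= x1 -> y0 <= y1 ->
  ccont y0 y1 (fun y => f (x0 +i* y)) -> ccont y0 y1 (fun y => f (x1 +i* y)) ->
  ccont x0 x1 (fun x => f (x +i* y0)) -> ccont x0 x1 (fun x => f (x +i* y1)) ->
  (forall x, x0 <= x <= x1 -> cmod (f (x +i* y0)) <= M /\ cmod (f (x +i* y1)) <= M) ->
  (forall y, y0 <= y <= y1 -> cmod (f (x0 +i* y)) <= M /\ cmod (f (x1 +i* y)) <= M) ->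
  cmod (contour f x0 x1 y0 y1) <= 4 * M * (x1 - x0 + (y1 - y0)).
Proof.
move=> x01 y01 v0 v1 h0 h1 bh bv; rewrite /contour.
apply: le_trans (cmodD _ _) _; rewrite cmodM cmodi mul1r.
have -> : 4 * M * (x1 - x0 + (y1 - y0)) =
  2 * (2 * M) * (x1 - x0) + 2 * (2 * M) * (y1 - y0) by ring.
apply: lerD; apply: cint_bound => //; try exact: ccontB.
  by move=> x /bh[b1 b2]; apply: le_trans (cmodB _ _) _; lra.
by move=> y /bv[b1 b2]; apply: le_trans (cmodB _ _) _; lra.
Qed.

(** Subtracting the tangent affine map at [p] does not change the contour integral, and what remains
    is small compared with the size of the rectangle. *)
Lemma contour_local f p d : cdiff f p d -> forall e : R, 0 < e ->
  exists2 r : R, 0 < r & forall (x0 x1 y0 y1 : R),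
    x0 <= complex.Re p <= x1 -> y0 <= complex.Im p <= y1 ->
    ccont y0 y1 (fun y => f (x0 +i* y)) -> ccont y0 y1 (fun y => f (x1 +i* y)) ->
    ccont x0 x1 (fun x => f (x +i* y0)) -> ccont x0 x1 (fun x => f (x +i* y1)) ->
    x1 - x0 + (y1 - y0) < r ->
    cmod (contour f x0 x1 y0 y1) <= e * (x1 - x0 + (y1 - y0)) ^+ 2.
Proof.
(* The divisor 4 absorbs the two edges in each difference and the factor 2 of [cint_bound]. *)
case: p => a b fd e e0; have e4 : 0 < e / 4 by lra.
have [r r0 fr] := fd _ e4.
exists r => // x0 x1 y0 y1 xa yb v0 v1 h0 h1; rewrite /= in xa yb.
set s := (x1 - x0 + (y1 - y0)) => sr.
pose E w := f w - f (a +i* b) - d * (w - (a +i* b)).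
have HE x y : x0 <= x <= x1 -> y0 <= y <= y1 -> cmod (E (x +i* y)) <= e / 4 * s.
  move=> hx hy; set h := (x +i* y) - (a +i* b).
  have hs : cmod h <= s.
    apply: le_trans (cmod_le_ReIm _) _; rewrite /s; apply: lerD => /=;
    by rewrite ler_norml; lra.
  have := fr h (le_lt_trans hs sr).
  have -> : a +i* b + h = x +i* y by rewrite /h; ring.
  by move/le_trans; apply; rewrite ler_wpM2l // ltW.
have x01 : x0 <= x1 by lra.
have y01 : y0 <= y1 by lra.
pose W : R[i] := (x1 - x0)%:C; pose H : R[i] := (y1 - y0)%:C.
(* The linear part contributes [- d * 'i * H] to the difference of the horizontal edges and [d * W]
   to that of the vertical ones; after integration the two contributions cancel. *)
have -> : contour f x0 x1 y0 y1 =
  cint x0 x1 (fun x => (f (x +i* y0) - f (x +i* y1)) + d * 'i * H) +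
  'i * cint y0 y1 (fun y => (f (x1 +i* y) - f (x0 +i* y)) - d * W).
  rewrite cintD; [|exact: ccontB|exact: ccont_cst].
  rewrite (cintB (a := y0)); [|exact: ccontB|exact: ccont_cst].
  by rewrite !cint_cst // /contour -/W -/H; ring.
apply: le_trans (cmodD _ _) _; rewrite cmodM cmodi mul1r.
have -> : e * s ^+ 2 = 2 * (2 * (e / 4 * s)) * (x1 - x0)
    + 2 * (2 * (e / 4 * s)) * (y1 - y0) by rewrite /s; field.
apply: lerD; apply: cint_bound => //.
- by apply: ccontD; [exact: ccontB|exact: ccont_cst].
- move=> x hx.
  have -> : f (x +i* y0) - f (x +i* y1) + d * 'i * H =
      E (x +i* y0) - E (x +i* y1).
    have HE' : 'i * H = (x +i* y1) - (x +i* y0).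
      by apply/eqP; rewrite eq_complex /=; apply/andP; split; apply/eqP; ring.
    by rewrite -mulrA HE' /E; ring.
  apply: le_trans (cmodB _ _) _.
  have := HE x y0 hx; have := HE x y1 hx.
  by rewrite !lexx !y01 => /(_ isT) ? /(_ isT); lra.
- by apply: ccontB; [exact: ccontB|exact: ccont_cst].
- move=> y hy.
  have -> : f (x1 +i* y) - f (x0 +i* y) - d * W =
      E (x1 +i* y) - E (x0 +i* y).
    have HW : W = (x1 +i* y) - (x0 +i* y).
      by apply/eqP; rewrite eq_complex /=; apply/andP; split; apply/eqP; ring.
    by rewrite HW /E; ring.
  apply: le_trans (cmodB _ _) _.
  have HE0 := HE x0 y; have HE1 := HE x1 y.
  by rewrite !lexx !x01 in HE0 HE1; have := HE0 isT hy; have := HE1 isT hy; lra.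
Qed.

Definition cholo_at f w := exists d, cdiff f w d.

(** The bound [e * s ^+ 2], with [s] the half-perimeter, is exactly additive under division into
    four equal quarters. By [bisection2] it passes from small rectangles to the whole one, and [e]
    is arbitrary. *)
Lemma goursat f (X0 X1 Y0 Y1 : R) : X0 <= X1 -> Y0 <= Y1 ->
  (forall x y, X0 <= x <= X1 -> Y0 <= y <= Y1 -> cholo_at f (x +i* y)) ->
  contour f X0 X1 Y0 Y1 = 0.
Proof.
move=> X01 Y01 fd.
have fc x y : X0 <= x <= X1 -> Y0 <= y <= Y1 -> contat f (x +i* y).
  by move=> hx hy; have [d /cdiff_contat] := fd x y hx hy.
have hc (x0 x1 y : R) : X0 <= x0 -> x1 <= X1 -> Y0 <= y -> y <= Y1 ->
    ccont x0 x1 (fun x => f (x +i* y)).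
  move=> h1 h2 h3 h4; apply: ccont_hline => x /andP[h5 h6]; apply: fc.
    by rewrite (le_trans h1 h5) (le_trans h6 h2).
  by rewrite h3 h4.
have vc (y0 y1 x : R) : Y0 <= y0 -> y1 <= Y1 -> X0 <= x -> x <= X1 ->
    ccont y0 y1 (fun y => f (x +i* y)).
  move=> h1 h2 h3 h4; apply: ccont_vline => y /andP[h5 h6]; apply: fc.
    by rewrite h3 h4.
  by rewrite (le_trans h1 h5) (le_trans h6 h2).
pose S := (X1 - X0 + (Y1 - Y0)) ^+ 2.
have key (e : R) : 0 < e -> cmod (contour f X0 X1 Y0 Y1) <= e * S.
  move=> e0.
  apply: (@bisection2 R (fun x0 x1 y0 y1 =>
    cmod (contour f x0 x1 y0 y1) <= e * (x1 - x0 + (y1 - y0)) ^+ 2)) => //.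
  - move=> x0 x1 y0 y1 x y h1 h2 h3 h4 h5 h6 A1 A2 A3 A4.
    have -> : e * (x1 - x0 + (y1 - y0)) ^+ 2 =
       (e * (x - x0 + (y - y0)) ^+ 2 + e * (x - x0 + (y1 - y)) ^+ 2) +
       (e * (x1 - x + (y - y0)) ^+ 2 + e * (x1 - x + (y1 - y)) ^+ 2).
      by rewrite /x /y; field.
    have [s1 s2 s3 s4] : [/\ x0 <= x, x <= x1, y0 <= y & y <= y1].
      by rewrite /x /y; clear -h2 h5; split; lra.
    have s5 := le_trans h1 s1; have s6 := le_trans s2 h3.
    have s7 := le_trans h4 s3; have s8 := le_trans s4 h6.
    have s9 := le_trans h1 h2; have s10 := le_trans h2 h3.
    have s11 := le_trans h4 h5; have s12 := le_trans h5 h6.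
    move: x y s1 s2 s3 s4 s5 s6 s7 s8 A1 A2 A3 A4.
    move=> x y s1 s2 s3 s4 s5 s6 s7 s8 A1 A2 A3 A4.
    rewrite (@contour_splitx f x0 x x1) //; try exact: hc; try exact: vc.
    rewrite (@contour_splity f x0 x y0 y y1) //; try exact: hc; try exact: vc.
    rewrite (@contour_splity f x x1 y0 y y1) //; try exact: hc; try exact: vc.
    apply: le_trans (cmodD _ _) _; apply: lerD; apply: le_trans (cmodD _ _) _;
    exact: lerD.
  move=> px py hx hy; have [d fdp] := fd px py hx hy.
  have [r r0 Hr] := contour_local fdp e0.
  exists r => // x0 x1 y0 y1 h1 h2 h3 h4 h5 h6 h7.
  have /andP[s1 s2] := h5; have /andP[s3 s4] := h6.
  have /andP[t1 t2] := hx; have /andP[t3 t4] := hy.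
  by apply: Hr => //; [apply: vc|apply: vc|apply: hc|apply: hc] => //;
    [exact: le_trans t2|exact: le_trans s2|exact: le_trans t4|exact: le_trans s4].
apply/eqP; rewrite -cmod_eq0; apply/eqP/le_anti; rewrite cmod_ge0 andbT.
apply/ler_addgt0Pr => e e0; rewrite add0r.
have S0 : 0 <= S by rewrite sqr_ge0.
have S1 : 0 < S + 1 by rewrite ltr_wpDl.
have q0 : 0 < e / (S + 1) by rewrite divr_gt0.
apply: le_trans (key _ q0) _; rewrite -mulrA ger_pMr //.
by rewrite ler_pdivrMl // mulr1 lerDl.
Qed.

(** The frame between the two rectangles is cut into two columns of full height and the two ends of
    the middle column; [goursat] applies to each of the four pieces. *)
Lemma goursat_cut f (X0 x0 x1 X1 Y0 y0 y1 Y1 : R) :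
  X0 <= x0 -> x0 <= x1 -> x1 <= X1 -> Y0 <= y0 -> y0 <= y1 -> y1 <= Y1 ->
  (forall x y, X0 <= x <= X1 -> Y0 <= y <= Y1 ->
     [|| x <= x0, x1 <= x, y <= y0 | y1 <= y] -> cholo_at f (x +i* y)) ->
  contour f X0 X1 Y0 Y1 = contour f x0 x1 y0 y1.
Proof.
move=> X0x x01 xX1 Y0y y01 yY1 fd.
have fc x y : X0 <= x <= X1 -> Y0 <= y <= Y1 ->
    [|| x <= x0, x1 <= x, y <= y0 | y1 <= y] -> contat f (x +i* y).
  by move=> hx hy hn; have [d /cdiff_contat] := fd x y hx hy hn.
have X01 : X0 <= X1 by lra.
have Y01 : Y0 <= Y1 by lra.
have hc (u v y : R) : X0 <= u -> v <= X1 -> Y0 <= y -> y <= Y1 ->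
    (y <= y0) || (y1 <= y) -> ccont u v (fun x => f (x +i* y)).
  move=> h1 h2 h3 h4 hn; apply: ccont_hline => x /andP[h5 h6]; apply: fc.
  - by rewrite (le_trans h1 h5) (le_trans h6 h2).
  - by rewrite h3 h4.
  - by rewrite hn !orbT.
have vc (u v x : R) : Y0 <= u -> v <= Y1 -> X0 <= x -> x <= X1 ->
    (x <= x0) || (x1 <= x) -> ccont u v (fun y => f (x +i* y)).
  move=> h1 h2 h3 h4 hn; apply: ccont_vline => y /andP[h5 h6]; apply: fc.
  - by rewrite h3 h4.
  - by rewrite (le_trans h1 h5) (le_trans h6 h2).
  - by case/orP: hn => ->; rewrite ?orbT.
have [xX0 Xx1 yY0 Yy1] : [/\ X0 <= x1, x0 <= X1, Y0 <= y1 & y0 <= Y1].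
  by split; lra.
rewrite (@contour_splitx f X0 x0 X1) //;
  try (by apply: hc; rewrite ?lexx ?Y0y ?yY1 ?orbT);
  try (by apply: vc; rewrite ?lexx ?X0x ?xX1 ?orbT).
rewrite (@contour_splitx f x0 x1 X1) //;
  try (by apply: hc; rewrite ?lexx ?Y0y ?yY1 ?orbT);
  try (by apply: vc; rewrite ?lexx ?X0x ?xX1 ?orbT).
rewrite (@contour_splity f x0 x1 Y0 y0 Y1) //;
  try (by apply: hc; rewrite ?lexx ?Y0y ?yY1 ?orbT);
  try (by apply: vc; rewrite ?lexx ?X0x ?xX1 ?orbT).
rewrite (@contour_splity f x0 x1 y0 y1 Y1) //;
  try (by apply: hc; rewrite ?lexx ?Y0y ?yY1 ?orbT);
  try (by apply: vc; rewrite ?lexx ?X0x ?xX1 ?orbT).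
rewrite (@goursat f X0 x0) //; last first.
  move=> x y /andP[h1 h2] hy; apply: fd => //; last by rewrite h2.
  by rewrite h1 (le_trans h2).
rewrite (@goursat f x1 X1) //; last first.
  move=> x y /andP[h1 h2] hy; apply: fd => //; last by rewrite h1 !orbT.
  by rewrite h2 (le_trans _ h1).
rewrite (@goursat f x0 x1 Y0 y0) //; last first.
  move=> x y /andP[h1 h2] /andP[h3 h4]; apply: fd; last by rewrite h4 !orbT.
    by rewrite (le_trans _ h1) // (le_trans h2).
  by rewrite h3 (le_trans h4).
rewrite (@goursat f x0 x1 y1 Y1) //; last first.
  move=> x y /andP[h1 h2] /andP[h3 h4]; apply: fd; last by rewrite h3 !orbT.
    by rewrite (le_trans _ h1) // (le_trans h2).
  by rewrite h4 (le_trans _ h3).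
by rewrite !add0r !addr0.
Qed.

(** [goursat_cut] shrinks the contour to a square of side [2 * e] around the puncture, where
    boundedness of [f] makes the integral of order [e]. The function itself is not extended over the
    puncture. *)
Lemma goursat_punctured f (a b M r X0 X1 Y0 Y1 : R) :
  X0 < a < X1 -> Y0 < b < Y1 -> 0 < r ->
  (forall w, w != a +i* b -> cmod (w - (a +i* b)) < r -> cmod (f w) <= M) ->
  (forall x y, X0 <= x <= X1 -> Y0 <= y <= Y1 -> x +i* y != a +i* b ->
     cholo_at f (x +i* y)) ->
  contour f X0 X1 Y0 Y1 = 0.
Proof.
move=> Xa Yb r0 fM fd.
have key (e : R) : 0 < e -> e < a - X0 -> e < X1 - a -> e < b - Y0 -> e < Y1 - b ->
    2 * e < r -> cmod (contour f X0 X1 Y0 Y1) <= 16 * M * e.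
  move=> e0 e1 e2 e3 e4 e5.
  have ne x y : [|| x <= a - e, a + e <= x, y <= b - e | b + e <= y] ->
      x +i* y != a +i* b.
    apply: contraTneq => -[-> ->]; rewrite !negb_or -!ltNge.
    by apply/and4P; split; lra.
  rewrite (@goursat_cut f X0 (a - e) (a + e) X1 Y0 (b - e) (b + e) Y1); last first.
    by move=> x y hx hy /ne; apply: fd.
  all: try by clear -e0 e1 e2 e3 e4; lra.
  have -> : 16 * M * e = 4 * M * (a + e - (a - e) + (b + e - (b - e))) by ring.
  have fc x y : a - e <= x <= a + e -> b - e <= y <= b + e ->
      [|| x <= a - e, a + e <= x, y <= b - e | b + e <= y] -> contat f (x +i* y).
    move=> hx hy /ne hn; have [||d /cdiff_contat //] := fd x y _ _ hn.
      by clear -hx e1 e2; lra.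
    by clear -hy e3 e4; lra.
  have B x y : a - e <= x <= a + e -> b - e <= y <= b + e ->
      [|| x <= a - e, a + e <= x, y <= b - e | b + e <= y] ->
      cmod (f (x +i* y)) <= M.
    move=> hx hy /ne hn; apply: fM => //.
    apply: le_lt_trans (cmod_le_ReIm _) _ => /=; apply: le_lt_trans e5.
    have -> : 2 * e = e + e by ring.
    by apply: lerD; rewrite ler_norml; [clear -hx|clear -hy]; lra.
  have ia : a - e <= a + e by clear -e0; lra.
  have ib : b - e <= b + e by clear -e0; lra.
  apply: contour_bound => //; rewrite ?ia ?ib //.
  - by apply: ccont_vline => y hy; apply: fc; rewrite ?lexx.
  - by apply: ccont_vline => y hy; apply: fc; rewrite ?lexx ?ia ?orbT.
  - by apply: ccont_hline => y hy; apply: fc; rewrite ?lexx ?orbT ?ib.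
  - by apply: ccont_hline => y hy; apply: fc; rewrite ?lexx ?ib ?orbT.
  - by move=> x hx; split; apply: B; rewrite ?lexx ?ib ?orbT.
  - by move=> y hy; split; apply: B; rewrite ?lexx ?ia ?orbT.
apply/eqP; rewrite -cmod_eq0; apply/eqP/le_anti; rewrite cmod_ge0 andbT.
apply/ler_addgt0Pr => e e0; rewrite add0r.
have N0 : 0 < 16 * `|M| + 1 by rewrite ltr_pwDr // mulr_ge0.
(* [q] keeps the small square inside the rectangle and inside the ball where [M] bounds [f], and
   makes [16 * M * q] at most [e]. It is halved below because [key] asks for strict inequalities. *)
pose q := Num.min (Num.min (Num.min (a - X0) (X1 - a)) (Num.min (b - Y0) (Y1 - b)))
  (Num.min (r / 2) (e / (16 * `|M| + 1))).
have q0 : 0 < q by rewrite !lt_min !divr_gt0 // !subr_gt0; case/andP: Xa => -> ->; case/andP: Yb => -> ->.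
have := lexx q; rewrite {2}/q !le_min.
move=> /andP[/andP[/andP[k1 k2] /andP[k3 k4]] /andP[k5 k6]].
apply: le_trans (key (q / 2) _ _ _ _ _ _) _; try by clear -q0 k1 k2 k3 k4 k5; lra.
have m1 : M <= `|M| by exact: ler_norm.
have m2 : 0 <= `|M| by [].
move: k6; rewrite ler_pdivlMr // => k6.
clear -m1 m2 k6 q0 e0.
have : M * q <= `|M| * q by rewrite ler_wpM2r // ltW.
by nra.
Qed.

End Goursat.

(** * Rules for derivatives and continuity *)

Section DifferentiationRules.
Context {R : realType}.
Implicit Types (f g : R[i] -> R[i]) (z w d c : R[i]).

Lemma eq_cdiff f g z d (r : R) : 0 < r ->
  (forall w : R[i], cmod (w - z) < r -> f w = g w) -> cdiff f z d -> cdiff g z d.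
Proof.
move=> r0 fg fd e e0; have [q q0 fq] := fd e e0.
exists (Num.min q r); first by rewrite lt_min q0.
move=> h; rewrite lt_min => /andP[hq hr].
rewrite -!fg ?subrr ?cmod0 //; first exact: fq.
by rewrite addrC addKr.
Qed.

Lemma cdiff_cst c z : cdiff (fun=> c) z 0.
Proof.
move=> e e0; exists 1 => // h _.
by rewrite mul0r !subrr cmod0 mulr_ge0 ?cmod_ge0 // ltW.
Qed.

Lemma cdiff_id z : cdiff id z 1.
Proof.
move=> e e0; exists 1 => // h _.
have -> : z + h - z - 1 * h = 0 by ring.
by rewrite cmod0 mulr_ge0 ?cmod_ge0 // ltW.
Qed.

Lemma cdiffD f g z d d' : cdiff f z d -> cdiff g z d' ->
  cdiff (fun w => f w + g w) z (d + d').
Proof.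
move=> fd gd e e0; have e2 : 0 < e / 2 by rewrite divr_gt0.
have [r r0 fr] := fd _ e2; have [q q0 gq] := gd _ e2.
exists (Num.min r q); first by rewrite lt_min r0.
move=> h; rewrite lt_min => /andP[hr hq].
have -> : f (z + h) + g (z + h) - (f z + g z) - (d + d') * h =
  (f (z + h) - f z - d * h) + (g (z + h) - g z - d' * h) by ring.
apply: le_trans (cmodD _ _) _.
have -> : e * cmod h = e / 2 * cmod h + e / 2 * cmod h by field.
by apply: lerD; [exact: fr|exact: gq].
Qed.

Lemma cdiff_lipschitz f z d : cdiff f z d -> exists2 r : R, 0 < r &
  forall h : R[i], cmod h < r -> cmod (f (z + h) - f z) <= (1 + cmod d) * cmod h.
Proof.
move=> fd; have [r r0 fr] := fd 1 ltr01; exists r => // h hr.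
have -> : f (z + h) - f z = (f (z + h) - f z - d * h) + d * h by ring.
apply: le_trans (cmodD _ _) _; rewrite mulrDl cmodM.
by apply: lerD => //; exact: fr.
Qed.

Lemma cdiffM f g z d d' : cdiff f z d -> cdiff g z d' ->
  cdiff (fun w => f w * g w) z (d * g z + f z * d').
Proof.
move=> fd gd e e0.
have [rg rg0 gl] := cdiff_lipschitz gd.
(* [A] bounds [g] near [z]. The error of the product splits into three terms, each allotted a third
   of [e]. *)
set A := cmod (g z) + (1 + cmod d') * rg.
have c0 := cmod_ge0 d; have c0' := cmod_ge0 d'.
have g0 := cmod_ge0 (g z); have f0 := cmod_ge0 (f z).
have A0 : 0 <= A by rewrite /A; apply: addr_ge0 => //; apply: mulr_ge0; lra.
have eA : 0 < e / 3 / (A + 1) by rewrite !divr_gt0 //; lra.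
have ef : 0 < e / 3 / (cmod (f z) + 1) by rewrite !divr_gt0 //; lra.
have [r r0 fr] := fd _ eA; have [q q0 gq] := gd _ ef.
set B := cmod d * (1 + cmod d').
have B0 : 0 <= B by rewrite /B; apply: mulr_ge0; lra.
have eB : 0 < e / 3 / (B + 1) by rewrite !divr_gt0 //; lra.
exists (Num.min (Num.min r q) (Num.min rg (e / 3 / (B + 1)))).
  by rewrite !lt_min r0 q0 rg0.
move=> h; rewrite !lt_min => /andP[/andP[hr hq] /andP[hg hB]].
have h0 := cmod_ge0 h.
have gA : cmod (g (z + h)) <= A.
  have -> : g (z + h) = (g z) + (g (z + h) - g z) by ring.
  apply: le_trans (cmodD _ _) _; rewrite lerD2l.
  apply: le_trans (gl h hg) _; apply: ler_wpM2l; lra.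
have -> : f (z + h) * g (z + h) - f z * g z - (d * g z + f z * d') * h =
  (f (z + h) - f z - d * h) * g (z + h) + d * h * (g (z + h) - g z)
   + f z * (g (z + h) - g z - d' * h) by ring.
have -> : e * cmod h = e / 3 * cmod h + e / 3 * cmod h + e / 3 * cmod h by field.
have frac (x t : R) : 0 <= x -> 0 <= t -> e / 3 / (x + 1) * t * x <= e / 3 * t.
  move=> x0 t0; have -> : e / 3 / (x + 1) * t * x = e / 3 * t * (x / (x + 1)).
    by field; lra.
  apply: ler_piMr; first by rewrite mulr_ge0 // divr_ge0 // ltW.
  by rewrite ler_pdivrMr; lra.
apply: le_trans (cmodD _ _) _; apply: lerD; first apply: le_trans (cmodD _ _) _; first apply: lerD.
- rewrite cmodM; apply: le_trans (frac A (cmod h) A0 h0).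
  by apply: ler_pM; rewrite ?cmod_ge0 //; exact: fr.
- rewrite !cmodM; apply: le_trans (_ : cmod d * cmod h * ((1 + cmod d') * cmod h) <= _).
    by apply: ler_wpM2l; [rewrite mulr_ge0|exact: gl].
  have -> : cmod d * cmod h * ((1 + cmod d') * cmod h) = cmod h * cmod h * B.
    by rewrite /B; ring.
  apply: le_trans (frac B (cmod h) B0 h0); apply: ler_wpM2r => //.
  by apply: ler_wpM2r => //; exact: ltW.
- rewrite cmodM mulrC; apply: le_trans (frac _ (cmod h) f0 h0).
  by apply: ler_wpM2r => //; exact: gq.
Qed.

Lemma cdiffZ f z d c : cdiff f z d -> cdiff (fun w => c * f w) z (c * d).
Proof.
by move=> fd; have := cdiffM (cdiff_cst c z) fd; rewrite mul0r add0r.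
Qed.

Lemma cdiffB f g z d d' : cdiff f z d -> cdiff g z d' ->
  cdiff (fun w => f w - g w) z (d - d').
Proof.
move=> fd gd; have := cdiffD fd (cdiffZ (-1) gd).
rewrite mulN1r; apply: (eq_cdiff ltr01) => w _.
by rewrite mulN1r.
Qed.

Lemma cdiff_inv z : z != 0 -> cdiff (fun w => w^-1) z (- z^-2).
Proof.
move=> z0 e e0; have c0 : 0 < cmod z by rewrite cmod_gt0.
exists (Num.min (cmod z / 2) (e * cmod z ^+ 3 / 2)).
  by rewrite lt_min !divr_gt0 ?mulr_gt0 ?exprn_gt0.
move=> h; rewrite lt_min => /andP[h1 h2].
have k1 : cmod z / 2 <= cmod (z + h).
  by have := cmod_ge_sub z h; lra.
have zh : z + h != 0 by rewrite -cmod_gt0; lra.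
have -> : (z + h)^-1 - z^-1 - - z^-2 * h = h * (h / ((z + h) * z ^+ 2)).
  by field; rewrite zh z0.
rewrite cmodM mulrC; apply: ler_wpM2r; first exact: cmod_ge0.
rewrite cmodf cmodM cmodX ler_pdivrMr; last first.
  by rewrite mulr_gt0 ?exprn_gt0 //; lra.
apply: le_trans (ltW h2) _.
have -> : e * cmod z ^+ 3 / 2 = e * (cmod z / 2 * cmod z ^+ 2) by field.
by rewrite ler_pM2l // ler_pM2r ?exprn_gt0.
Qed.

Lemma cdiff_comp f g z d d' : cdiff g z d' -> cdiff f (g z) d ->
  cdiff (fun w => f (g w)) z (d * d').
Proof.
move=> gd fd e e0.
have [rg rg0 gl] := cdiff_lipschitz gd.
have c0 := cmod_ge0 d; have c0' := cmod_ge0 d'.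
have e1 : 0 < e / 2 / (1 + cmod d') by rewrite !divr_gt0 //; lra.
have e2 : 0 < e / 2 / (1 + cmod d) by rewrite !divr_gt0 //; lra.
have [r r0 fr] := fd _ e1; have [q q0 gq] := gd _ e2.
have s0 : 0 < r / (1 + cmod d') by rewrite divr_gt0 //; lra.
exists (Num.min (Num.min rg q) (r / (1 + cmod d'))).
  by rewrite !lt_min rg0 q0.
move=> h; rewrite !lt_min => /andP[/andP[hg hq] hr].
have h0 := cmod_ge0 h.
set k := g (z + h) - g z.
have kl : cmod k <= (1 + cmod d') * cmod h by exact: gl.
have kr : cmod k < r.
  by apply: le_lt_trans kl _; rewrite mulrC -ltr_pdivlMr //; lra.
have := fr k kr; have -> : g z + k = g (z + h) by rewrite /k; ring.
move=> Hf.
have -> : f (g (z + h)) - f (g z) - d * d' * h =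
  (f (g (z + h)) - f (g z) - d * k) + d * (g (z + h) - g z - d' * h).
  by rewrite /k; ring.
apply: le_trans (cmodD _ _) _.
have -> : e * cmod h = e / 2 * cmod h + e / 2 * cmod h by field.
apply: lerD.
  apply: le_trans Hf _.
  have -> : e / 2 * cmod h = e / 2 / (1 + cmod d') * ((1 + cmod d') * cmod h).
    by field; lra.
  by apply: ler_wpM2l => //; exact: ltW.
rewrite cmodM; have := gq h hq => Hg.
apply: le_trans (_ : (1 + cmod d) * (e / 2 / (1 + cmod d) * cmod h) <= _).
  by apply: ler_pM; rewrite ?cmod_ge0 //; lra.
by rewrite le_eqVlt; apply/orP; left; apply/eqP; field; lra.
Qed.

Lemma contatM f g w : contat f w -> contat g w -> contat (fun v => f v * g v) w.
Proof.
move=> fc gc e e0.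
have g0 := cmod_ge0 (g w); have f0 := cmod_ge0 (f w).
have e1 : 0 < e / 2 / (cmod (g w) + 1) by rewrite !divr_gt0 //; lra.
have e2 : 0 < Num.min 1 (e / 2 / (cmod (f w) + 1)).
  by rewrite lt_min ltr01 !divr_gt0 //; lra.
have [r r0 fr] := fc _ e1; have [q q0 gq] := gc _ e2.
exists (Num.min r q); first by rewrite lt_min r0.
move=> v; rewrite lt_min => /andP[vr vq].
have -> : f v * g v - f w * g w = (f v - f w) * g v + f w * (g v - g w) by ring.
have := gq v vq; rewrite le_min => /andP[g1 g2].
have gv : cmod (g v) <= cmod (g w) + 1.
  have -> : g v = g w + (g v - g w) by ring.
  by apply: le_trans (cmodD _ _) _; rewrite lerD2l.
apply: le_trans (cmodD _ _) _; rewrite !cmodM.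
have -> : e = e / 2 / (cmod (g w) + 1) * (cmod (g w) + 1) +
   (cmod (f w) + 1) * (e / 2 / (cmod (f w) + 1)) by field; rewrite !gt_eqF //; lra.
apply: lerD; apply: ler_pM; rewrite ?cmod_ge0 //; first exact: fr.
by rewrite lerDl.
Qed.

Lemma contatB f g w : contat f w -> contat g w -> contat (fun v => f v - g v) w.
Proof.
move=> fc gc e e0; have e2 : 0 < e / 2 by rewrite divr_gt0.
have [r r0 fr] := fc _ e2; have [q q0 gq] := gc _ e2.
exists (Num.min r q); first by rewrite lt_min r0.
move=> v; rewrite lt_min => /andP[vr vq].
have -> : f v - g v - (f w - g w) = (f v - f w) - (g v - g w) by ring.
apply: le_trans (cmodB _ _) _; have -> : e = e / 2 + e / 2 by field.
by apply: lerD; [exact: fr|exact: gq].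
Qed.

Lemma eq_contat f g w (r : R) : 0 < r -> (forall v : R[i], cmod (v - w) < r -> f v = g v) ->
  contat f w -> contat g w.
Proof.
move=> r0 fg fc e e0; have [q q0 fq] := fc e e0.
exists (Num.min q r); first by rewrite lt_min q0.
move=> v; rewrite lt_min => /andP[vq vr].
by rewrite -!fg ?subrr ?cmod0 //; exact: fq.
Qed.

End DifferentiationRules.

Lemma sqr_le_sym {R : realType} (u v : R) : - v <= u -> u <= v -> u ^+ 2 <= v ^+ 2.
Proof. by nra. Qed.

(** * Cauchy's formula on a rectangle and continuity of the derivative *)

Section CauchyFormula.
Context {R : realType}.
Variables (X0 X1 Y0 Y1 : R).
Hypotheses (X01 : X0 < X1) (Y01 : Y0 < Y1).
Implicit Types (f g : R[i] -> R[i]) (z w c d : R[i]) (a b : R).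

Definition on_boundary w :=
  [&& X0 <= complex.Re w <= X1, Y0 <= complex.Im w <= Y1 &
   [|| complex.Re w == X0, complex.Re w == X1, complex.Im w == Y0 | complex.Im w == Y1]].

Definition edge_cont f :=
  [/\ ccont Y0 Y1 (fun y => f (X0 +i* y)), ccont Y0 Y1 (fun y => f (X1 +i* y)),
   ccont X0 X1 (fun x => f (x +i* Y0)) & ccont X0 X1 (fun x => f (x +i* Y1))].

Local Notation cont f := (contour f X0 X1 Y0 Y1).

Lemma bdryL y : Y0 <= y <= Y1 -> on_boundary (X0 +i* y).
Proof. by move=> h; rewrite /on_boundary /= h eqxx lexx ltW. Qed.
Lemma bdryR y : Y0 <= y <= Y1 -> on_boundary (X1 +i* y).
Proof. by move=> h; rewrite /on_boundary /= h eqxx lexx ltW // orbT. Qed.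
Lemma bdryB x : X0 <= x <= X1 -> on_boundary (x +i* Y0).
Proof. by move=> h; rewrite /on_boundary /= h eqxx lexx ltW // !orbT. Qed.
Lemma bdryT x : X0 <= x <= X1 -> on_boundary (x +i* Y1).
Proof. by move=> h; rewrite /on_boundary /= h eqxx lexx ltW // !orbT. Qed.

Lemma edge_contP f : (forall w, on_boundary w -> contat f w) -> edge_cont f.
Proof.
move=> fc; split.
- by apply: ccont_vline => y hy; apply/fc/bdryL.
- by apply: ccont_vline => y hy; apply/fc/bdryR.
- by apply: ccont_hline => y hy; apply/fc/bdryB.
- by apply: ccont_hline => y hy; apply/fc/bdryT.
Qed.

Lemma eq_contour f g : (forall w, on_boundary w -> f w = g w) -> cont f = cont g.
Proof.
move=> fg; rewrite /contour; congr (_ + 'i * _); apply: eq_cint => t ht.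
  by rewrite !fg //; [exact: bdryT|exact: bdryB].
by rewrite !fg //; [exact: bdryL|exact: bdryR].
Qed.

Lemma contourD f g : edge_cont f -> edge_cont g ->
  cont (fun w => f w + g w) = cont f + cont g.
Proof.
move=> [f1 f2 f3 f4] [g1 g2 g3 g4]; rewrite /contour !cintB ?cintD //;
  try exact: ccontD.
by ring.
Qed.

Lemma contourZ c f : edge_cont f -> cont (fun w => c * f w) = c * cont f.
Proof.
move=> [f1 f2 f3 f4]; rewrite /contour !cintB ?cintZ //; try exact: ccontZ.
by ring.
Qed.

Lemma edge_contZ c f : edge_cont f -> edge_cont (fun w => c * f w).
Proof. by case=> *; split; apply: ccontZ. Qed.

Lemma contourB f g : edge_cont f -> edge_cont g ->
  cont (fun w => f w - g w) = cont f - cont g.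
Proof.
move=> fc gc; rewrite -[- cont g]mulN1r -contourZ // -contourD //.
  by apply: eq_contour => w _; rewrite mulN1r.
exact: edge_contZ.
Qed.

Lemma edge_cont_bound f : edge_cont f ->
  exists2 M, 0 <= M & forall w, on_boundary w -> cmod (f w) <= M.
Proof.
move=> [/ccont_bounded[M1 p1 b1] /ccont_bounded[M2 p2 b2] /ccont_bounded[M3 p3 b3]
  /ccont_bounded[M4 p4 b4]].
exists (M1 + M2 + M3 + M4) => [|[x y]]; first by rewrite !addr_ge0.
move=> /and3P[/= hx hy /or4P[] /eqP E]; rewrite E.
- by have := b1 _ hy; clear -p1 p2 p3 p4; lra.
- by have := b2 _ hy; clear -p1 p2 p3 p4; lra.
- by have := b3 _ hx; clear -p1 p2 p3 p4; lra.
- by have := b4 _ hx; clear -p1 p2 p3 p4; lra.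
Qed.

Lemma contour_le f M : edge_cont f -> (forall w, on_boundary w -> cmod (f w) <= M) ->
  cmod (cont f) <= 4 * M * (X1 - X0 + (Y1 - Y0)).
Proof.
move=> [f1 f2 f3 f4] fM; apply: contour_bound => //; try exact: ltW.
  by move=> x hx; split; apply: fM; [exact: bdryB|exact: bdryT].
by move=> y hy; split; apply: fM; [exact: bdryL|exact: bdryR].
Qed.

Lemma boundary_dist a b (r : R) w : X0 + r <= a <= X1 - r -> Y0 + r <= b <= Y1 - r ->
  on_boundary w -> r <= cmod (w - (a +i* b)).
Proof.
case: w => x y ha hb /and3P[/= hx hy hor].
have hR := ler_Re_cmod ((x +i* y) - (a +i* b)).
have hI := ler_Im_cmod ((x +i* y) - (a +i* b)).
move: hR hI; rewrite /= => hR hI.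
case/or4P: hor => /eqP E.
- apply: le_trans hR; rewrite ler_normr; apply/orP; right; clear -E ha; lra.
- apply: le_trans hR; rewrite ler_normr; apply/orP; left; clear -E ha; lra.
- apply: le_trans hI; rewrite ler_normr; apply/orP; right; clear -E hb; lra.
- apply: le_trans hI; rewrite ler_normr; apply/orP; left; clear -E hb; lra.
Qed.

Lemma cdiff_cauchy_kernel z w : w != z -> cdiff (fun v => (v - z)^-1) w (- (w - z)^-2).
Proof.
rewrite -subr_eq0 => wz.
have h1 : cdiff (fun v => v - z) w (1 - 0) by apply: cdiffB; [exact: cdiff_id|exact: cdiff_cst].
by have := cdiff_comp h1 (cdiff_inv wz); rewrite subr0 mulr1.
Qed.

(* Its value is [2 * pi * 'i] inside the square, but only its non-vanishing and its
   derivative are needed. *)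
Definition winding z := cont (fun w => (w - z)^-1).

(** The imaginary part is positive: for an interior point every edge contributes with the same sign,
    and the bottom edge contributes a strictly positive amount, estimated through the squared
    diagonal [D]. *)
Lemma winding_neq0 a b : X0 < a < X1 -> Y0 < b < Y1 -> winding (a +i* b) != 0.
Proof.
move=> ha hb; set z := a +i* b.
have ne w : on_boundary w -> w != z.
  move=> wb; rewrite -subr_eq0 -cmod_gt0.
  pose r := Num.min (Num.min (a - X0) (X1 - a)) (Num.min (b - Y0) (Y1 - b)).
  have r0 : 0 < r.
    by rewrite !lt_min !subr_gt0; case/andP: ha => -> ->; case/andP: hb => -> ->.
  have := lexx r; rewrite {2}/r !le_min => /andP[/andP[k1 k2] /andP[k3 k4]].
  apply: lt_le_trans r0 _; apply: boundary_dist wb; clear -k1 k2 k3 k4; lra.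
have [e1 e2 e3 e4] : edge_cont (fun w => (w - z)^-1).
  by apply: edge_contP => w /ne/cdiff_cauchy_kernel/cdiff_contat.
set D := (X1 - X0) ^+ 2 + (Y1 - Y0) ^+ 2.
have D0 : 0 < D by rewrite ltr_wpDl ?sqr_ge0 // exprn_gt0 // subr_gt0.
apply/negP => /eqP; rewrite /winding /contour => /(congr1 (@complex.Im R)).
rewrite raddfD /= mul0r mul1r add0r => H.
have hA : (b - Y0) / D * (X1 - X0) <=
   \int[lebesgue_measure]_(t in `[X0, X1])
     complex.Im (((t +i* Y0) - z)^-1 - ((t +i* Y1) - z)^-1).
  have -> : (b - Y0) / D * (X1 - X0) =
      \int[lebesgue_measure]_(t in `[X0, X1]) ((b - Y0) / D).
    by rewrite Rintegral_cst //= lebesgue_measure_itv /= lte_fin X01.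
  apply: le_Rintegral => //.
  - apply: continuous_compact_integrable; first exact: segment_compact.
    by apply: continuous_subspaceT => ?; exact: cvg_cst.
  - by apply: ccont_Im_integrable; apply: ccontB.
  - move=> t /=; rewrite in_itv /= => ht /=; rewrite -mulNr opprK.
    apply: (@le_trans _ _ (- (Y0 - b) / ((t - a) ^+ 2 + (Y0 - b) ^+ 2))).
      rewrite opprB; apply: ler_wpM2l; first by rewrite subr_ge0; case/andP: hb => /ltW.
      rewrite lef_pV2 ?posrE //; last first.
        by rewrite ltr_wpDl ?sqr_ge0 // exprn_even_gt0 //= subr_eq0 lt_eqF //; case/andP: hb.
      by rewrite /D; apply: lerD; apply: sqr_le_sym; case/andP: ha => ? ?; case/andP: hb => ? ?;
        case/andP: ht => ? ?; lra.
    rewrite lerDl; apply: divr_ge0; last by rewrite addr_ge0 ?sqr_ge0.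
    by rewrite subr_ge0; case/andP: hb => _ /ltW.
have hB : 0 <= \int[lebesgue_measure]_(t in `[Y0, Y1])
     complex.Re (((X1 +i* t) - z)^-1 - ((X0 +i* t) - z)^-1).
  apply: Rintegral_ge0 => t /=; rewrite in_itv /= => ht /=.
  rewrite subr_ge0; apply: (@le_trans _ _ 0).
    apply: mulr_le0_ge0; last by rewrite invr_ge0 addr_ge0 // sqr_ge0.
    by rewrite subr_le0; case/andP: ha => /ltW.
  apply: divr_ge0; last by rewrite addr_ge0 ?sqr_ge0.
  rewrite subr_ge0.
  by case/andP: ha => _ /ltW.
have hC : 0 < (b - Y0) / D * (X1 - X0).
  by rewrite !mulr_gt0 ?invr_gt0 ?subr_gt0 //; case/andP: hb.
by rewrite /= in hA hB; move: (lt_le_trans hC hA) => hD; move: (ltr_pwDl hD hB); rewrite H ltxx.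
Qed.

(** The quotient [(f w - f z) / (w - z)] is holomorphic away from [z], and bounded near [z] because
    [f] is differentiable there, so [goursat_punctured] makes its contour integral vanish. *)
Lemma cauchy_formula f a b : X0 < a < X1 -> Y0 < b < Y1 ->
  (forall x y, X0 <= x <= X1 -> Y0 <= y <= Y1 -> cholo_at f (x +i* y)) ->
  cont (fun w => f w * (w - (a +i* b))^-1) = f (a +i* b) * winding (a +i* b).
Proof.
move=> ha hb fd; set z := a +i* b.
have [d fz] : cholo_at f z.
  by apply: fd; [case/andP: ha => /ltW -> /ltW ->|case/andP: hb => /ltW -> /ltW ->].
have [r r0 fl] := cdiff_lipschitz fz.
have ne w : on_boundary w -> w != z.
  move=> /and3P[_ _ h]; apply: contraTneq h => ->; rewrite /z /= !negb_or.
  case/andP: ha => h1 h2; case/andP: hb => h3 h4.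
  by rewrite (gt_eqF h1) (lt_eqF h2) (gt_eqF h3) (lt_eqF h4).
have kc : forall w, on_boundary w -> contat (fun w => (w - z)^-1) w.
  by move=> w /ne/cdiff_cauchy_kernel/cdiff_contat.
have fc : forall w, on_boundary w -> contat f w.
  by case=> x y /and3P[hx hy _]; have [d' /cdiff_contat] := fd x y hx hy.
apply/eqP; rewrite -subr_eq0 /winding -contourZ -?contourB; first last.
- exact: edge_contP.
- by apply/edge_contZ/edge_contP.
- by apply: edge_contP => w wb; apply: contatM; [exact: fc|exact: kc].
apply/eqP; rewrite -(@goursat_punctured R (fun w => (f w - f z) * (w - z)^-1)
  a b (1 + cmod d) r X0 X1 Y0 Y1) //.
- by apply: eq_contour => w _; ring.
- move=> w wz wr; have := fl (w - z) wr.
  rewrite (addrC z) subrK => H; rewrite cmodf ler_pdivrMr //.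
  by rewrite cmod_gt0 subr_eq0.
- move=> x y hx hy nz; have [d' fd'] := fd x y hx hy.
  have fd2 := cdiffB fd' (cdiff_cst (f z) (x +i* y)).
  by exists ((d' - 0) * ((x +i* y) - z)^-1 + (f (x +i* y) - f z) * - ((x +i* y) - z)^-2);
    apply: cdiffM fd2 (cdiff_cauchy_kernel nz).
Qed.

(** Differentiation under the integral sign made explicit. The contour stays at distance at least
    [2 * r] and the increment [h] below [r], so the kernels are bounded by powers of [1 / r]; the
    two remainders are [h ^+ 2] and [h] times bounded contour integrals. *)
Lemma cdiff_cauchy_transform f a b (r : R) : 0 < r ->
  X0 + 2 * r <= a <= X1 - 2 * r -> Y0 + 2 * r <= b <= Y1 - 2 * r ->
  (forall w, on_boundary w -> contat f w) ->
  cdiff (fun z => cont (fun w => f w * (w - z)^-1)) (a +i* b)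
    (cont (fun w => f w * (w - (a +i* b))^-2)) /\
  contat (fun z => cont (fun w => f w * (w - z)^-2)) (a +i* b).
Proof.
move=> r0 ha hb fc; set z := a +i* b.
have [M M0 fM] := edge_cont_bound (edge_contP fc).
have far w (h : R[i]) : on_boundary w -> cmod h < r -> r <= cmod (w - (z + h)).
  move=> wb hr; have : 2 * r <= cmod (w - z) by exact: boundary_dist wb.
  have := cmod_ge_sub (w - z) (- h); rewrite cmodN.
  have -> : w - z - h = w - (z + h) by ring.
  by clear -hr; lra.
have ne w (h : R[i]) : on_boundary w -> cmod h < r -> w != z + h.
  by move=> wb hr; rewrite -subr_eq0 -cmod_gt0; apply: lt_le_trans r0 (far w h wb hr).
have k1 (h : R[i]) w : on_boundary w -> cmod h < r -> contat (fun w => (w - (z + h))^-1) w.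
  by move=> wb hr; have := ne w h wb hr => /cdiff_cauchy_kernel/cdiff_contat.
have k2 (h : R[i]) w : on_boundary w -> cmod h < r -> contat (fun w => (w - (z + h))^-2) w.
  move=> wb hr; apply: (eq_contat (r := 1) _ _ (contatM (k1 h w wb hr) (k1 h w wb hr))) => //.
  by move=> v _; rewrite -invfM expr2.
have z00 : cmod (0 : R[i]) < r by rewrite cmod0.
set L := X1 - X0 + (Y1 - Y0).
have L0 : 0 <= L by rewrite addr_ge0 // subr_ge0 ltW.
(* One constant for both remainders: [2 / r ^+ 3] covers the sum of two kernels that occurs in the
   continuity part, each of them at most [1 / r ^+ 3]. *)
set K := 4 * (M * (2 / r ^+ 3)) * L.
have K0 : 0 <= K by rewrite /K !mulr_ge0 // invr_ge0 exprn_ge0 // ltW.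
have r3 : 0 < r ^+ 3 by rewrite exprn_gt0.
have bnd w (h : R[i]) : on_boundary w -> cmod h < r ->
    cmod ((w - (z + h))^-1 * (w - z)^-2) <= (r ^+ 3)^-1 /\
    cmod ((w - (z + h))^-2 * (w - z)^-1) <= (r ^+ 3)^-1.
  move=> wb hr; have f1 := far w h wb hr; have f2 := far w 0 wb z00.
  rewrite addr0 in f2; rewrite !cmodM !cmodV !cmodX -!invfM.
  have p1 := lt_le_trans r0 f1; have p2 := lt_le_trans r0 f2.
  have r00 := ltW r0.
  split; rewrite lef_pV2 ?posrE ?mulr_gt0 ?exprn_gt0 //.
    by rewrite exprS ler_pM ?exprn_ge0 // lerXn2r // nnegrE ltW.
  by rewrite exprSr ler_pM ?exprn_ge0 // lerXn2r // nnegrE ltW.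
have fin e : 0 < e -> 0 < Num.min r (e / (K + 1)).
  by move=> e0; rewrite lt_min r0 divr_gt0 // ltr_wpDl.
have K1 (e t : R) : 0 < e -> 0 <= t -> t < e / (K + 1) -> K * t <= e.
  move=> e0 t0; rewrite ltr_pdivlMr; last by rewrite ltr_wpDl.
  by clear -t0 K0; nra.
split.
  move=> e e0; exists (Num.min r (e / (K + 1))); first exact: fin.
  move=> h; rewrite lt_min => /andP[hr hK].
  have c1 : edge_cont (fun w => f w * (w - (z + h))^-1).
    by apply: edge_contP => w wb; apply: contatM; [exact: fc|exact: k1].
  have c2 : edge_cont (fun w => f w * (w - z)^-1).
    by apply: edge_contP => w wb; apply: contatM; [exact: fc|have := k1 0 w wb z00; rewrite addr0].
  have c3 : edge_cont (fun w => f w * (w - z)^-2).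
    by apply: edge_contP => w wb; apply: contatM; [exact: fc|have := k2 0 w wb z00; rewrite addr0].
  rewrite -contourB // (mulrC _ h) -contourZ // -contourB; last 2 first.
  - by apply: edge_contP => w wb; apply: contatB; apply: contatM; try exact: fc;
      [exact: k1|have := k1 0 w wb z00; rewrite addr0].
  - exact: edge_contZ.
  (* With [A = (w - z - h)^-1] and [B = (w - z)^-1] one has [A - B = h A B], hence
     [A - B - h B^2 = h^2 A B^2]. *)
  rewrite (_ : cont _ = h ^+ 2 *
     cont (fun w => f w * ((w - (z + h))^-1 * (w - z)^-2))); last first.
    rewrite -contourZ; last first.
      apply: edge_contP => w wb; apply: contatM; first exact: fc.
      by apply: contatM; [exact: k1|have := k2 0 w wb z00; rewrite addr0].
    apply: eq_contour => w wb; have := ne w h wb hr; have := ne w 0 wb z00.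
    rewrite addr0 -subr_eq0 => n1; rewrite -subr_eq0 => n2.
    by field; rewrite n1.
  rewrite cmodM cmodX expr2 -mulrA mulrC; apply: ler_wpM2r; first exact: cmod_ge0.
  apply: le_trans (K1 e _ e0 (cmod_ge0 h) hK); rewrite mulrC.
  apply: ler_wpM2r; first exact: cmod_ge0.
  apply: contour_le.
    apply: edge_contP => w wb; apply: contatM; first exact: fc.
    by apply: contatM; [exact: k1|have := k2 0 w wb z00; rewrite addr0].
  move=> w wb; rewrite cmodM; apply: ler_pM; rewrite ?cmod_ge0 ?fM //.
  apply: le_trans (bnd w h wb hr).1 _.
  by rewrite ler_peMl ?invr_ge0 ?ltW // ltr1n.
move=> e e0; exists (Num.min r (e / (K + 1))); first exact: fin.
move=> v; have -> : v = z + (v - z) by ring.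
set h := v - z; rewrite {1}addrC addKr lt_min => /andP[hr hK].
have c2 : edge_cont (fun w => f w * (w - (z + h))^-2).
  by apply: edge_contP => w wb; apply: contatM; [exact: fc|exact: k2].
have c3 : edge_cont (fun w => f w * (w - z)^-2).
  by apply: edge_contP => w wb; apply: contatM; [exact: fc|have := k2 0 w wb z00; rewrite addr0].
rewrite -contourB //.
(* In the same notation, [A^2 - B^2 = h (A B^2 + A^2 B)]. *)
rewrite (_ : cont _ = h * cont (fun w => f w * ((w - (z + h))^-1 * (w - z)^-2) +
    f w * ((w - (z + h))^-2 * (w - z)^-1))); last first.
  have ck w : on_boundary w ->
    contat (fun w => f w * ((w - (z + h))^-1 * (w - z)^-2)) w /\
    contat (fun w => f w * ((w - (z + h))^-2 * (w - z)^-1)) w.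
    move=> wb; split; apply: contatM; try exact: fc; apply: contatM;
    [exact: k1|have := k2 0 w wb z00; rewrite addr0 //|exact: k2|have := k1 0 w wb z00; rewrite addr0 //].
  rewrite [in RHS]contourD; try by apply: edge_contP => w /ck[].
  rewrite [in RHS]mulrDr -!contourZ; try by apply: edge_contP => w /ck[].
  rewrite -contourD; try by apply/edge_contZ/edge_contP => w /ck[].
  apply: eq_contour => w wb; have := ne w h wb hr; have := ne w 0 wb z00.
  rewrite addr0 -subr_eq0 => n1; rewrite -subr_eq0 => n2.
  by field; rewrite n1.
rewrite cmodM mulrC.
apply: le_trans (K1 e _ e0 (cmod_ge0 h) hK).
apply: ler_wpM2r; first exact: cmod_ge0.
apply: contour_le.
  apply: edge_contP => w wb.
  apply: (eq_contat (r := 1) _ _ (contatM (fc w wb) _)) => //; first by move=> u _; rewrite -mulrDr.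
  apply: (eq_contat (r := 1) (f := fun w => (w - (z + h))^-1 * (w - z)^-2 - (-1) * ((w - (z + h))^-2 * (w - z)^-1))) => //.
    by move=> u _; rewrite mulN1r opprK.
  apply: contatB; last apply: contatM; try apply: contatM.
  - exact: k1.
  - by have := k2 0 w wb z00; rewrite addr0.
  - by apply: cdiff_contat; exact: cdiff_cst.
  - exact: k2.
  - by have := k1 0 w wb z00; rewrite addr0.
move=> w wb; rewrite -mulrDr cmodM; apply: ler_pM; rewrite ?cmod_ge0 ?fM //.
apply: le_trans (cmodD _ _) _; have [b1 b2] := bnd w h wb hr.
by rewrite mulr_natl mulr2n lerD.
Qed.

End CauchyFormula.

(** Near the centre Cauchy's formula reads [Phi f = f * Phi one]. Differentiating it and solving for
    [f'] expresses [f'] by [f] and by Cauchy transforms over a fixed square, all of them continuous;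
    the only division is by [Phi one], the winding integral, which does not vanish. *)
Lemma holo_deriv_contat {R : realType} (f f' : R[i] -> R[i]) (z0 : R[i]) (r : R) :
  0 < r -> (forall w : R[i], cmod (w - z0) < r -> cdiff f w (f' w)) -> contat f' z0.
Proof.
case: z0 => a b r0 fd.
(* The square of half-side [s] lies in the ball of radius [r], as its points are within [2 * s] of
   the centre. Below, [q = s / 4] leaves the margin [2 * q] to the boundary that the Cauchy
   transform requires. *)
pose s := r / 4; have s0 : 0 < s by rewrite divr_gt0.
pose X0 := a - s; pose X1 := a + s; pose Y0 := b - s; pose Y1 := b + s.
have X01 : X0 < X1 by rewrite /X0 /X1; clear -s0; lra.
have Y01 : Y0 < Y1 by rewrite /Y0 /Y1; clear -s0; lra.
have ins x y : X0 <= x <= X1 -> Y0 <= y <= Y1 -> cmod ((x +i* y) - (a +i* b)) < r.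
  rewrite /X0 /X1 /Y0 /Y1 => hx hy; apply: le_lt_trans (cmod_le_ReIm _) _ => /=.
  apply: (@le_lt_trans _ _ (s + s)); last by rewrite /s; clear -r0; lra.
  by apply: lerD; rewrite ler_norml; [clear -hx|clear -hy]; lra.
have fb w : on_boundary X0 X1 Y0 Y1 w -> contat f w.
  by case: w => x y /and3P[hx hy _]; apply: cdiff_contat; apply: fd; apply: ins.
have fh x y : X0 <= x <= X1 -> Y0 <= y <= Y1 -> cholo_at f (x +i* y).
  by move=> hx hy; exists (f' (x +i* y)); apply: fd; apply: ins.
pose Phi g := fun z => contour (fun w => g w * (w - z)^-1) X0 X1 Y0 Y1.
pose Psi g := fun z => contour (fun w => g w * (w - z)^-2) X0 X1 Y0 Y1.
pose one : R[i] -> R[i] := fun=> 1.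
have ob w : on_boundary X0 X1 Y0 Y1 w -> contat one w.
  by move=> _; apply: cdiff_contat; exact: cdiff_cst.
have WE z : winding X0 X1 Y0 Y1 z = Phi one z.
  by apply: eq_contour => // w _; rewrite mul1r.
pose q := s / 4.
have q0 : 0 < q by rewrite divr_gt0.
have near (z : R[i]) : cmod (z - (a +i* b)) < 2 * q ->
    [/\ X0 + 2 * q <= complex.Re z <= X1 - 2 * q & Y0 + 2 * q <= complex.Im z <= Y1 - 2 * q].
  case: z => x y h; have := le_lt_trans (ler_Re_cmod _) h.
  have := le_lt_trans (ler_Im_cmod _) h; rewrite /= !ltr_norml /X0 /X1 /Y0 /Y1 /q.
  by clear -s0 => h1 h2; split; lra.
have inn (z : R[i]) : cmod (z - (a +i* b)) < 2 * q ->
    [/\ X0 < complex.Re z < X1 & Y0 < complex.Im z < Y1].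
  by move/near => [h1 h2]; clear -h1 h2 q0; split; lra.
have cau (z : R[i]) : cmod (z - (a +i* b)) < 2 * q -> Phi f z = f z * Phi one z.
  by case: z => x y /inn[h1 h2]; rewrite -WE; apply: cauchy_formula.
have dP g (z : R[i]) : (forall w, on_boundary X0 X1 Y0 Y1 w -> contat g w) ->
    cmod (z - (a +i* b)) < q -> cdiff (Phi g) z (Psi g z) /\ contat (Psi g) z.
  case: z => x y gc hz; have [|h1 h2] := near (x +i* y).
    by apply: lt_trans hz _; clear -q0; lra.
  exact: (@cdiff_cauchy_transform R X0 X1 Y0 Y1 X01 Y01 g x y q).
have formula (z : R[i]) : cmod (z - (a +i* b)) < q ->
    (Psi f z - f z * Psi one z) * (Phi one z)^-1 = f' z.
  move=> hz; have z2 : cmod (z - (a +i* b)) < 2 * q by clear -hz q0; lra.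
  have [d1 _] := dP f z fb hz; have [d2 _] := dP one z ob hz.
  have fz : cdiff f z (f' z).
    case: z {hz d1 d2} z2 => x y z2; apply: fd; have [/= h1 h2] := inn _ z2.
    by apply: ins; [case/andP: h1 => /ltW -> /ltW ->|case/andP: h2 => /ltW -> /ltW ->].
  have d3 := cdiffM fz d2.
  have p0 : 0 < q - cmod (z - (a +i* b)) by rewrite subr_gt0.
  have d4 : cdiff (Phi f) z (f' z * Phi one z + f z * Psi one z).
    apply: (eq_cdiff p0 _ d3) => w hw; apply/esym/cau.
    have -> : w - (a +i* b) = (w - z) + (z - (a +i* b)) by ring.
    by apply: le_lt_trans (cmodD _ _) _; clear -hw q0; lra.
  rewrite (cdiff_unique d1 d4).
  have n0 : Phi one z != 0.
    by rewrite -WE; case: z {hz d1 d2 fz d3 p0 d4} z2 => x y /inn[/= h1 h2]; apply: winding_neq0.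
  by field.
have h0 : cmod ((a +i* b) - (a +i* b)) < q by rewrite subrr cmod0.
have n0 : Phi one (a +i* b) != 0.
  by rewrite -WE; apply: winding_neq0 => //; rewrite /X0 /X1 /Y0 /Y1; clear -s0; lra.
have [d1 c1] := dP f _ fb h0; have [d2 c2] := dP one _ ob h0.
apply: (eq_contat q0 formula); apply: contatM.
  apply: contatB => //; apply: contatM => //.
  by apply: cdiff_contat; apply: fd; rewrite subrr cmod0.
exact: cdiff_contat (cdiff_comp d2 (cdiff_inv n0)).
Qed.

(** * The primitive along rays and its derivative *)

Section RayIntegral.
Context {R : realType}.
Implicit Types (f g u : R -> R[i]).

Lemma Rint_scale (f : R -> R) (r : R) : 0 < r ->
  {within `[0, r], continuous f} ->
  \int[lebesgue_measure]_(t in `[0, r]) f t =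
  \int[lebesgue_measure]_(t in `[0, 1]) (f (r * t) * r).
Proof.
move=> r0 fc.
have d1 (x : R) : is_derive x 1 (fun t : R => r * t) r.
  rewrite (_ : (fun t : R => r * t) = r *: (id : R -> R)) //.
  by apply: is_derive_eq; rewrite /GRing.scale /= mulr1.
have D : derive1 (fun t : R => r * t) = cst r.
  by apply/funext => x; rewrite derive1E; apply: derive_val.
have C : continuous (fun t : R => r * t) by exact: mulrl_continuous.
rewrite /Rintegral; congr fine.
have /= := @integration_by_substitution_increasing R (fun t => r * t) f 0 1.
rewrite mulr0 mulr1 D => -> //.
- by move=> x y _ _ xy; rewrite ltr_pM2l.
- by move=> x _; exact: cvg_cst.
- by apply/cvg_ex; exists r; exact: cvg_cst.
- by apply/cvg_ex; exists r; exact: cvg_cst.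
- split.
  + by move=> x _; apply: ex_derive.
  + by apply: cvg_at_right_filter; exact: C.
  + by apply: cvg_at_left_filter; exact: C.
Qed.

Lemma cint_scale u (r : R) : 0 < r -> ccont 0 r u ->
  cint 0 r u = cint 0 1 (fun t => u (r * t) * r%:C).
Proof.
move=> r0 cu; rewrite /cint.
rewrite (Rint_scale r0 (ccont_within_Re cu)) (Rint_scale r0 (ccont_within_Im cu)).
congr (_ +i* _); apply: eq_Rintegral => t _; case: (u _) => x y /=; ring.
Qed.

End RayIntegral.

Section HolOnDisc.
Context {R : realType}.
Implicit Types (f g : Cx R -> Cx R) (z w d : R[i]).

Lemma discE z : disc z = (cmod z < 1) :> Prop.
Proof. by []. Qed.

Lemma disc_near z : disc z -> exists2 r : R, 0 < r &
  forall w : R[i], cmod (w - z) < r -> disc w.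
Proof.
rewrite discE => z1; exists (1 - cmod z); first by rewrite subr_gt0.
move=> w wz; have -> : w = (w - z) + z by ring.
by apply: le_lt_trans (cmodD _ _) _; clear -wz; lra.
Qed.

Lemma Hol_cdiff f z : Hol f -> disc z -> cdiff f z (derive1 f z).
Proof. by move=> fH zd; apply: derivable_cdiff; apply: fH. Qed.

Lemma Hol_deriv_contat f z : Hol f -> disc z -> contat (derive1 f) z.
Proof.
move=> fH /disc_near[r r0 zr]; apply: (holo_deriv_contat r0) => w /zr wd.
exact: Hol_cdiff.
Qed.

(** In the definition the integrand depends on the endpoint. The substitution [s = r * t] gives one
    integrand for the whole ray, so that only the upper limit varies. *)
Lemma Jop_ray f g (v : R[i]) (r : R) : Hol f -> Hol g -> disc v -> 0 < r -> r <= 1 ->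
  Jop g f (r%:C * v) = v * cint 0 r (fun s => f (s%:C * v) * derive1 g (s%:C * v)).
Proof.
move=> fH gH vd r0 r1.
have cu : ccont 0 r (fun s => f (s%:C * v) * derive1 g (s%:C * v)).
  move=> s hs e e0.
  have sd : disc (s%:C * v).
    rewrite discE cmodM cmodR ger0_norm; last by case/andP: hs.
    apply: le_lt_trans vd; rewrite ler_piMl ?cmod_ge0 //.
    by case/andP: hs => _ /le_trans; apply.
  have [q q0 fq] : exists2 q : R, 0 < q & forall w : R[i], cmod (w - s%:C * v) < q ->
      cmod (f w * derive1 g w - f (s%:C * v) * derive1 g (s%:C * v)) <= e.
    apply: (contatM _ _ e0); last exact: Hol_deriv_contat.
    exact: cdiff_contat (Hol_cdiff fH sd).
  exists q => // t ts; apply: fq; rewrite -mulrBl -rmorphB cmodM cmodR.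
  apply: le_lt_trans ts; rewrite ler_piMr //; exact: ltW.
have c1 : ccont 0 1 (fun t => f ((r * t)%:C * v) * derive1 g ((r * t)%:C * v)).
  move=> t ht e e0.
  have [|q q0 Hq] := cu (r * t) _ e e0.
    case/andP: ht => t0 t1; apply/andP; split; first by rewrite mulr_ge0 // ltW.
    by rewrite ler_piMr // ltW.
  exists (q / r); first by rewrite divr_gt0.
  move=> s st; apply: Hq; rewrite -mulrBr normrM (gtr0_norm r0) mulrC.
  by rewrite -ltr_pdivlMr.
rewrite cint_scale // -cintZ; last first.
  apply: ccontW (_ : ccont 0 1 _) => //; last first.
    have -> : (fun t : R => f ((r * t)%:C * v) * derive1 g ((r * t)%:C * v) * r%:C) =
        (fun t => r%:C * (f ((r * t)%:C * v) * derive1 g ((r * t)%:C * v))).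
      by apply/funext => t; rewrite mulrC.
    exact: ccontZ.
rewrite /Jop; apply: eq_cint => t _.
have -> : t%:C * (r%:C * v) = (r * t)%:C * v by rewrite rmorphM; ring.
by ring.
Qed.

(* The primitive is known to be differentiable, so its derivative may be computed
   along a ray through the point, on one side only: this also covers the origin. *)
Lemma derive1_Jop f g z : Hol f -> Hol g -> Hol (Jop g f) -> disc z ->
  derive1 (Jop g f) z = f z * derive1 g z.
Proof.
move=> fH gH JH zd.
(* [z] must come strictly before the end of a segment from 0 to a point [v] of the disc, to leave
   room for positive increments: [v = 1/2] at the origin, otherwise [v = 2 z / (1 + |z|)], which has
   modulus below 1. *)
have [v [t0 [vd v0 /andP[t00 t01] zE]]] : exists v : R[i], exists t : R,
    [/\ disc v, v != 0, 0 <= t < 1 & z = t%:C * v].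
  have [->|z0] := eqVneq z 0.
    exists (2^-1)%:C, 0; split; rewrite ?lexx ?ltr01 ?mul0r //.
      by rewrite discE cmodR ger0_norm ?invr_ge0 // invf_lt1 // ltr1n.
    by rewrite -cmod_gt0 cmodR normr_gt0 invr_eq0 pnatr_eq0.
  have cz0 : 0 < cmod z by rewrite cmod_gt0.
  pose k := 2 / (1 + cmod z).
  have k0 : 0 < 1 + cmod z by rewrite addr_gt0.
  exists (k%:C * z), k^-1; split.
  - rewrite discE cmodM cmodR ger0_norm ?divr_ge0 // ?ltW //.
    by rewrite /k mulrAC ltr_pdivrMr // mul1r; move: zd; rewrite discE; clear; lra.
  - by rewrite mulf_neq0 // -cmod_gt0 cmodR normr_gt0 mulf_neq0 ?invr_eq0 ?pnatr_eq0 // gt_eqF.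
  - rewrite /k invf_div divr_ge0 ?ltW //= ltr_pdivrMr // mul1r.
    by move: zd; rewrite discE; clear; lra.
  - by rewrite mulrA -rmorphM mulVf ?mul1r // mulf_neq0 ?invr_eq0 ?pnatr_eq0 // gt_eqF.
set u := fun s : R => f (s%:C * v) * derive1 g (s%:C * v).
have ud (s : R) : 0 <= s <= 1 -> disc (s%:C * v).
  move=> /andP[s0 s1]; rewrite discE cmodM cmodR ger0_norm //.
  by apply: le_lt_trans vd; rewrite ler_piMl ?cmod_ge0.
have uc : ccont 0 1 u.
  move=> s hs e e0; have sd := ud s hs.
  have [q q0 fq] : exists2 q : R, 0 < q & forall w : R[i], cmod (w - s%:C * v) < q ->
      cmod (f w * derive1 g w - f (s%:C * v) * derive1 g (s%:C * v)) <= e.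
    apply: (contatM _ _ e0); last exact: Hol_deriv_contat.
    exact: cdiff_contat (Hol_cdiff fH sd).
  exists q => // t ts; apply: fq; rewrite -mulrBl -rmorphB cmodM cmodR.
  apply: le_lt_trans ts; rewrite ler_piMr //; exact: ltW.
have J0 : Jop g f 0 = 0.
  rewrite /Jop; have -> : (fun t : R => f (t%:C * 0) * derive1 g (t%:C * 0) * 0) = (fun=> 0).
    by apply/funext => t; rewrite mulr0.
  by have := @cint_cst R 0 1 0 ler01; rewrite mul0r.
have ray (r : R) : 0 <= r <= 1 -> Jop g f (r%:C * v) = v * cint 0 r u.
  move=> /andP[r0 r1]; have [->|rn] := eqVneq r 0.
    rewrite mul0r J0 /cint set_itv1 !Rintegral_set1.
    by have -> : (0 +i* 0 : R[i]) = 0 by []; rewrite mulr0.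
  by rewrite Jop_ray // lt_def rn.
have JD := Hol_cdiff JH zd; set d := derive1 _ z in JD *.
have vp : 0 < cmod v by rewrite cmod_gt0.
(* Of the three [e], one is the error of differentiability of the primitive, and two come from
   [cint_bound] applied to [u - u t0]. *)
have key (e : R) : 0 < e -> cmod (u t0 - d) <= e * 3.
  move=> e0; have [q q0 uq] := uc t0 (introT andP (conj t00 (ltW t01))) e e0.
  have [r r0 Jr] := JD e e0.
  pose h := Num.min (Num.min (q / 2) (r / 2)) ((1 - t0) / 2).
  have h0 : 0 < h by rewrite !lt_min !divr_gt0 // subr_gt0.
  have := lexx h; rewrite {2}/h !le_min => /andP[/andP[h1 h2] h3].
  have hq : h < q by clear -h1 h0; lra.
  have hr : h < r by clear -h2 h0; lra.
  have hs : t0 + h <= 1 by clear -h3 t01; lra.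
  have th : 0 <= t0 + h by rewrite addr_ge0 // ltW.
  have := Jr (h%:C * v); rewrite cmodM cmodR (gtr0_norm h0).
  have -> : h * cmod v < r.
    by apply: le_lt_trans hr; rewrite ler_piMr ?ltW.
  move=> /(_ isT).
  have -> : z + h%:C * v = (t0 + h)%:C * v by rewrite zE rmorphD; ring.
  rewrite ray ?th // {1}zE ray; last by rewrite t00 ltW.
  rewrite (@cint_split _ 0 t0 (t0 + h)) //; last 2 first.
  - by rewrite lerDl ltW.
  - exact: ccontW uc.
  set A := cint 0 t0 u; set B := cint t0 (t0 + h) u => HJ.
  have HB : cmod (B - u t0 * h%:C) <= 2 * e * h.
    have -> : h%:C = (t0 + h - t0)%:C by congr (_%:C); ring.
    rewrite -cint_cst; last by rewrite lerDl ltW.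
    rewrite -cintB; last 2 first.
    - exact: ccontW uc.
    - exact: ccont_cst.
    have {2}-> : h = t0 + h - t0 by ring.
    apply: cint_bound; first by rewrite lerDl ltW.
      by apply: ccontB; [exact: ccontW uc|exact: ccont_cst].
    move=> s /andP[s1 s2]; apply: uq; rewrite ger0_norm ?subr_ge0 //.
    by clear -s2 hq; lra.
  have hv : 0 < h * cmod v by rewrite mulr_gt0.
  rewrite -(ler_pM2r hv).
  have -> : cmod (u t0 - d) * (h * cmod v) =
      cmod ((v * (A + B) - v * A - d * (h%:C * v)) - v * (B - u t0 * h%:C)).
    rewrite -{1}(gtr0_norm h0) -cmodR -!cmodM; congr cmod; ring.
  apply: le_trans (cmodB _ _) _.
  rewrite [X in _ + X]cmodM.
  have : cmod v * cmod (B - u t0 * h%:C) <= cmod v * (2 * e * h) by rewrite ler_pM2l.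
  move: HJ; clear; lra.
apply/esym/eqP; rewrite -subr_eq0 -cmod_eq0; apply/eqP/le_anti.
rewrite cmod_ge0 andbT.
suff H (e : R) : 0 < e -> cmod (f z * derive1 g z - d) <= e.
  by apply/ler_addgt0Pr => e /H; rewrite add0r.
move=> e0; have e3 : 0 < e / 3 by rewrite divr_gt0.
have := key _ e3; have -> : e / 3 * 3 = e by field.
by rewrite {1}/u -zE.
Qed.

End HolOnDisc.

(** * Change of variables: general mechanism *)

Section DensityTransfer.
Context d1 d2 (X : measurableType d1) (Y : measurableType d2) (R : realType).
Variables (mu : {measure set X -> \bar R}) (nu : {measure set Y -> \bar R}).
Variables (S : X -> Y) (w : X -> R).
Hypotheses (mS : measurable_fun setT S) (mw : measurable_fun setT w).
Hypothesis w0 : forall x, 0 <= w x.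
Hypothesis H : forall A, measurable A ->
  (\int[mu]_x (\1_A (S x) * w x)%:E = nu A)%E.

Import HBNNSimple.

Let mind (A : set Y) : measurable A -> measurable_fun setT (fun x => \1_A (S x) * w x).
Proof.
by move=> mA; apply: measurable_funM => //; apply: measurableT_comp => //; exact: measurable_indic.
Qed.

Let density_nnsfun (f : {nnsfun Y >-> R}) :
  (\int[mu]_x (f (S x) * w x)%:E = \int[nu]_y (f y)%:E)%E.
Proof.
transitivity (\sum_(k \in range f) (k%:E * nu (f @^-1` [set k])))%E.
  transitivity (\int[mu]_x (\sum_(k \in range f)
      (k%:E * (\1_(f @^-1` [set k]) (S x) * w x)%:E)))%E.
    apply: eq_integral => x _; rewrite fimfunE.
    rewrite EFinM -fsumEFin// ge0_mule_fsuml => [|k]; last first.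
      by rewrite EFinM nnfun_muleindic_ge0.
    by apply: eq_fsbigr => k _; rewrite !EFinM muleA.
  rewrite ge0_integral_fsum //; last 2 first.
  - move=> k; apply: measurable_funeM; apply/measurable_EFinP; exact: mind.
  - move=> k x _; rewrite !EFinM muleA mule_ge0 ?lee_fin //.
    exact: nnfun_muleindic_ge0.
  apply: eq_fsbigr => k _.
  have [k0|k0] := leP 0 k.
    rewrite ge0_integralZl_EFin //; last 2 first.
    - by move=> x _; rewrite lee_fin mulr_ge0.
    - by apply/measurable_EFinP; exact: mind.
    by rewrite H.
  rewrite preimage_nnfun0 // measure0 mule0.
  by apply: integral0_eq => x _; rewrite indic0 mul0r mule0.
transitivity (\int[nu]_y (\sum_(k \in range f) (k * \1_(f @^-1` [set k]) y)%:E))%E.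
  rewrite ge0_integral_fsum //; last 2 first.
  - by move=> k; apply/measurable_EFinP/measurable_funM.
  - by move=> k x _; rewrite EFinM nnfun_muleindic_ge0.
  apply: eq_fsbigr => k _.
  by rewrite integralZl_indic_nnsfun // integral_indic // setIT.
by apply: eq_integral => y _; rewrite [in RHS]fimfunE -fsumEFin.
Qed.

(** The usual extension from indicators: simple functions by linearity, then increasing limits by
    monotone convergence on both sides. *)
Lemma ge0_integral_density (f : Y -> \bar R) : measurable_fun setT f ->
  (forall y, 0 <= f y)%E -> (\int[mu]_x (f (S x) * (w x)%:E) = \int[nu]_y f y)%E.
Proof.
move=> mf f0; pose f_ := nnsfun_approx measurableT mf.
transitivity (limn (fun n => \int[mu]_x (f_ n (S x) * w x)%:E)%E).
  rewrite -monotone_convergence //.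
  - apply: eq_integral => x _; apply/esym/cvg_lim => //.
    under eq_fun do rewrite EFinM muleC.
    rewrite muleC; apply: cvgeZl => //.
    by apply: (cvg_nnsfun_approx measurableT mf) => // y _; apply: f0.
  - move=> n; apply/measurable_EFinP/measurable_funM => //.
    by apply: measurableT_comp => //; exact: measurable_funP.
  - by move=> n x _; rewrite lee_fin mulr_ge0.
  - move=> x _ m n mn; rewrite lee_fin ler_wpM2r //.
    exact/lefP/nd_nnsfun_approx.
transitivity (limn (fun n => \int[nu]_y (f_ n y)%:E)%E).
  by congr (limn _); apply/funext => n; exact: density_nnsfun.
rewrite -monotone_convergence //.
- apply: eq_integral => x _; apply/cvg_lim => //.
  by apply: (cvg_nnsfun_approx measurableT mf) => // y _; apply: f0.
- by move=> n; apply/measurable_EFinP; exact: measurable_funP.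
- by move=> n x _; rewrite lee_fin.
- by move=> x _ m n mn; rewrite lee_fin; exact/lefP/nd_nnsfun_approx.
Qed.

End DensityTransfer.

(** The image under [S] of the measure with density [w] is [mu], so [w] is the absolute Jacobian of
    [S]. Total maps and integrals over the whole space make such formulas compose without tracking
    domains. *)
Definition jac d (T : measurableType d) (R : realType) (mu : {measure set T -> \bar R})
    (S : T -> T) (w : T -> R) :=
  [/\ measurable_fun setT S, measurable_fun setT w, (forall x, 0 <= w x) &
   forall f : T -> \bar R, measurable_fun setT f -> (forall y, 0 <= f y)%E ->
     (\int[mu]_x (f (S x) * (w x)%:E) = \int[mu]_y f y)%E].

Lemma jac_comp d (T : measurableType d) (R : realType) (mu : {measure set T -> \bar R})
    (S S' : T -> T) (w w' : T -> R) :
  jac mu S w -> jac mu S' w' -> jac mu (S' \o S) (fun x => w' (S x) * w x).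
Proof.
move=> [mS mw w0 HS] [mS' mw' w'0 HS']; split.
- exact: measurableT_comp.
- by apply: measurable_funM => //; exact: measurableT_comp.
- by move=> x; rewrite mulr_ge0.
- move=> f mf f0; rewrite -(HS' f mf f0) -(HS (fun y => f (S' y) * (w' y)%:E)%E).
  + by apply: eq_integral => x _; rewrite EFinM muleA.
  + by apply: emeasurable_funM; [exact: measurableT_comp|exact/measurable_EFinP].
  + by move=> y; rewrite mule_ge0 ?lee_fin.
Qed.

Lemma eq_jac d (T : measurableType d) (R : realType) (mu : {measure set T -> \bar R})
    (S S' : T -> T) (w w' : T -> R) :
  S =1 S' -> w =1 w' -> jac mu S w -> jac mu S' w'.
Proof. by move=> /funext <- /funext <-. Qed.

Section Jac1.
Context {R : realType}.
Local Notation mu := (@lebesgue_measure R).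
Local Notation mR := (measurableTypeR R).

Section Build.
Variables (S : R -> R) (w : R -> R).
Hypotheses (mS : measurable_fun setT (S : mR -> mR)) (mw : measurable_fun setT (w : mR -> R)).
Hypothesis w0 : forall x, 0 <= w x.

Let nu (A : set mR) : \bar R := (\int[mu]_x (\1_A (S x) * w x)%:E)%E.

Let nu0 : nu set0 = 0%E.
Proof.
by rewrite /nu; apply: integral0_eq => x _; rewrite indic0 mul0r.
Qed.

Let nu_ge0 A : (0 <= nu A)%E.
Proof. by apply: integral_ge0 => x _; rewrite lee_fin mulr_ge0. Qed.

Let nuE A : nu A = (\int[mu]_(x in S @^-1` A) (w x)%:E)%E.
Proof.
rewrite [RHS]integral_mkcond; apply: eq_integral => x _.
rewrite patchE /=; case: ifPn; rewrite ?inE ?notin_setE /= => h.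
  by rewrite indicE mem_set // mul1r.
by rewrite indicE memNset // mul0r.
Qed.

Let mSA (A : set mR) : measurable A -> measurable (S @^-1` A : set mR).
Proof. by move=> mA; rewrite -[X in measurable X]setTI; exact: mS. Qed.

Let nu_sigma : semi_sigma_additive nu.
Proof.
move=> F mF tF mUF.
have E : nu = fun A => (\int[mu]_(x in S @^-1` A) (w x)%:E)%E by apply/funext => A.
rewrite E preimage_bigcup.
apply: (@semi_sigma_additive_nng_induced _ _ _ mu (EFin \o w) _ _ (fun i => S @^-1` F i)).
- exact/measurable_EFinP.
- by move=> x; rewrite lee_fin.
- by move=> i; exact: mSA.
- apply/trivIsetP => i j _ _ ij; rewrite -preimage_setI.
  by move/trivIsetP: tF => /(_ i j I I ij) ->; rewrite preimage_set0.
- by rewrite -preimage_bigcup; exact: mSA.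
Qed.

HB.instance Definition _ := isMeasure.Build _ _ _ nu nu0 nu_ge0 nu_sigma.

(** The image measure [nu] agrees with Lebesgue measure on half-open intervals, hence on all
    measurable sets. *)
Lemma jac_lebesgue :
  (forall a b : R, a < b -> (\int[mu]_(x in S @^-1` `]a, b]) (w x)%:E = (b - a)%:E)%E) ->
  jac mu S w.
Proof.
move=> Hab; split => //.
apply: (@ge0_integral_density _ _ mR mR R mu mu) => // A mA.
rewrite -/(nu A); apply/esym.
apply: (@lebesgue_measure_unique R nu) => // B /ocitvP[->|[[a b] /= ab ->]].
  by rewrite !measure0.
by rewrite [RHS]nuE Hab // lebesgue_measure_itv /= lte_fin ab.
Qed.

End Build.
End Jac1.

(** * Changes of variables on the line *)

Section LineTransformations.
Context {R : realType}.
Local Notation mu := (@lebesgue_measure R).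

Lemma measurable_inv : measurable_fun [set: R] (@GRing.inv R).
Proof.
have -> : [set: R] = [set 0] `|` ~` [set 0].
  by apply/seteqP; split => x // _; case: (pselect (x = 0)); [left|right].
apply/measurable_funU => //; first exact: measurableC.
split; first exact: measurable_fun_set1.
apply: open_continuous_measurable_fun.
  by apply: closed_openC; exact: closed_eq.
by move=> x /set_mem /= /eqP x0; exact: inv_continuous.
Qed.

Lemma jac_affine (c d : R) : c != 0 -> jac mu (fun x => c * x + d) (fun=> `|c|).
Proof.
move=> c0; apply: jac_lebesgue => //.
  by apply: measurable_funD => //; exact: mulrl_measurable.
move=> a b ab.
have [cp|cn] : 0 < c \/ c < 0 by move: c0; rewrite neq_lt => /orP[]; [right|left].
  have -> : (fun x => c * x + d) @^-1` `]a, b] = `](a - d) / c, (b - d) / c]%classic.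
    apply/seteqP; split => x /=; rewrite !in_itv /= ltr_pdivrMr // ler_pdivlMr //;
    by rewrite (mulrC x) ltrBlDr lerBrDr.
  rewrite integral_cst //= lebesgue_measure_itv /= lte_fin.
  rewrite ltr_pM2r ?invr_gt0 // ltrD2r ab gtr0_norm // -EFinB -EFinM; congr EFin.
  by field.
have -> : (fun x => c * x + d) @^-1` `]a, b] = `[(b - d) / c, (a - d) / c[%classic.
  apply/seteqP; split => x /=; rewrite !in_itv /= ler_ndivrMr // ltr_ndivlMr //;
  rewrite (mulrC x) ltrBlDr lerBrDr; by case/andP => -> ->.
rewrite integral_cst //= lebesgue_measure_itv /= lte_fin.
rewrite ltr_nM2r ?invr_lt0 // ltrD2r ab ltr0_norm // -EFinB -EFinM; congr EFin.
by field.
Qed.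

Lemma integral_inv_sqr_pinfty (c : R) : 0 < c ->
  (\int[mu]_(x in `[c, +oo[) (x ^- 2)%:E = (c^-1)%:E)%E.
Proof.
move=> c0.
have dF (x : R) : 0 < x -> is_derive x 1 (fun y : R => - y^-1) (x ^- 2).
  move=> x0; apply: is_derive_eq.
    apply: is_deriveN; apply: is_deriveV; first by rewrite gt_eqF.
  by rewrite /GRing.scale /= mulr1 opprK.
have cinv (x : R) : 0 < x -> {for x, continuous (fun y : R => y^-1)}.
  by move=> x0; apply: inv_continuous; rewrite gt_eqF.
rewrite (@ge0_continuous_FTC2y R (fun x => x ^- 2) (fun x => - x^-1) c 0).
- by rewrite -EFinB sub0r opprK.
- by move=> x _; rewrite invr_ge0 sqr_ge0.
- apply: continuous_in_subspaceT => x; rewrite inE /= in_itv /= andbT => cx.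
  have x0 : 0 < x by exact: lt_le_trans cx.
  apply: (@continuousV R R (fun y : R => y ^+ 2) x).
    by rewrite expf_neq0 // gt_eqF.
  exact: exprn_continuous.
- rewrite -[X in _ --> X]oppr0; apply: cvgN; apply/gtr0_cvgV0; last exact: cvg_id.
  exact: nbhs_pinfty_gt.
- by move=> x cx; have [] := dF x (lt_trans c0 cx).
- apply: cvg_at_right_filter; apply: cvgN; exact: cinv.
- move=> x; rewrite in_itv /= andbT => cx.
  by have [_] := dF x (lt_trans c0 cx); rewrite derive1E.
Qed.

(** The tail from [b^-1] minus the tail from [a^-1], which is finite. *)
Lemma integral_inv_sqr_itv (a b : R) : 0 < a -> a < b ->
  (\int[mu]_(x in `[b^-1%R, a^-1%R[) (x ^- 2)%:E = (b - a)%:E)%E.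
Proof.
move=> a0 ab; have b0 := lt_trans a0 ab.
have := integral_inv_sqr_pinfty (c := b^-1); rewrite invr_gt0 => /(_ b0).
have -> : `[b^-1, +oo[%classic = `[b^-1, a^-1[%classic `|` `[a^-1, +oo[%classic :> set R.
  rewrite -itv_bndbnd_setU // bnd_simp // ltW // ltf_pV2 ?posrE //.
rewrite ge0_integral_setU //=.
- have := integral_inv_sqr_pinfty (c := a^-1); rewrite invr_gt0 => /(_ a0) ->.
  rewrite !invrK => /(congr1 (fun t => t - a%:E)%E); rewrite addeK //.
- apply/measurable_EFinP/measurable_funTS.
  apply: (measurableT_comp measurable_inv); exact: exprn_measurable.
- by move=> x _; rewrite lee_fin invr_ge0 sqr_ge0.
- apply/disj_setPS => x [] /=; rewrite !in_itv /= andbT => /andP[_ h1] h2.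
  by move: (lt_le_trans h1 h2); rewrite ltxx.
Qed.

(* Extended by the identity to a bijection of the line, so that the change of
   variables holds for every measurable function. *)
Definition pos_inv (x : R) := if 0 < x then x^-1 else x.
Definition pos_inv_jac (x : R) := if 0 < x then x ^- 2 else 1.

Lemma jac_pos_inv : jac mu pos_inv pos_inv_jac.
Proof.
have mpos : measurable_fun [set: R] (fun x : R => 0 < x) by exact: measurable_fun_ltr.
have mw : measurable_fun [set: R] pos_inv_jac.
  apply: measurable_fun_ifT => //.
  apply: (measurableT_comp measurable_inv); exact: exprn_measurable.
have w0 (x : R) : 0 <= pos_inv_jac x.
  by rewrite /pos_inv_jac; case: ifP => // _; rewrite invr_ge0 sqr_ge0.
apply: jac_lebesgue => //.
  by apply: measurable_fun_ifT => //; exact: measurable_inv.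
have neg (a b : R) : a <= b -> b <= 0 ->
    (\int[mu]_(x in `]a, b]) (pos_inv_jac x)%:E = (b - a)%:E)%E.
  move=> ab b0; rewrite (@eq_integral _ _ _ mu _ (cst 1%E)).
    rewrite integral_cst //= mul1e lebesgue_measure_itv /= lte_fin.
    by case: ltP => //= ba; rewrite (_ : b - a = 0) //; apply/eqP; rewrite subr_eq0 eq_le ba.
  move=> x; rewrite inE /= in_itv /= /pos_inv_jac => /andP[_ xb].
  by rewrite ltNge (le_trans xb b0).
have posI (I : set R) : (forall x, I x -> 0 < x) ->
    (\int[mu]_(x in I) (pos_inv_jac x)%:E = \int[mu]_(x in I) (x ^- 2)%:E)%E.
  by move=> I0; apply: eq_integral => x; rewrite inE /pos_inv_jac => /I0 ->.
have big (b : R) : 0 < b -> forall x, `[b^-1, +oo[%classic x -> 0 < x.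
  move=> b0 x /=; rewrite in_itv /= andbT; apply: lt_le_trans; by rewrite invr_gt0.
move=> a b ab.
(* Three cases by the signs of the endpoints. The part of []a, b]] below 0 is its own preimage; the
   preimage of the part above 0 is [[b^-1, a^-1[], or the half-line from [b^-1] when [a <= 0]. *)
have [b0|b0] := leP b 0.
  rewrite (_ : _ @^-1` _ = `]a, b]%classic); first exact: neg (ltW ab) b0.
  apply/seteqP; split => x /=; rewrite !in_itv /= /pos_inv; case: ifP => // x0.
    by move=> /andP[_ h]; have := le_trans h b0; rewrite leNgt invr_gt0 x0.
  by move=> /andP[_ h]; have := le_trans h b0; rewrite leNgt x0.
have [a0|a0] := ltP 0 a.
  rewrite (_ : _ @^-1` _ = `[b^-1, a^-1[%classic).
    rewrite posI; first exact: integral_inv_sqr_itv.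
    move=> x /=; rewrite in_itv /= => /andP[h _]; apply: lt_le_trans h; by rewrite invr_gt0.
  apply/seteqP; split => x /=; rewrite !in_itv /= /pos_inv; case: ifP => x0.
  - by move=> /andP[h1 h2]; rewrite -[x]invrK lef_pV2 ?ltf_pV2 ?posrE ?invr_gt0 // h1 h2.
  - by move=> /andP[h _]; move: (lt_trans a0 h); rewrite x0.
  - by move=> /andP[h1 h2]; rewrite -[a]invrK -[b]invrK lef_pV2 ?ltf_pV2 ?posrE ?invr_gt0 // h1 h2.
  - move=> /andP[h _]; have := lt_le_trans _ h; move=> /(_ 0).
    by rewrite invr_gt0 b0 x0 => /(_ isT).
rewrite (_ : _ @^-1` _ = `]a, 0]%classic `|` `[b^-1, +oo[%classic).
  rewrite ge0_integral_setU //=.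
  - rewrite neg // (posI _ (big b b0)) integral_inv_sqr_pinfty ?invr_gt0 // invrK.
    by rewrite -EFinD; congr EFin; ring.
  - exact/measurable_EFinP/measurable_funTS.
  - by move=> x _; rewrite lee_fin.
  - apply/disj_setPS => x [] /=; rewrite !in_itv /= andbT => /andP[_ h1] h2.
    by have := big b b0 x; rewrite /= in_itv /= andbT => /(_ h2); rewrite ltNge h1.
apply/seteqP; split => x /=; rewrite !in_itv /= andbT /pos_inv; case: ifP => x0.
- by move=> /andP[_ h2]; right; rewrite -[x]invrK lef_pV2 ?posrE ?invr_gt0.
- by move=> /andP[h1 _]; left; rewrite h1 leNgt x0.
- case=> [/andP[_]|h]; first by rewrite leNgt x0.
  rewrite -[b]invrK lef_pV2 ?posrE ?invr_gt0 // h andbT.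
  by apply: le_lt_trans a0 _; rewrite invr_gt0.
- case=> [/andP[-> h]|h]; first exact: le_trans (ltW b0).
  by have := big b b0 x; rewrite /= in_itv /= andbT => /(_ h); rewrite x0.
Qed.

End LineTransformations.

(** * Changes of variables in the plane *)

Section PlaneTransformations.
Context {R : realType}.
Local Notation mu := (@lebesgue_measure R).
Local Notation mR := (measurableTypeR R).
Local Notation mu2 := (mu \x mu)%E.

(** By Tonelli's theorem, a map that moves only the second coordinate can be treated on each
    vertical line separately. *)
Lemma jac_fiber1 (s w : R -> R -> R) :
  measurable_fun setT (fun z : mR * mR => s z.1 z.2 : mR) ->
  measurable_fun setT (fun z : mR * mR => w z.1 z.2) ->
  (forall x, jac mu (s x) (w x)) ->
  jac mu2 (fun z : mR * mR => (z.1, s z.1 z.2)) (fun z => w z.1 z.2).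
Proof.
move=> ms mw H.
have mS : measurable_fun setT (fun z : mR * mR => (z.1, s z.1 z.2) : mR * mR).
  exact: measurable_fun_pair.
split => //; first by move=> z; have [_ _ + _] := H z.1.
move=> f mf f0; rewrite [RHS]fubini_tonelli1 // [LHS]fubini_tonelli1 //.
- apply: eq_integral => x _; have [_ _ _ Hx] := H x.
  rewrite /fubini_F /= -[RHS]Hx //.
  exact: measurableT_comp.
- apply: emeasurable_funM; first exact: measurableT_comp.
  exact/measurable_EFinP.
- by move=> z; rewrite mule_ge0 // lee_fin; have [_ _ + _] := H z.1.
Qed.

Lemma jac_fiber2 (s w : R -> R -> R) :
  measurable_fun setT (fun z : mR * mR => s z.1 z.2 : mR) ->
  measurable_fun setT (fun z : mR * mR => w z.1 z.2) ->
  (forall y, jac mu (s ^~ y) (w ^~ y)) ->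
  jac mu2 (fun z : mR * mR => (s z.1 z.2, z.2)) (fun z => w z.1 z.2).
Proof.
move=> ms mw H.
have mS : measurable_fun setT (fun z : mR * mR => (s z.1 z.2, z.2) : mR * mR).
  exact: measurable_fun_pair.
split => //; first by move=> z; have [_ _ + _] := H z.2.
move=> f mf f0; rewrite [RHS]fubini_tonelli2 // [LHS]fubini_tonelli2 //.
- apply: eq_integral => y _; have [_ _ _ Hy] := H y.
  rewrite /fubini_G /= -[RHS]Hy //.
  exact: measurableT_comp.
- apply: emeasurable_funM; first exact: measurableT_comp.
  exact/measurable_EFinP.
- by move=> z; rewrite mule_ge0 // lee_fin; have [_ _ + _] := H z.2.
Qed.

Let mfst : measurable_fun setT (fun z : mR * mR => z.1).
Proof. exact: measurable_fst. Qed.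
Let msnd : measurable_fun setT (fun z : mR * mR => z.2).
Proof. exact: measurable_snd. Qed.

Lemma jac_conj : jac mu2 (fun z : mR * mR => (z.1, - z.2)) (fun=> 1).
Proof.
apply: (@jac_fiber1 (fun _ y => - y) (fun _ _ => 1)) => //.
  exact: measurable_funN.
move=> x; have := @jac_affine R (-1) 0; rewrite oppr_eq0 oner_eq0 => /(_ isT).
by apply: eq_jac => y; rewrite ?addr0 ?mulN1r ?normrN ?normr1.
Qed.

(* A complex multiplication is a product of two shears composed with dilations. *)
Let jac_linear_re (a1 a2 b1 b2 : R) : a1 != 0 ->
  jac mu2 (fun z : mR * mR => (a1 * z.1 - a2 * z.2 + b1, a2 * z.1 + a1 * z.2 + b2))
     (fun=> a1 ^+ 2 + a2 ^+ 2).
Proof.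
move=> a0.
have n0 : 0 < a1 ^+ 2 + a2 ^+ 2 by rewrite ltr_pwDl ?sqr_ge0 // exprn_even_gt0.
have J1 : jac mu2 (fun z : mR * mR => (a1 * z.1 + (b1 - a2 * z.2), z.2)) (fun=> `|a1|).
  apply: (@jac_fiber2 (fun x y => a1 * x + (b1 - a2 * y)) (fun _ _ => `|a1|)) => //.
    apply: measurable_funD; first exact: measurable_funM.
    by apply: measurable_funB => //; exact: measurable_funM.
  by move=> y; exact: jac_affine.
(* The first step produces the final first coordinate; eliminating the old one from the second
   coordinate leaves [c] as the coefficient of [z.2], and [|c| * |a1|] is the determinant. *)
set c := (a1 ^+ 2 + a2 ^+ 2) / a1.
have c0 : c != 0 by rewrite mulf_neq0 ?invr_eq0 // gt_eqF.
have J2 : jac mu2 (fun z : mR * mR => (z.1, c * z.2 + (a2 / a1 * (z.1 - b1) + b2)))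
    (fun=> `|c|).
  apply: (@jac_fiber1 (fun x y => c * y + (a2 / a1 * (x - b1) + b2)) (fun _ _ => `|c|)) => //.
    apply: measurable_funD; first exact: measurable_funM.
    by apply: measurable_funD => //; apply: measurable_funM => //; exact: measurable_funB.
  by move=> x; exact: jac_affine.
apply: eq_jac (jac_comp J1 J2).
  by move=> [x y] /=; congr (_, _); rewrite /c; [ring|field].
by move=> z; rewrite -normrM /c divfK // gtr0_norm.
Qed.

Lemma jac_linear (a1 a2 b1 b2 : R) : 0 < a1 ^+ 2 + a2 ^+ 2 ->
  jac mu2 (fun z : mR * mR => (a1 * z.1 - a2 * z.2 + b1, a2 * z.1 + a1 * z.2 + b2))
     (fun=> a1 ^+ 2 + a2 ^+ 2).
Proof.
have [-> a20|a0 _] := eqVneq a1 0; last exact: jac_linear_re.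
have h0 : a2 / 2 != 0.
  by rewrite mulf_neq0 ?invr_eq0 ?pnatr_eq0 //; apply: contraTneq a20 => ->;
    rewrite expr0n /= addr0 ltxx.
have one : (1 : R) != 0 by exact: oner_neq0.
(* Multiplication by ['i * a2] is the product of the multiplications by [1 + 'i] and by [a2 / 2]
   times [1 + 'i], both with nonzero real part. *)
apply: eq_jac (jac_comp (jac_linear_re 1 0 0 one) (jac_linear_re (a2 / 2) b1 b2 h0)).
  by move=> [x y] /=; congr (_, _); field.
by move=> z; field.
Qed.

Lemma jac_slope : jac mu2 (fun z : mR * mR => (z.1, if 0 < z.1 then z.1 * z.2 else z.2))
  (fun z => if 0 < z.1 then z.1 else 1).
Proof.
have mpos : measurable_fun setT (fun z : mR * mR => 0 < z.1) by exact: measurable_fun_ltr.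
apply: (@jac_fiber1 (fun x y => if 0 < x then x * y else y)
  (fun x _ => if 0 < x then x else 1)).
- by apply: measurable_fun_ifT => //; exact: measurable_funM.
- exact: measurable_fun_ifT.
- move=> x; case: ifPn => x0.
    have := @jac_affine R x 0; rewrite gt_eqF // => /(_ isT).
    by apply: eq_jac => y; rewrite ?addr0 ?gtr0_norm.
  have := @jac_affine R 1 0; rewrite oner_eq0 => /(_ isT).
  by apply: eq_jac => y; rewrite ?mul1r ?addr0 ?normr1.
Qed.

Lemma jac_unslope : jac mu2 (fun z : mR * mR => (z.1, if 0 < z.1 then z.2 / z.1 else z.2))
  (fun z => if 0 < z.1 then z.1^-1 else 1).
Proof.
have mpos : measurable_fun setT (fun z : mR * mR => 0 < z.1) by exact: measurable_fun_ltr.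
have minv : measurable_fun setT (fun z : mR * mR => z.1^-1).
  exact: (measurableT_comp measurable_inv).
apply: (@jac_fiber1 (fun x y => if 0 < x then y / x else y)
  (fun x _ => if 0 < x then x^-1 else 1)).
- by apply: measurable_fun_ifT => //; exact: measurable_funM.
- exact: measurable_fun_ifT.
- move=> x; case: ifPn => x0.
    have := @jac_affine R x^-1 0; rewrite invr_eq0 gt_eqF // => /(_ isT).
    by apply: eq_jac => y; rewrite ?addr0 ?gtr0_norm ?invr_gt0 // mulrC.
  have := @jac_affine R 1 0; rewrite oner_eq0 => /(_ isT).
  by apply: eq_jac => y; rewrite ?mul1r ?addr0 ?normr1.
Qed.

(** With the slope [t = y / x], the inverted first coordinate is
    [x / (x^2 + y^2) = 1 / (x (1 + t^2))], and the slope is kept. For fixed [t] the map is a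
    dilation followed by [pos_inv]. *)
Let jac_radial : jac mu2
  (fun z : mR * mR => (pos_inv (z.1 * (1 + z.2 ^+ 2)), z.2))
  (fun z => pos_inv_jac (z.1 * (1 + z.2 ^+ 2)) * (1 + z.2 ^+ 2)).
Proof.
have [m1 m2 _ _] := @jac_pos_inv R.
have mD : measurable_fun setT (fun z : mR * mR => 1 + z.2 ^+ 2).
  by apply: measurable_funD => //; exact: measurable_funX.
have mM : measurable_fun setT (fun z : mR * mR => z.1 * (1 + z.2 ^+ 2)).
  exact: measurable_funM.
apply: (@jac_fiber2 (fun x y => pos_inv (x * (1 + y ^+ 2)))
  (fun x y => pos_inv_jac (x * (1 + y ^+ 2)) * (1 + y ^+ 2))).
- exact: measurableT_comp.
- by apply: measurable_funM => //; exact: measurableT_comp.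
- move=> y; have y0 : 0 < 1 + y ^+ 2 by rewrite ltr_pwDl // sqr_ge0.
  have := @jac_affine R (1 + y ^+ 2) 0; rewrite gt_eqF // => /(_ isT) J1.
  apply: eq_jac (jac_comp J1 (@jac_pos_inv R)) => x /=; rewrite addr0 mulrC //.
  by rewrite gtr0_norm // mulrC (mulrC x).
Qed.

(* In the coordinates [(x, y / x)] the inversion in the unit circle acts on the
   first coordinate only. *)
Lemma jac_inversion : exists S w, jac mu2 S w /\
  forall z : mR * mR, 0 < z.1 ->
    S z = (z.1 / (z.1 ^+ 2 + z.2 ^+ 2), z.2 / (z.1 ^+ 2 + z.2 ^+ 2)) /\
    w z = ((z.1 ^+ 2 + z.2 ^+ 2) ^+ 2)^-1.
Proof.
do 2 eexists; split; first exact: (jac_comp (jac_comp jac_unslope jac_radial) jac_slope).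
move=> [x y] /= x0; rewrite x0 /pos_inv /pos_inv_jac /=.
have d0 : 0 < 1 + (y / x) ^+ 2 by rewrite ltr_pwDl // sqr_ge0.
have d1 : 0 < x ^+ 2 + y ^+ 2 by rewrite ltr_pwDl ?sqr_ge0 // exprn_gt0.
rewrite mulr_gt0 // invr_gt0 mulr_gt0 // .
have E : 1 + (y / x) ^+ 2 = (x ^+ 2 + y ^+ 2) / x ^+ 2 by field; rewrite gt_eqF.
rewrite E; have xn : x != 0 by rewrite gt_eqF.
have dn : x ^+ 2 + y ^+ 2 != 0 by rewrite gt_eqF.
by split; [congr (_, _)|]; field; rewrite ?xn ?dn.
Qed.

End PlaneTransformations.

(** * Measurability in the plane *)

Section PlaneMeasurability.
Context {R : realType}.
Local Notation mR := (measurableTypeR R).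

(** An open set is a union of boxes with rational corners; these are countably many and measurable
    for the product structure. *)
Lemma open_plane_measurable (A : set (mR * mR)) :
  (forall w, A w -> exists2 r : R, 0 < r &
     forall v : R * R, `|v.1 - w.1| < r -> `|v.2 - w.2| < r -> A v) ->
  measurable A.
Proof.
move=> Aopen.
pose box (q : (rat * rat) * (rat * rat)) : set (mR * mR) :=
  `]ratr q.1.1, ratr q.1.2[%classic `*` `]ratr q.2.1, ratr q.2.2[%classic.
pose I := [set q | box q `<=` A].
have -> : A = \bigcup_(q in I) box q.
  apply/seteqP; split => [w Aw|w [q qI]]; last exact: qI.
  have [r r0 Hr] := Aopen w Aw.
  have rat_near (t : R) : exists p : rat * rat,
      [/\ t - r < ratr p.1, ratr p.1 < t, t < ratr p.2 & ratr p.2 < t + r].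
    have t1 : t - r < t by rewrite ltrBlDr ltrDl.
    have t2 : t < t + r by rewrite ltrDl.
    have [p1] := rat_in_itvoo t1; have [p2] := rat_in_itvoo t2.
    rewrite !in_itv /= => /andP[h1 h2] /andP[h3 h4].
    by exists (p1, p2).
  have [p [p1 p2 p3 p4]] := rat_near w.1; have [q [q1 q2 q3 q4]] := rat_near w.2.
  exists (p, q); last by split; rewrite /= in_itv /= ?p2 ?q2.
  move=> v [/=]; rewrite !in_itv /= => /andP[h1 h2] /andP[h3 h4].
  by apply: Hr; rewrite ltr_norml; apply/andP; split; lra.
have -> : \bigcup_(q in I) box q = \bigcup_q (if q \in I then box q else set0).
  apply/seteqP; split => [w [q qI bq]|w [q _]]; first by exists q; rewrite ?mem_set.
  by case: ifPn => [/set_mem qI bq|//]; exists q.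
apply: countable_bigcupT_measurable => // q.
by case: ifPn => // _; exact: measurableX.
Qed.

Definition disc_pre : set (mR * mR) := (@plane R) @^-1` (@disc R).

Lemma disc_pre_open (w : R * R) : disc_pre w -> exists2 r : R, 0 < r &
  forall v : R * R, `|v.1 - w.1| < r -> `|v.2 - w.2| < r -> disc_pre v.
Proof.
move=> wd; have [r r0 Hr] := disc_near (z := plane w) wd.
exists (r / 2); first by rewrite divr_gt0.
move=> v h1 h2; apply: Hr; apply: le_lt_trans (cmod_le_ReIm _) _ => /=.
by rewrite [ltRHS]splitr ltrD.
Qed.

Lemma measurable_disc : measurable disc_pre.
Proof. exact: open_plane_measurable disc_pre_open. Qed.

Definition mdisc (u : Cx R -> R) := measurable_fun disc_pre (fun w : mR * mR => u (plane w)).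

(** The sets where [cmod (F z) > a] are open, and open half-lines generate the Borel sets of the
    line. *)
Lemma contat_mdisc (F : R[i] -> R[i]) : (forall z, disc z -> contat F z) ->
  mdisc (fun z => cmod (F z)).
Proof.
move=> Fc mD; apply: (measurability _ (RGenOInfty.measurableE R)).
move=> _ [_ [a ->] <-]; rewrite preimage_itvoy.
apply: open_plane_measurable => w [wd /= wa].
have [r1 r10 H1] := disc_pre_open wd.
have e0 : 0 < (cmod (F (plane w)) - a) / 2 by rewrite divr_gt0 // subr_gt0.
have [r2 r20 H2] := Fc (plane w) wd _ e0.
exists (Num.min r1 (r2 / 2)); first by rewrite lt_min r10 divr_gt0.
move=> v; rewrite !lt_min => /andP[h1 h2] /andP[h3 h4]; split; first exact: H1.
have : cmod (F (plane v) - F (plane w)) <= (cmod (F (plane w)) - a) / 2.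
  apply: H2; apply: le_lt_trans (cmod_le_ReIm _) _ => /=.
  by rewrite [ltRHS]splitr ltrD.
have := cmod_ge_sub (F (plane w)) (F (plane v) - F (plane w)).
have -> : F (plane w) + (F (plane v) - F (plane w)) = F (plane v) by ring.
  by rewrite /=; move: e0 wa; clear; lra.
exact: measurable_disc.
Qed.

End PlaneMeasurability.

(** * Integrals over the disc and the Mobius change of variables *)

Section DiscIntegral.
Context {R : realType}.
Local Notation mu := (@lebesgue_measure R).
Local Notation mR := (measurableTypeR R).
Local Notation mu2 := (mu \x mu)%E.
Implicit Types (u v : Cx R -> R) (a z : R[i]).

Let pi_inv_ge0 : 0 <= (@pi R)^-1.
Proof. by rewrite invr_ge0 pi_ge0. Qed.

Lemma disc_integral_ge0 u : (forall z, disc z -> 0 <= u z) -> (0 <= disc_integral u)%E.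
Proof.
move=> u0; rewrite mule_ge0 ?lee_fin //; apply: integral_ge0 => w wd.
by rewrite lee_fin; apply: u0.
Qed.

Lemma eq_disc_integral u v : (forall z, disc z -> u z = v z) ->
  disc_integral u = disc_integral v.
Proof.
move=> uv; rewrite /disc_integral; congr (_ * _)%E; apply: eq_integral => w.
by rewrite inE /= => wd; rewrite uv.
Qed.

Lemma le_disc_integral u v : mdisc u -> mdisc v ->
  (forall z, disc z -> 0 <= u z) -> (forall z, disc z -> u z <= v z) ->
  (disc_integral u <= disc_integral v)%E.
Proof.
move=> mu_ mv u0 uv; apply: lee_wpmul2l; first by rewrite lee_fin.
apply: ge0_le_integral.
- exact: measurable_disc.
- by move=> w wd; rewrite lee_fin; exact: u0.
- exact/measurable_EFinP.
- exact/measurable_EFinP.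
- by move=> w wd; rewrite lee_fin; exact: uv.
Qed.

Lemma disc_integralZ u (k : R) : mdisc u -> (forall z, disc z -> 0 <= u z) -> 0 <= k ->
  disc_integral (fun z => k * u z) = (k%:E * disc_integral u)%E.
Proof.
move=> mu_ u0 k0; rewrite /disc_integral muleCA; congr (_ * _)%E.
rewrite -ge0_integralZl_EFin //; first exact: measurable_disc.
- by move=> w wd; rewrite lee_fin; exact: u0.
- exact/measurable_EFinP.
Qed.

Lemma disc_integralD u v : mdisc u -> mdisc v ->
  (forall z, disc z -> 0 <= u z) -> (forall z, disc z -> 0 <= v z) ->
  disc_integral (fun z => u z + v z) = (disc_integral u + disc_integral v)%E.
Proof.
move=> mu_ mv u0 v0; rewrite /disc_integral -ge0_muleDr; last 2 first.
- by apply: integral_ge0 => w wd; rewrite lee_fin; exact: u0.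
- by apply: integral_ge0 => w wd; rewrite lee_fin; exact: v0.
congr (_ * _)%E; rewrite -ge0_integralD //; first exact: measurable_disc.
- by move=> w wd; rewrite lee_fin; exact: u0.
- exact/measurable_EFinP.
- by move=> w wd; rewrite lee_fin; exact: v0.
- exact/measurable_EFinP.
Qed.

(** The real Jacobian of [phi a], that is, the squared modulus of its complex derivative; see
    [cmod_phi_deriv]. *)
Definition mobius_jac a z : R := ((1 - cmod a ^+ 2) / cmod (1 - conjc a * z) ^+ 2) ^+ 2.

Lemma mobius_den a z : disc a -> disc z -> 1 - conjc a * z != 0.
Proof.
rewrite !discE => ad zd; rewrite -cmod_gt0; have := cmod_ge_sub 1 (- (conjc a * z)).
rewrite cmod1 cmodN cmodM cmodJ; apply: lt_le_trans; rewrite subr_gt0.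
by apply: mulr_ilt1; rewrite ?cmod_ge0.
Qed.

(** For [a != 0] put [Z = 1 - conj a z] and [n = |a|^2]; then
    [phi a z = a / n - (1 - n) (a / n) / Z]. This is an affine map, the inversion in the circle, a
    conjugation and another affine map. On the disc [Re Z > 0], which is where [jac_inversion] is
    explicit. For [a = 0] the map is [z |-> - z]. *)
Lemma mobius_jac_plane a : disc a -> exists S W, jac mu2 S W /\
  forall w : R * R, disc (plane w) ->
    plane (S w) = phi a (plane w) /\ W w = mobius_jac a (plane w).
Proof.
move=> ad; have [a0|an] := eqVneq a 0.
  do 2 eexists; split; first by apply: (@jac_linear R (-1) 0 0 0); rewrite expr0n addr0 sqrrN expr1n.
  move=> [x y] _; have E : 1 - conjc 0 * plane (x, y) = 1 :> R[i].
    by rewrite conjc0 mul0r subr0.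
  rewrite a0 /phi /mobius_jac !E cmod0 cmod1; split; last by rewrite /=; field.
  by rewrite divr1 sub0r /plane /=; apply/eqP; rewrite eq_complex /=; apply/andP; split; apply/eqP; ring.
have [S [W [J HS]]] := @jac_inversion R.
case: a ad an => a1 a2 ad an.
pose n := a1 ^+ 2 + a2 ^+ 2.
have nE : cmod (a1 +i* a2) ^+ 2 = n by rewrite cmod_sqr.
have n0 : 0 < n by rewrite -nE exprn_gt0 // cmod_gt0.
have n1 : n < 1 by rewrite -nE expr_lt1 ?cmod_ge0.
have k0 : (1 - n) != 0 by rewrite subr_eq0 gt_eqF.
have J1 : jac mu2 _ _ := @jac_linear R (- a1) a2 1 0 _.
have {}J1 := J1 (eq_ind_r (fun t => 0 < t + _) n0 (sqrrN a1)).
have J3 : 0 < (- (1 - n) / n * a1) ^+ 2 + (- (1 - n) / n * a2) ^+ 2.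
  rewrite ![(- (1 - n) / n * _) ^+ 2]exprMn -mulrDr mulr_gt0 // exprn_even_gt0 //= mulf_neq0 ?oppr_eq0 //.
  by rewrite invr_eq0 gt_eqF.
have {}J3 := @jac_linear R _ _ (a1 / n) (a2 / n) J3.
do 2 eexists; split; first exact: (jac_comp (jac_comp (jac_comp J1 J) (@jac_conj R)) J3).
move=> [x y] wd /=.
have zden := mobius_den ad wd.
set X := - a1 * x - a2 * y + 1; set Y := a2 * x + - a1 * y + 0.
have zE : 1 - conjc (a1 +i* a2) * plane (x, y) = X +i* Y.
  by rewrite /plane /X /Y; apply/eqP; rewrite eq_complex /=; apply/andP; split; apply/eqP; ring.
have X0 : 0 < X.
  have : cmod (conjc (a1 +i* a2) * plane (x, y)) < 1.
    by rewrite cmodM cmodJ; apply: mulr_ilt1; rewrite ?cmod_ge0.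
  move/(le_lt_trans (ler_Re_cmod _)); rewrite ltr_norml /= /X => /andP[_].
  by clear; lra.
have D0 : 0 < X ^+ 2 + Y ^+ 2 by rewrite ltr_pwDl ?sqr_ge0 // exprn_gt0.
have Dn : X ^+ 2 + Y ^+ 2 != 0 by rewrite gt_eqF.
have nn : n != 0 by rewrite gt_eqF.
have [SE WE] := HS (X, Y) X0; rewrite SE WE /=; split; last first.
  rewrite /mobius_jac zE nE cmod_sqr /=.
  have -> : (- (1 - n) / n * a1) ^+ 2 + (- (1 - n) / n * a2) ^+ 2 = (1 - n) ^+ 2 / n.
    have -> : (- (1 - n) / n * a1) ^+ 2 + (- (1 - n) / n * a2) ^+ 2 =
      ((1 - n) / n) ^+ 2 * n by rewrite /n; ring.
    by field.
  have -> : (- a1) ^+ 2 + a2 ^+ 2 = n by rewrite sqrrN.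
  by move: (X ^+ 2 + Y ^+ 2) Dn => D Dn; field; rewrite Dn nn.
rewrite /phi; apply: (mulIf zden); rewrite divfK // zE.
have e1 : a1 * X - a2 * Y = a1 - n * x by rewrite /X /Y /n; ring.
have e2 : a1 * Y + a2 * X = a2 - n * y by rewrite /X /Y /n; ring.
rewrite /plane /=; apply/eqP; rewrite eq_complex /=; apply/andP; split; apply/eqP.
  transitivity (- (1 - n) / n * a1 + (a1 * X - a2 * Y) / n); last by rewrite e1; field.
  by move: X Y n Dn nn {e1 e2 X0 D0 zE SE WE nE n0 n1 k0 J1 J3}; clear => X Y n Dn nn; field; rewrite nn Dn.
transitivity (- (1 - n) / n * a2 + (a1 * Y + a2 * X) / n); last by rewrite e2; field.
by move: X Y n Dn nn {e1 e2 X0 D0 zE SE WE nE n0 n1 k0 J1 J3}; clear => X Y n Dn nn; field; rewrite nn Dn.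
Qed.

Lemma phi_disc a z : disc a -> disc z -> disc (phi a z).
Proof.
move=> ad zd; have den := mobius_den ad zd; rewrite discE /phi cmodf.
rewrite ltr_pdivrMr ?cmod_gt0 // mul1r -ltr_sqr ?nnegrE ?cmod_ge0 // !cmod_sqr.
have : 0 < (1 - cmod a ^+ 2) * (1 - cmod z ^+ 2).
  by rewrite mulr_gt0 // subr_gt0 expr_lt1 ?cmod_ge0.
rewrite !cmod_sqr; case: (a) (z) => [a1 a2] [x y] /=; clear; lra.
Qed.

Lemma mobius_jac_ge0 a z : 0 <= mobius_jac a z.
Proof. exact: sqr_ge0. Qed.

(* As [phi a] is an involution, the converse inequality follows from this one. *)
Lemma disc_integral_mobius_le u a : disc a -> mdisc u -> (forall z, disc z -> 0 <= u z) ->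
  (disc_integral (fun z => u (phi a z) * mobius_jac a z)%R <= disc_integral u)%E.
Proof.
move=> ad mu_ u0; apply: lee_wpmul2l; first by rewrite lee_fin.
have [S [W [[mS mW W0 J] HS]]] := mobius_jac_plane ad.
pose U := (fun w : mR * mR => (u (plane w))%:E) \_ disc_pre.
have mU : measurable_fun setT U.
  by apply/(measurable_restrictT _ measurable_disc); exact/measurable_EFinP.
have U0 w : (0 <= U w)%E.
  rewrite /U patchE; case: ifPn => // /set_mem wd; rewrite lee_fin; exact: u0.
rewrite [leRHS]integral_mkcond -/U -(J U mU U0).
apply: (@le_trans _ _ (\int[mu2]_(w in disc_pre) (U (S w) * (W w)%:E))%E).
  rewrite le_eqVlt; apply/orP; left; apply/eqP; apply: eq_integral => w /set_mem wd.
  have [SE WE] := HS w wd; rewrite /U patchE mem_set; first by rewrite SE WE EFinM.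
  by rewrite /disc_pre /= SE; apply: phi_disc.
(* Nothing recorded about [S] off the disc excludes that points there are sent into the disc, hence
   an inequality. *)
apply: ge0_subset_integral => //; first exact: measurable_disc.
- apply: emeasurable_funM; first exact: measurableT_comp.
  exact/measurable_EFinP.
- by move=> w _; rewrite mule_ge0 // lee_fin.
Qed.

End DiscIntegral.

(** * The Forelli-Rudin estimate *)

Section ForelliRudin.
Context {R : realType}.
Local Notation mu := (@lebesgue_measure R).
Local Notation mR := (measurableTypeR R).
Local Notation mu2 := (mu \x mu)%E.

Lemma powRN_cvg0 (d q : R) : 0 < d -> 0 < q -> (d + x) `^ (- q) @[x --> +oo] --> 0.
Proof.
move=> d0 q0; apply/cvgrPdist_le => e e0; rewrite /=.
have M0 : 0 < e `^ (- q^-1) by rewrite powR_gt0.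
have : \forall x \near (+oo : set_system R), e `^ (- q^-1) < x by exact: nbhs_pinfty_gt.
apply: filterS => x Mx; have x0 := lt_trans M0 Mx.
rewrite sub0r normrN ger0_norm ?powR_ge0 // powRN.
rewrite -[leRHS]invrK lef_pV2 ?posrE ?invr_gt0 ?powR_gt0 ?addr_gt0 //.
have -> : e^-1 = (e `^ (- q^-1)) `^ q.
  by rewrite -powRrM mulNr mulVf ?gt_eqF // powR_inv1 // ltW.
apply: ge0_ler_powR; rewrite ?nnegrE ?ltW ?addr_gt0 //.
by apply: lt_le_trans Mx _; rewrite lerDr ltW.
Qed.

Lemma is_derive_powR_shift (d q x : R) : 0 < d + x ->
  is_derive x 1 (fun t : R => (d + t) `^ q) (q * (d + x) `^ (q - 1)).
Proof.
move=> dx.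
have h1 : is_derive x 1 (fun t : R => d + t) 1.
  rewrite (_ : (fun t : R => d + t) = cst d + (id : R -> R)) //.
  by apply: is_derive_eq; rewrite add0r.
have := is_derive1_comp (is_derive1_powR q dx) h1.
by rewrite mulr1.
Qed.

Lemma integral_powR_tail (d q : R) : 0 < d -> 0 < q ->
  (\int[mu]_(x in `[0%R, +oo[) ((d + x) `^ (- q - 1))%:E = (d `^ (- q) / q)%:E)%E.
Proof.
move=> d0 q0.
have D (x : R) : 0 <= x -> is_derive x 1 (fun t : R => - q^-1 * (d + t) `^ (- q))
    ((d + x) `^ (- q - 1)).
  move=> x0; have dx : 0 < d + x by rewrite ltr_pwDl.
  have := is_deriveM (is_derive_cst (- q^-1) x 1) (is_derive_powR_shift (- q) dx).
  move=> H; apply: (is_derive_eq H).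
  rewrite /GRing.scale /= mulr0 addr0 mulrA mulrNN mulVf ?mul1r //.
  by rewrite gt_eqF.
have Dc (r x : R) : 0 <= x -> {for x, continuous (fun t : R => (d + t) `^ r)}.
  move=> x0; have dx : 0 < d + x by rewrite ltr_pwDl.
  by apply: differentiable_continuous; apply/derivable1_diffP; have [] := is_derive_powR_shift r dx.
rewrite (@ge0_continuous_FTC2y R (fun x => (d + x) `^ (- q - 1))
  (fun x => - q^-1 * (d + x) `^ (- q)) 0 0).
- by rewrite -EFinB sub0r addr0 mulNr opprK mulrC.
- by move=> x _; exact: powR_ge0.
- apply: continuous_in_subspaceT => x; rewrite inE /= in_itv /= andbT => x0.
  exact: Dc.
- rewrite -[X in _ --> X](mulr0 (- q^-1)); apply: cvgM; first exact: cvg_cst.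
  exact: powRN_cvg0.
- by move=> x x0; have [] := D x (ltW x0).
- apply: cvg_at_right_filter; apply: cvgM; first exact: cvg_cst.
  by apply: Dc.
- move=> x; rewrite in_itv /= andbT => x0.
  by have [_] := D x (ltW x0); rewrite derive1E.
Qed.

(** One-dimensional majorant: up to a constant, a product of two bumps dominates the kernel on the
    disc, which reduces the planar estimate to two integrals over the line. *)
Definition bump (d q x0 x : R) := (d + `|x - x0|) `^ (- q - 1).

Lemma bump_continuous (d q x0 : R) : 0 < d -> continuous (bump d q x0).
Proof.
move=> d0 x; apply: (@continuous_comp _ _ _ (fun t => `|t - x0|) (fun t => (d + t) `^ (- q - 1))).
  apply: (@continuous_comp _ _ _ (fun t => t - x0) (fun t => `|t|)).
    by apply: continuousB => //; exact: cvg_cst.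
  exact: norm_continuous.
have dx : 0 < d + `|x - x0| by rewrite ltr_pwDl.
by apply: differentiable_continuous; apply/derivable1_diffP; have [] := is_derive_powR_shift (- q - 1) dx.
Qed.

Lemma integral_bump (d q x0 : R) : 0 < d -> 0 < q ->
  (\int[mu]_x (bump d q x0 x)%:E = (2 * (d `^ (- q) / q))%:E)%E.
Proof.
move=> d0 q0.
have [_ _ _ J] := @jac_affine R 1 (- x0) (oner_neq0 R).
transitivity (\int[mu]_x (bump d q 0 x)%:E)%E.
  rewrite -(J (fun x => (bump d q 0 x)%:E)).
  - by apply: eq_integral => x _; rewrite normr1 mule1 /bump mul1r subr0.
  - by apply/measurable_EFinP; apply: continuous_measurable_fun; exact: bump_continuous.
  - by move=> x; rewrite lee_fin powR_ge0.
rewrite ge0_symfun_integralT.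
- rewrite EFinM; congr (_ * _)%E; rewrite -integral_powR_tail // set_itvcy.
  by apply: eq_integral => x; rewrite inE /= => xp; rewrite /bump subr0 ger0_norm.
- by move=> x; exact: powR_ge0.
- exact: bump_continuous.
- by move=> x; rewrite /bump /= !subr0 normrN.
Qed.

Lemma integral_bump2 (d q x0 y0 : R) : 0 < d -> 0 < q ->
  (\int[mu2]_w ((d + `|w.1 - x0|) `^ (- q - 1) * (d + `|w.2 - y0|) `^ (- q - 1))%:E =
   ((2 * (d `^ (- q) / q)) ^+ 2)%:E)%E.
Proof.
move=> d0 q0.
have mb t : measurable_fun [set: R] (bump d q t).
  by apply: continuous_measurable_fun; exact: bump_continuous.
rewrite fubini_tonelli1 /=; last 2 first.
- apply/measurable_EFinP; apply: measurable_funM.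
    exact: (measurableT_comp (mb x0) measurable_fst).
  exact: (measurableT_comp (mb y0) measurable_snd).
- by move=> w; rewrite lee_fin mulr_ge0 ?powR_ge0.
transitivity (\int[mu]_x ((2 * (d `^ (- q) / q))%:E * (bump d q x0 x)%:E))%E.
  apply: eq_integral => x _; rewrite /fubini_F /= -(integral_bump y0 d0 q0) muleC.
  rewrite -ge0_integralZl_EFin ?powR_ge0 //.
    by move=> y _; rewrite lee_fin powR_ge0.
  by apply/measurable_EFinP; exact: mb.
rewrite ge0_integralZl_EFin //; last 3 first.
- by move=> y _; rewrite lee_fin powR_ge0.
- by apply/measurable_EFinP; exact: mb.
- by rewrite mulr_ge0 // divr_ge0 ?powR_ge0 // ltW.
by rewrite integral_bump // -EFinM expr2.
Qed.

(** The kernel vanishes at [1 / conj c], outside the disc. For [|c| >= 1/2] its modulus controls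
    both [1 - |c|] and the distance to that point; for smaller [c] it is at least 1/2 on the disc,
    and 0 serves as the centre. *)
Lemma disc_kernel_near (c : R[i]) : disc c -> exists x0 y0 : R, forall z, disc z ->
  (1 - cmod c) + `|complex.Re z - x0| <= 4 * cmod (1 - conjc c * z) /\
  (1 - cmod c) + `|complex.Im z - y0| <= 4 * cmod (1 - conjc c * z).
Proof.
rewrite discE => cd.
have low z : disc z -> 1 - cmod c <= cmod (1 - conjc c * z) /\
    1 - cmod c * cmod z <= cmod (1 - conjc c * z).
  rewrite discE => zd; have := cmod_ge_sub 1 (- (conjc c * z)).
  rewrite cmod1 cmodN cmodM cmodJ => h; split => //.
  apply: le_trans h; rewrite lerD2l lerN2.
  by apply: ler_piMr; [exact: cmod_ge0|exact: ltW].
suff [w Hw] : exists w : R[i], forall z, disc z ->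
    1 - cmod c + cmod (z - w) <= 4 * cmod (1 - conjc c * z).
  exists (complex.Re w), (complex.Im w) => z /Hw h.
  have := ler_Re_cmod (z - w); have := ler_Im_cmod (z - w).
  rewrite !raddfB /= => h1 h2; split; apply: le_trans h; by rewrite lerD2l.
have [ch|ch] := ltP (cmod c) 2^-1.
  exists 0 => z zd; rewrite subr0; have [_ h] := low z zd.
  rewrite discE in zd; have z0 := cmod_ge0 z; have c0 := cmod_ge0 c.
  have : cmod c * cmod z <= 2^-1.
    by apply: le_trans (_ : 2^-1 * 1 <= _); [apply: ler_pM => //; exact: ltW|rewrite mulr1].
  by move: h zd c0; clear; lra.
have cn : conjc c != 0 by rewrite conjc_eq0 -cmod_gt0; apply: lt_le_trans ch; rewrite invr_gt0.
exists (conjc c)^-1 => z zd; have [h _] := low z zd.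
have E : 1 - conjc c * z = - conjc c * (z - (conjc c)^-1) by field.
have : 2^-1 * cmod (z - (conjc c)^-1) <= cmod (1 - conjc c * z).
  by rewrite [in leRHS]E cmodM cmodN cmodJ ler_wpM2r // cmod_ge0.
by move: h; have := cmod_ge0 (1 - conjc c * z); clear; lra.
Qed.

(** Let [m = |1 - conj c z|]. As [1 - |z|^2 <= 2 m], the integrand is at most a constant times
    [m^(p - 4)], which is shared evenly by the two coordinates: [- q - 1 = (p - 4) / 2]. Each
    integral over the line is of order [d^(- q)], and [d^(- 2 q) = d^(p - 2)]. *)
Lemma forelli_rudin (p : R) : 0 < p < 1 -> exists2 K : R, 0 <= K &
  forall c : R[i], disc c ->
  (disc_integral (fun z => (1 - cmod z ^+ 2) `^ p * (cmod (1 - conjc c * z) ^+ 4)^-1)%R <=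
   (K * (1 - cmod c ^+ 2) `^ (p - 2))%:E)%E.
Proof.
move=> /andP[p0 p1].
pose q := 1 - p / 2.
have q0 : 0 < q by rewrite /q; move: p1; clear; lra.
(* In [A], 2 is the loss in [hm] and 4 the loss in [disc_kernel_near]; in [K], the power of 2 passes
   from [1 - |c|] to [1 - |c|^2]. *)
pose A := 2 `^ p * (4 `^ (q + 1)) ^+ 2.
have A0 : 0 <= A by rewrite mulr_ge0 ?powR_ge0 ?exprn_ge0 ?powR_ge0.
pose K := (@pi R)^-1 * (A * (2 / q) ^+ 2 * 2 `^ (2 - p)).
have K0 : 0 <= K.
  rewrite /K; apply: mulr_ge0; first by rewrite invr_ge0 pi_ge0.
  apply: mulr_ge0; last exact: powR_ge0.
  by apply: mulr_ge0 => //; exact: sqr_ge0.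
exists K => // c cd; have [x0 [y0 Hxy]] := disc_kernel_near cd.
set d := 1 - cmod c in Hxy.
have d0 : 0 < d by rewrite subr_gt0.
have c0 := cmod_ge0 c.
have dc : 0 < 1 - cmod c ^+ 2 by rewrite subr_gt0 expr_lt1.
pose G := fun w : mR * mR => (d + `|w.1 - x0|) `^ (- q - 1) * (d + `|w.2 - y0|) `^ (- q - 1).
have mG : measurable_fun setT G.
  apply: measurable_funM.
    apply: (measurableT_comp (f := bump d q x0) _ measurable_fst).
    by apply: continuous_measurable_fun; exact: bump_continuous.
  apply: (measurableT_comp (f := bump d q y0) _ measurable_snd).
  by apply: continuous_measurable_fun; exact: bump_continuous.
have G0 w : 0 <= G w by rewrite mulr_ge0 ?powR_ge0.
have pt (w : R * R) : disc (plane w) ->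
    (1 - cmod (plane w) ^+ 2) `^ p * (cmod (1 - conjc c * plane w) ^+ 4)^-1 <= A * G w.
  move=> wd; have [h1 h2] := Hxy _ wd.
  set m := cmod (1 - conjc c * plane w) in h1 h2 *.
  have m0 : 0 < m by rewrite cmod_gt0 mobius_den.
  have z0 := cmod_ge0 (plane w); have z1 : cmod (plane w) < 1 by [].
  have hm : 1 - cmod (plane w) ^+ 2 <= 2 * m.
    have := cmod_ge_sub 1 (- (conjc c * plane w)).
    rewrite cmod1 cmodN cmodM cmodJ -/m => h.
    have : cmod c * cmod (plane w) <= cmod (plane w) by rewrite ler_piMl // ltW.
    by move: h z0 z1; clear; nra.
  have e1 : (1 - cmod (plane w) ^+ 2) `^ p <= 2 `^ p * m `^ p.
    rewrite -powRM //; last exact: ltW.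
    apply: ge0_ler_powR; rewrite ?nnegrE //.
    - exact: ltW.
    - by rewrite subr_ge0 expr_le1 // ltW.
    - by rewrite mulr_ge0 // ltW.
  have e2 (t : R) : 0 <= t -> d + t <= 4 * m ->
      m `^ (- q - 1) <= 4 `^ (q + 1) * (d + t) `^ (- q - 1).
    move=> t0 ht; have dt : 0 < d + t by rewrite ltr_pwDl.
    rewrite -opprD !powRN -[leRHS]mulrC ler_pdivlMl ?powR_gt0 // mulrC.
    rewrite ler_pdivrMl ?powR_gt0 // mulrC -powRM //; last exact: ltW.
    apply: ge0_ler_powR; rewrite ?nnegrE //.
    - by rewrite addr_ge0 // ltW.
    - exact: ltW.
    - by rewrite mulr_ge0 // ltW.
  have m4 : m `^ p * (m ^+ 4)^-1 = m `^ (- q - 1) * m `^ (- q - 1).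
    rewrite -powRD; last by rewrite (gt_eqF m0) implybT.
    have -> : - q - 1 + (- q - 1) = p - 4%:R by rewrite /q; field.
    rewrite powRB; last by rewrite (gt_eqF m0) implybT.
    by rewrite powR_mulrn // ltW.
  apply: le_trans (_ : 2 `^ p * (m `^ (- q - 1) * m `^ (- q - 1)) <= _).
    by rewrite -m4 mulrA ler_wpM2r // invr_ge0 exprn_ge0 // ltW.
  rewrite /A /G -mulrA ler_wpM2l ?powR_ge0 // expr2 mulrACA.
  by apply: ler_pM; rewrite ?powR_ge0 //; apply: e2.
have mL : measurable_fun disc_pre (fun w : mR * mR =>
    (1 - cmod (plane w) ^+ 2) `^ p * (cmod (1 - conjc c * plane w) ^+ 4)^-1).
  apply: measurable_funM.
    apply: (measurableT_comp (measurable_powR p)).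
    apply: measurable_funB => //; apply: measurable_funX.
    by apply: (@contat_mdisc R id) => z _; apply: cdiff_contat; exact: cdiff_id.
  apply: (measurableT_comp measurable_inv); apply: measurable_funX.
  apply: (@contat_mdisc R (fun z => 1 - conjc c * z)) => z _.
  apply: cdiff_contat (cdiffB (cdiff_cst 1 z) (cdiffZ (conjc c) (cdiff_id z))).
apply: (@le_trans _ _ ((pi^-1)%:E * \int[mu2]_w (A * G w)%:E)%E).
  apply: lee_wpmul2l; first by rewrite lee_fin invr_ge0 pi_ge0.
  apply: (@le_trans _ _ (\int[mu2]_(w in disc_pre) (A * G w)%:E)%E).
    apply: ge0_le_integral.
    - exact: measurable_disc.
    - by move=> w wd; rewrite lee_fin mulr_ge0 ?powR_ge0 // invr_ge0 exprn_ge0 ?cmod_ge0.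
    - exact/measurable_EFinP.
    - by apply/measurable_EFinP; apply: measurable_funTS; apply: measurable_funM.
    - by move=> w wd; rewrite lee_fin; exact: pt.
  apply: ge0_subset_integral => //; first exact: measurable_disc.
  - by apply/measurable_EFinP; apply: measurable_funM.
  - by move=> w _; rewrite lee_fin mulr_ge0.
have -> : (\int[mu2]_w (A * G w)%:E = (A * (2 * (d `^ (- q) / q)) ^+ 2)%:E)%E.
  rewrite [RHS]EFinM -(integral_bump2 x0 y0 d0 q0) -ge0_integralZl_EFin //.
  - by move=> w _; rewrite lee_fin; exact: G0.
  - exact/measurable_EFinP.
have -> : K * (1 - cmod c ^+ 2) `^ (p - 2) =
    (@pi R)^-1 * (A * ((2 / q) ^+ 2 * (2 `^ (2 - p) * (1 - cmod c ^+ 2) `^ (p - 2)))).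
  by rewrite /K; ring.
rewrite -EFinM lee_fin.
apply: ler_wpM2l; first by rewrite invr_ge0 pi_ge0.
apply: ler_wpM2l => //.
have -> : (2 * (d `^ (- q) / q)) ^+ 2 = (2 / q) ^+ 2 * d `^ (p - 2).
  have -> : d `^ (p - 2) = d `^ (- q) ^+ 2.
    rewrite -powR_mulrn ?powR_ge0 // -powRrM; congr (_ `^ _); by rewrite /q; field.
  by field; rewrite gt_eqF.
rewrite ler_wpM2l ?sqr_ge0 //.
have -> : p - 2 = - (2 - p) by ring.
have p2 : 0 <= 2 - p by move: p1; clear; lra.
rewrite !powRN -[leRHS]mulrC ler_pdivlMl ?powR_gt0 // ler_pdivrMr ?powR_gt0 //.
rewrite -powRM //; last exact: ltW.
apply: ge0_ler_powR; rewrite ?nnegrE ?mulr_ge0 //; try exact: ltW.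
by rewrite /d; move: c0 d0; rewrite /d; clear; nra.
Qed.

End ForelliRudin.

(** * Identities for the Mobius maps *)

Section MobiusIdentities.
Context {R : realType}.
Implicit Types (a b z w : R[i]).

Lemma one_sub_cmod2_gt0 a : disc a -> 0 < 1 - cmod a ^+ 2.
Proof. by rewrite discE => ad; rewrite subr_gt0 expr_lt1 ?cmod_ge0. Qed.

Lemma one_sub_cmod2E a : (1 - cmod a ^+ 2)%:C = 1 - conjc a * a.
Proof.
have E (r : R) : (1 - r)%:C = 1 - r%:C by apply/eqP; rewrite eq_complex /= subr0 !eqxx.
by rewrite E conj_mul_cmod.
Qed.

Lemma phi0 a : phi a 0 = a.
Proof. by rewrite /phi mulr0 !subr0 divr1. Qed.

Lemma one_sub_conj_phi a z : disc a -> disc z ->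
  1 - conjc a * phi a z = (1 - cmod a ^+ 2)%:C / (1 - conjc a * z).
Proof.
move=> ad zd; have den := mobius_den ad zd.
rewrite one_sub_cmod2E /phi.
(* The conjugate is treated as an independent variable: the identity is rational in it, [a] and [z].
   The same device is used below. *)
by move: den; move: (conjc a) => b den; field.
Qed.

Lemma cmod_one_sub_conj_phi a z : disc a -> disc z ->
  cmod (1 - conjc a * phi a z) = (1 - cmod a ^+ 2) / cmod (1 - conjc a * z).
Proof.
move=> ad zd; rewrite one_sub_conj_phi // cmodf cmodR ger0_norm // ltW //.
exact: one_sub_cmod2_gt0.
Qed.

Lemma phiK a z : disc a -> disc z -> phi a (phi a z) = z.
Proof.
move=> ad zd; have den := mobius_den ad zd.
have dn : (1 - cmod a ^+ 2)%:C != 0 :> R[i].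
  by rewrite -cmod_gt0 cmodR normr_gt0 gt_eqF // one_sub_cmod2_gt0.
rewrite {1}/phi one_sub_conj_phi //; move: dn.
rewrite one_sub_cmod2E /phi; move: den; move: (conjc a) => b den dn.
have n0 : (1 - b * a) / (1 - b * z) != 0 by rewrite mulf_neq0 // invr_eq0.
by apply: (mulIf n0); rewrite divfK //; field.
Qed.

Lemma one_sub_cmod_phi2 a z : disc a -> disc z ->
  1 - cmod (phi a z) ^+ 2 =
  (1 - cmod a ^+ 2) * (1 - cmod z ^+ 2) / cmod (1 - conjc a * z) ^+ 2.
Proof.
move=> ad zd; have den := mobius_den ad zd; rewrite /phi cmodf.
have mn : cmod (1 - conjc a * z) ^+ 2 != 0 by rewrite expf_neq0 // cmod_eq0.
apply: (mulIf mn); rewrite divfK // mulrBl mul1r exprMn exprVn divfK //.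
rewrite !cmod_sqr; case: (a) (z) => [a1 a2] [x y] /=; ring.
Qed.

Lemma mobius_jac_phi a z : disc a -> disc z ->
  mobius_jac a (phi a z) * mobius_jac a z = 1.
Proof.
move=> ad zd; have den := mobius_den ad zd; have d0 := one_sub_cmod2_gt0 ad.
have mn : cmod (1 - conjc a * z) != 0 by rewrite cmod_eq0.
rewrite /mobius_jac cmod_one_sub_conj_phi //.
move: (cmod (1 - conjc a * z)) (1 - cmod a ^+ 2) mn d0 => m d mn d0.
by field; rewrite mn gt_eqF.
Qed.

(** Covariance of the kernel: pulled back by [phi a], the kernel of [b] becomes that of [phi a b].
    This brings the energy of a test function to Forelli-Rudin form. *)
Lemma mobius_kernel a b z : disc a -> disc b -> disc z ->
  cmod (1 - conjc b * phi a z) * cmod (1 - conjc a * z) =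
  cmod (1 - conjc a * b) * cmod (1 - conjc (phi a b) * z).
Proof.
move=> ad bd zd; have den := mobius_den ad zd; have den2 := mobius_den bd ad.
have -> : cmod (1 - conjc a * b) = cmod (1 - conjc b * a).
  rewrite -cmodJ; congr cmod.
  by case: (a) (b) => [a1 a2] [b1 b2]; apply/eqP; rewrite eq_complex /=;
    apply/andP; split; apply/eqP; ring.
rewrite -!cmodM; congr cmod.
have -> : conjc (phi a b) = (conjc a - conjc b) / (1 - a * conjc b).
  have -> : phi a b = (a - b) / (1 - conjc a * b) :> R[i] by [].
  have cM (x y : R[i]) : conjc (x * y) = conjc x * conjc y.
    by case: x y => [x1 x2] [y1 y2]; apply/eqP; rewrite eq_complex /=;
      apply/andP; split; apply/eqP; ring.
  rewrite cM conjc_inv; congr (_ / _).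
    by case: (a) (b) => [a1 a2] [b1 b2]; apply/eqP; rewrite eq_complex /=;
      apply/andP; split; apply/eqP; ring.
  by case: (a) (b) => [a1 a2] [b1 b2]; apply/eqP; rewrite eq_complex /=;
    apply/andP; split; apply/eqP; ring.
rewrite mulrC in den2; move: den den2; rewrite /phi.
move: (conjc a) (conjc b) => a' b' den den2.
by field; rewrite den2.
Qed.

Lemma cdiff_phi a z : disc a -> disc z ->
  cdiff (phi a) z (- (1 - cmod a ^+ 2)%:C / (1 - conjc a * z) ^+ 2).
Proof.
move=> ad zd; have den := mobius_den ad zd.
have h1 := cdiffB (cdiff_cst a z) (cdiff_id z).
have h2 := cdiffB (cdiff_cst 1 z) (cdiffZ (conjc a) (cdiff_id z)).
have h3 := cdiff_comp h2 (cdiff_inv den).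
have := cdiffM h1 h3; rewrite /phi.
set d := (X in cdiff _ _ X -> _); suff -> : d = - (1 - cmod a ^+ 2)%:C / (1 - conjc a * z) ^+ 2 by [].
rewrite /d one_sub_cmod2E.
by move: den; move: (conjc a) => b den; field.
Qed.

Lemma cmod_phi_deriv a z : disc a -> disc z ->
  cmod (- (1 - cmod a ^+ 2)%:C / (1 - conjc a * z) ^+ 2) ^+ 2 = mobius_jac a z.
Proof.
move=> ad zd; rewrite /mobius_jac cmodf cmodN cmodX cmodR ger0_norm //.
by rewrite ltW // one_sub_cmod2_gt0.
Qed.

End MobiusIdentities.

(** * Energies and their conformal transport *)

Section Energy.
Context {R : realType}.
Local Notation mR := (measurableTypeR R).
Implicit Types (a b z w : R[i]) (f g F : Cx R -> Cx R) (u v : Cx R -> R).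

Lemma contat_comp (f g : R[i] -> R[i]) z : contat g z -> contat f (g z) ->
  contat (fun w => f (g w)) z.
Proof.
move=> gc fc e e0; have [r r0 Hr] := fc e e0.
have r2 : 0 < r / 2 by rewrite divr_gt0.
have [q q0 Hq] := gc _ r2; exists q => // v vq; apply: Hr.
by apply: le_lt_trans (Hq v vq) _; rewrite ltr_pdivrMr // ltr_pMr // ltr1n.
Qed.

Lemma mdiscM u v : mdisc u -> mdisc v -> mdisc (fun z => u z * v z).
Proof. exact: measurable_funM. Qed.

Lemma mdiscD u v : mdisc u -> mdisc v -> mdisc (fun z => u z + v z).
Proof. exact: measurable_funD. Qed.

Lemma mdisc_sqr u : mdisc u -> mdisc (fun z => u z ^+ 2).
Proof. by move=> mu_; apply: measurable_funX. Qed.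

Lemma mdisc_powR u (p : R) : mdisc u -> mdisc (fun z => u z `^ p).
Proof. by move=> mu_; apply: (measurableT_comp (measurable_powR p)). Qed.

Lemma mdisc_inv u : mdisc u -> mdisc (fun z => (u z)^-1).
Proof. by move=> mu_; apply: (measurableT_comp measurable_inv). Qed.

Lemma mdisc_cst (k : R) : mdisc (fun=> k).
Proof. exact: measurable_cst. Qed.

Lemma mdisc_one_sub u : mdisc u -> mdisc (fun z => 1 - u z).
Proof. by move=> mu_; apply: measurable_funB. Qed.

Lemma mdisc_cmod : mdisc (fun z : Cx R => cmod z).
Proof. by apply: (@contat_mdisc R id) => z _; apply: cdiff_contat; exact: cdiff_id. Qed.

Lemma mdisc_phi a : disc a -> mdisc (fun z => cmod (phi a z)).
Proof.
by move=> ad; apply: contat_mdisc => z zd; apply: cdiff_contat (cdiff_phi ad zd).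
Qed.

Lemma mdisc_den a : mdisc (fun z => cmod (1 - conjc a * z)).
Proof.
apply: (@contat_mdisc R (fun z => 1 - conjc a * z)) => z _.
exact: cdiff_contat (cdiffB (cdiff_cst 1 z) (cdiffZ (conjc a) (cdiff_id z))).
Qed.

Lemma mdisc_mobius_jac a : mdisc (mobius_jac a).
Proof.
apply: mdisc_sqr; apply: mdiscM; first exact: mdisc_cst.
by apply: mdisc_inv; apply: mdisc_sqr; exact: mdisc_den.
Qed.

Lemma mdisc_deriv f : Hol f -> mdisc (fun z => cmod (derive1 f z) ^+ 2).
Proof.
move=> fH; apply: mdisc_sqr; apply: (@contat_mdisc R (derive1 f)) => z zd.
exact: Hol_deriv_contat.
Qed.

Lemma mdisc_deriv_phi f a : Hol f -> disc a ->
  mdisc (fun z => cmod (derive1 f (phi a z)) ^+ 2).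
Proof.
move=> fH ad; apply: mdisc_sqr; apply: (@contat_mdisc R (fun z => derive1 f (phi a z))) => z zd.
apply: (@contat_comp (derive1 f) (phi a)).
  exact: cdiff_contat (cdiff_phi ad zd).
by apply: Hol_deriv_contat => //; exact: phi_disc.
Qed.

(** The squared Dirichlet seminorm of [f o phi a], transported to the variable [w = phi a z]. The
    derivative factor no longer involves [a], so energies at different points are compared under one
    integral. *)
Definition energy (p : R) f a : \bar R :=
  disc_integral (fun w => (cmod (derive1 f w) ^+ 2 * (1 - cmod (phi a w) ^+ 2) `^ p)%R).

Definition energy_pull (p : R) f a : \bar R := disc_integral
  (fun z => (cmod (derive1 f (phi a z)) ^+ 2 * mobius_jac a z * (1 - cmod z ^+ 2) `^ p)%R).

Lemma energy_pullE (p : R) f a : Hol f -> disc a -> energy_pull p f a = energy p f a.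
Proof.
move=> fH ad; apply/eqP; rewrite eq_le; apply/andP; split.
  apply: le_trans (_ : _ <= _)%E (disc_integral_mobius_le ad _ _).
  - rewrite le_eqVlt; apply/orP; left; apply/eqP; apply: eq_disc_integral => z zd.
    by rewrite phiK // mulrAC.
  - apply: mdiscM; first exact: mdisc_deriv.
    by apply: mdisc_powR; apply: mdisc_one_sub; apply: mdisc_sqr; exact: mdisc_phi.
  - by move=> z _; rewrite mulr_ge0 ?sqr_ge0 ?powR_ge0.
(* The converse is the same inequality for the pulled-back integrand; the Jacobians at [z] and at
   [phi a z] cancel. *)
apply: le_trans (_ : _ <= _)%E (disc_integral_mobius_le ad _ _).
- rewrite le_eqVlt; apply/orP; left; apply/eqP; apply: eq_disc_integral => z zd.
  rewrite phiK //; have := mobius_jac_phi ad zd.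
  move: (mobius_jac a (phi a z)) (mobius_jac a z) => j k jk.
  by rewrite -mulrA (mulrC _ k) mulrA -(mulrA _ j) jk mulr1.
- apply: mdiscM.
    by apply: mdiscM; [exact: mdisc_deriv_phi|exact: mdisc_mobius_jac].
  by apply: mdisc_powR; apply: mdisc_one_sub; apply: mdisc_sqr; exact: mdisc_cmod.
- by move=> z _; rewrite mulr_ge0 ?powR_ge0 // mulr_ge0 ?sqr_ge0 ?mobius_jac_ge0.
Qed.

Lemma dirichlet_norm_pull (p : R) f a : Hol f -> disc a ->
  dirichlet_norm p (fun z => f (phi a z) - f a) = ((energy p f a) `^ (2^-1))%E.
Proof.
move=> fH ad; rewrite /dirichlet_norm phi0 subrr cmod0 expr0n add0e.
rewrite -energy_pullE //; congr (_ `^ _)%E; apply: eq_disc_integral => z zd.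
have fd := Hol_cdiff fH (phi_disc ad zd).
have := cdiffB (cdiff_comp (cdiff_phi ad zd) fd) (cdiff_cst (f a) z).
by move/cdiff_derive1 => ->; rewrite subr0 cmodM exprMn cmod_phi_deriv.
Qed.

Lemma energy_ge0 (p : R) f a : (0 <= energy p f a)%E.
Proof. by apply: disc_integral_ge0 => z _; rewrite mulr_ge0 ?sqr_ge0 ?powR_ge0. Qed.

End Energy.

(** * From tested energies to all energies *)

Section Descent.
Context {R : realType}.
Implicit Types (a b z w : R[i]) (f g : Cx R -> Cx R).

(** The energy of [g] at [a] with the extra weight [(d_a / |1 - conj a w|)^2]: the quantity that
    boundedness of [J_g] on one test function controls. *)
Definition tested (p : R) g a : \bar R :=
  disc_integral (fun w => (cmod (derive1 g w) ^+ 2 *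
    (((1 - cmod a ^+ 2) / cmod (1 - conjc a * w)) ^+ 2 * (1 - cmod (phi a w) ^+ 2) `^ p))%R).

Lemma mdisc_tested (p : R) g a : Hol g -> disc a ->
  mdisc (fun w => cmod (derive1 g w) ^+ 2 *
    (((1 - cmod a ^+ 2) / cmod (1 - conjc a * w)) ^+ 2 * (1 - cmod (phi a w) ^+ 2) `^ p)).
Proof.
move=> gH ad; apply: mdiscM; first exact: mdisc_deriv.
apply: mdiscM.
  apply: mdisc_sqr; apply: mdiscM; first exact: mdisc_cst.
  by apply: mdisc_inv; exact: mdisc_den.
by apply: mdisc_powR; apply: mdisc_one_sub; apply: mdisc_sqr; exact: mdisc_phi.
Qed.

Lemma mdisc_energy (p : R) g a : Hol g -> disc a ->
  mdisc (fun w => cmod (derive1 g w) ^+ 2 * (1 - cmod (phi a w) ^+ 2) `^ p).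
Proof.
move=> gH ad; apply: mdiscM; first exact: mdisc_deriv.
by apply: mdisc_powR; apply: mdisc_one_sub; apply: mdisc_sqr; exact: mdisc_phi.
Qed.

(** Here [|1 - conj a w| <= 2] and [1 - |a|^2 >= 1/32], so [d_a / |1 - conj a w|] is at least 1/64
    on the whole disc. *)
Lemma energy_le_tested (p : R) g a : Hol g -> disc a -> 32^-1 <= 1 - cmod a ->
  (energy p g a <= (64 ^+ 2)%:E * tested p g a)%E.
Proof.
move=> gH ad a32; rewrite -disc_integralZ; last 3 first.
- exact: mdisc_tested.
- by move=> z _; rewrite mulr_ge0 ?sqr_ge0 // mulr_ge0 ?sqr_ge0 ?powR_ge0.
- exact: sqr_ge0.
apply: le_disc_integral.
- exact: mdisc_energy.
- by apply: mdiscM; [exact: mdisc_cst|exact: mdisc_tested].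
- by move=> z _; rewrite mulr_ge0 ?sqr_ge0 ?powR_ge0.
move=> w wd; rewrite mulrCA; apply: ler_wpM2l; first exact: sqr_ge0.
rewrite mulrA; apply: ler_peMl; first exact: powR_ge0.
rewrite -exprMn; apply: exprn_ege1.
have m0 : 0 < cmod (1 - conjc a * w) by rewrite cmod_gt0 mobius_den.
rewrite mulrA ler_pdivlMr // mul1r.
have := cmodB 1 (conjc a * w); rewrite cmod1 cmodM cmodJ => h.
have a0 := cmod_ge0 a; have w0 := cmod_ge0 w.
rewrite !discE in ad wd.
have : cmod a * cmod w <= 1 by apply: mulr_ile1 => //; exact: ltW.
by move: h a32 a0 ad; clear; nra.
Qed.

(** Passing from [a] to [a'] changes the denominator by at most [31 (1 - |a|)], less than half of
    [|1 - conj a w|], so its square grows at most by 9/4. Meanwhile [1 - |a|^2] grows at least by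
    16, since [1 + |a| <= 2]. Hence [1 - |phi_a(w)|^2] grows at least by 64/9, which exceeds 4. *)
Lemma energy_descent_pointwise a a' w : disc a -> disc a' -> disc w ->
  1 - cmod a' = 32 * (1 - cmod a) -> cmod (a - a') = cmod a - cmod a' ->
  64 * (1 - cmod a ^+ 2) < cmod (1 - conjc a * w) ->
  1 - cmod (phi a w) ^+ 2 <= 4^-1 * (1 - cmod (phi a' w) ^+ 2).
Proof.
move=> ad ad' wd aa' dist far.
have m0 : 0 < cmod (1 - conjc a * w) by rewrite cmod_gt0 mobius_den.
have m0' : 0 < cmod (1 - conjc a' * w) by rewrite cmod_gt0 mobius_den.
rewrite !one_sub_cmod_phi2 //.
have dw := one_sub_cmod2_gt0 wd.
have close : cmod (1 - conjc a' * w) <= cmod (1 - conjc a * w) + (cmod a - cmod a').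
  have -> : 1 - conjc a' * w = (1 - conjc a * w) + (conjc (a - a')) * w.
    have -> : conjc (a - a') = conjc a - conjc a'.
      by case: (a) (a') => [a1 a2] [b1 b2]; apply/eqP; rewrite eq_complex /=;
        apply/andP; split; apply/eqP; ring.
    by ring.
  apply: le_trans (cmodD _ _) _; rewrite lerD2l cmodM cmodJ dist.
  rewrite -dist; apply: ler_piMr; first exact: cmod_ge0.
  exact: ltW.
have a0 := cmod_ge0 a; have a0' := cmod_ge0 a'.
rewrite !discE in ad ad'.
set m := cmod (1 - conjc a * w) in far m0 close *.
set m' := cmod (1 - conjc a' * w) in m0' close *.
have mm : 2 * m' <= 3 * m.
  by move: close far aa' ad a0; clear; nra.
have dd : 16 * (1 - cmod a ^+ 2) <= 1 - cmod a' ^+ 2.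
  by move: aa' ad ad' a0 a0'; clear; nra.
have da0 : 0 < 1 - cmod a ^+ 2 by rewrite subr_gt0 expr_lt1.
have sq : 4 * m' ^+ 2 <= 9 * m ^+ 2.
  have : (2 * m') ^+ 2 <= (3 * m) ^+ 2 by apply: lerXn2r; rewrite ?nnegrE ?mulr_ge0 // ltW.
  by rewrite !exprMn; clear; lra.
rewrite ler_pdivrMr ?exprn_gt0 //.
have -> : 4^-1 * ((1 - cmod a' ^+ 2) * (1 - cmod w ^+ 2) / m' ^+ 2) * m ^+ 2 =
   (1 - cmod w ^+ 2) * ((1 - cmod a' ^+ 2) * m ^+ 2 / (4 * m' ^+ 2)).
  by field; rewrite gt_eqF.
rewrite [leLHS]mulrC ler_pM2l // ler_pdivlMr ?mulr_gt0 ?exprn_gt0 //.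
apply: le_trans (_ : (1 - cmod a ^+ 2) * (9 * m ^+ 2) <= _); first by rewrite ler_pM2l.
have m20 : 0 < m ^+ 2 by rewrite exprn_gt0.
by move: m20 dd da0; clear; nra.
Qed.

(** Where [|1 - conj a w| <= 64 d_a] the extra weight of [tested] is at least [64^-2] and the first
    term suffices; elsewhere [energy_descent_pointwise] supplies the second. *)
Lemma energy_descent (p : R) g a : 0 < p -> Hol g -> disc a -> 1 - cmod a < 32^-1 ->
  exists a', [/\ disc a', 1 - cmod a' = 32 * (1 - cmod a) &
   (energy p g a <= (64 ^+ 2)%:E * tested p g a + (4^-1 `^ p)%:E * energy p g a')%E].
Proof.
move=> p0 gH ad a32; rewrite discE in ad.
have a0 : 0 < cmod a by move: a32; lra.
(* Solves [1 - t |a| = 32 (1 - |a|)]; the assumption [1 - |a| < 1/32] makes [t] nonnegative. *)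
pose t := (32 * cmod a - 31) / cmod a.
have t0 : 0 <= t by apply: divr_ge0; [move: a32; lra|exact: ltW].
have t1 : t <= 1 by rewrite ler_pdivrMr // mul1r; move: ad; lra.
have ta : t * cmod a = 32 * cmod a - 31 by rewrite divfK // gt_eqF.
have ca' : cmod (t%:C * a) = 32 * cmod a - 31 by rewrite cmodM cmodR ger0_norm.
have ad' : disc (t%:C * a) by rewrite discE ca'; move: ad; lra.
have aa' : 1 - cmod (t%:C * a) = 32 * (1 - cmod a) by rewrite ca'; ring.
have dist : cmod (a - t%:C * a) = cmod a - cmod (t%:C * a).
  have -> : a - t%:C * a = (1 - t)%:C * a.
    have -> : (1 - t)%:C = 1 - t%:C by apply/eqP; rewrite eq_complex /= subr0 !eqxx.
    by ring.
  by rewrite !cmodM !cmodR !ger0_norm ?subr_ge0 //; ring.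
exists (t%:C * a); split => //; set a' := t%:C * a in ad' aa' dist *.
have mt := mdisc_tested p gH ad; have me := mdisc_energy p gH ad'.
have t_ge0 z : disc z -> 0 <= cmod (derive1 g z) ^+ 2 *
    (((1 - cmod a ^+ 2) / cmod (1 - conjc a * z)) ^+ 2 * (1 - cmod (phi a z) ^+ 2) `^ p).
  by move=> _; rewrite mulr_ge0 ?sqr_ge0 // mulr_ge0 ?sqr_ge0 ?powR_ge0.
have e_ge0 z : disc z -> 0 <= cmod (derive1 g z) ^+ 2 * (1 - cmod (phi a' z) ^+ 2) `^ p.
  by move=> _; rewrite mulr_ge0 ?sqr_ge0 ?powR_ge0.
rewrite -!disc_integralZ //; try exact: powR_ge0; try exact: sqr_ge0.
rewrite -disc_integralD; last 4 first.
- by apply: mdiscM => //; exact: mdisc_cst.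
- by apply: mdiscM => //; exact: mdisc_cst.
- by move=> z /t_ge0 h; rewrite mulr_ge0 // sqr_ge0.
- by move=> z /e_ge0 h; rewrite mulr_ge0 // powR_ge0.
apply: le_disc_integral.
- exact: mdisc_energy.
- by apply: mdiscD; apply: mdiscM => //; exact: mdisc_cst.
- by move=> z _; rewrite mulr_ge0 ?sqr_ge0 ?powR_ge0.
move=> w wd.
have [near|far] := leP (cmod (1 - conjc a * w)) (64 * (1 - cmod a ^+ 2)).
  apply: (@le_trans _ _ (64 ^+ 2 * (cmod (derive1 g w) ^+ 2 *
   (((1 - cmod a ^+ 2) / cmod (1 - conjc a * w)) ^+ 2 * (1 - cmod (phi a w) ^+ 2) `^ p)))).
    rewrite mulrCA; apply: ler_wpM2l; first exact: sqr_ge0.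
    rewrite mulrA; apply: ler_peMl; first exact: powR_ge0.
    rewrite -exprMn; apply: exprn_ege1.
    have m0 : 0 < cmod (1 - conjc a * w) by rewrite cmod_gt0 mobius_den.
    by rewrite mulrA ler_pdivlMr // mul1r.
  by rewrite lerDl mulr_ge0 ?powR_ge0 //; exact: e_ge0.
apply: (@le_trans _ _ (4^-1 `^ p * (cmod (derive1 g w) ^+ 2 * (1 - cmod (phi a' w) ^+ 2) `^ p))).
  rewrite mulrCA; apply: ler_wpM2l; first exact: sqr_ge0.
  have b0 b : disc b -> 0 <= 1 - cmod (phi b w) ^+ 2.
    by move=> bd; apply: ltW; apply: one_sub_cmod2_gt0; exact: phi_disc.
  rewrite -powRM ?invr_ge0 //; last exact: b0.
  apply: ge0_ler_powR; rewrite ?nnegrE ?mulr_ge0 ?invr_ge0 ?b0 //; first exact: ltW.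
  exact: energy_descent_pointwise.
by rewrite lerDr mulr_ge0 ?sqr_ge0 //; exact: t_ge0.
Qed.

(* Each descent step moves the point away from the circle by the factor 32, so
   finitely many steps reach the region treated by [energy_le_tested]. *)
Lemma energy_bounded (p C : R) g : 0 < p -> Hol g -> 0 <= C ->
  (forall a, disc a -> (tested p g a <= C%:E)%E) ->
  exists2 K : R, 0 <= K & forall a, disc a -> (energy p g a <= K%:E)%E.
Proof.
move=> p0 gH C0 HC; set k := 4^-1 `^ p.
have k1 : k < 1.
  have := gt0_ltr_powR p0 (x := 4^-1) (y := 1); rewrite powR1; apply.
  - by rewrite nnegrE invr_ge0.
  - by rewrite nnegrE.
  - by rewrite invf_lt1 // ltr1n.
have k0 : 0 <= k by exact: powR_ge0.
have d0 : 0 < 1 - k by rewrite subr_gt0.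
(* The fixed point of [K = 64^2 C + k K], so one descent step reproduces the bound. *)
pose K := 64 ^+ 2 * C / (1 - k).
have K0 : 0 <= K by rewrite divr_ge0 ?mulr_ge0 ?sqr_ge0 // ltW.
have CK : 64 ^+ 2 * C <= K.
  by rewrite ler_pdivlMr // ler_piMr ?mulr_ge0 ?sqr_ge0 // gerBl.
have KE : 64 ^+ 2 * C + k * K = K by rewrite /K; field; rewrite gt_eqF.
have base a : disc a -> ((64 ^+ 2)%:E * tested p g a <= (64 ^+ 2 * C)%:E)%E.
  by move=> ad; rewrite [leRHS]EFinM lee_wpmul2l ?lee_fin ?sqr_ge0 // HC.
(* The condition says that at most [n] descent steps lead from [a] to a point with
   [1 - |a| >= 1/32]. *)
have step n : forall a, disc a -> 1 <= 32 * ((1 - cmod a) * 32 ^+ n) ->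
    (energy p g a <= K%:E)%E.
  elim: n => [|n IH] a ad.
    rewrite expr0 mulr1 => a1; apply: le_trans (energy_le_tested p gH ad _) _.
      by rewrite -[leLHS]mul1r ler_pdivrMr // mulrC.
    by apply: le_trans (base a ad) _; rewrite lee_fin.
  move=> a1; have [a32|a32] := leP 32^-1 (1 - cmod a).
    apply: le_trans (energy_le_tested p gH ad a32) _.
    by apply: le_trans (base a ad) _; rewrite lee_fin.
  have [a' [ad' aa' H]] := energy_descent p0 gH ad a32.
  apply: le_trans H _; rewrite -KE EFinD; apply: leeD; first exact: base.
  rewrite [leRHS]EFinM lee_wpmul2l ?lee_fin //; apply: IH => //.
  by rewrite aa'; move: a1; rewrite exprS; lra.
exists K => // a ad; have a1 : 0 < 1 - cmod a by rewrite subr_gt0.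
have [n Hn] := halving_small (@ler01 R) a1.
apply: (step n) => //; rewrite ltr_pdivrMr ?exprn_gt0 // in Hn.
have : (2 : R) ^+ n <= 32 ^+ n by apply: lerXn2r; rewrite ?nnegrE // ler_nat.
by move: Hn a1; clear; nra.
Qed.

End Descent.

Section ExtendedSquareRoot.
Context {R : realType}.
Local Open Scope ereal_scope.

(** Passes between norms and energies, which may be infinite: for [P = +oo] both sides fail, because
    [E] is positive. *)
Lemma sqrte_mul_le (E C : R) (P : \bar R) : (0 < E)%R -> (0 <= C)%R -> 0 <= P ->
  E%:E * P `^ (2^-1) <= C%:E <-> (E ^+ 2)%:E * P <= (C ^+ 2)%:E.
Proof.
move=> E0 C0; case: P => [r| |] //; last first.
  move=> _; rewrite poweRyr ?invr_eq0 ?pnatr_eq0 // !gt0_muley ?lte_fin ?exprn_gt0 //.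
rewrite lee_fin => r0; rewrite poweR_EFin powR12_sqrt // -!EFinM !lee_fin.
have S0 : (0 <= E * Num.sqrt r)%R by rewrite mulr_ge0 ?sqrtr_ge0 // ltW.
by rewrite -[in X in _ <-> X](sqr_sqrtr r0) -exprMn ler_sqr ?nnegrE.
Qed.

End ExtendedSquareRoot.

(** * Test functions and their uniform bound *)

Section TestFunctions.
Context {R : realType}.
Implicit Types (a b z w : R[i]) (f g : Cx R -> Cx R).

Lemma powR_expln (x r : R) : 0 < x -> x `^ r = expR (r * ln x).
Proof. by move=> x0; rewrite /powR gt_eqF. Qed.

(** In logarithms the exponents of [X], [Y] and [M] add up to [s + p], [p - s] and [- 2 p]. The
    first two are nonnegative, so [X <= 2 M] and [Y <= 2 M] bound the product by [2^(2 p)]. *)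
Lemma test_function_powers (p s X Y M : R) : 0 <= s <= p ->
  0 < X -> 0 < Y -> 0 < M -> X <= 2 * M -> Y <= 2 * M ->
  X `^ s * (Y `^ (1 - s / 2) ^+ 2 * X ^+ 2 / M ^+ 4 * (X * Y / M ^+ 2) `^ (p - 2)) <=
  4 `^ p.
Proof.
move=> /andP[s0 sp] X0 Y0 M0 XM YM.
have E (x : R) n : 0 < x -> x ^+ n = expR (n%:R * ln x).
  by move=> x0; rewrite -powR_mulrn ?ltW // powR_expln.
have lX : ln X <= ln 2 + ln M by rewrite -lnM ?posrE // ler_ln ?posrE ?mulr_gt0.
have lY : ln Y <= ln 2 + ln M by rewrite -lnM ?posrE // ler_ln ?posrE ?mulr_gt0.
have l4 : ln (4 : R) = 2 * ln 2.
  have -> : (4 : R) = 2 * 2 by ring.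
  by rewrite lnM ?posrE //; ring.
have q0 : 0 < X * Y / M ^+ 2 by rewrite !mulr_gt0 ?invr_gt0 ?exprn_gt0.
rewrite !powR_expln // -[expR _ ^+ 2]expRM_natl (E X 2) // (E M 4) // -expRN -!expRD.
rewrite ler_expR l4.
have -> : ln (X * Y / M ^+ 2) = ln X + ln Y - 2 * ln M.
  rewrite lnM ?posrE ?mulr_gt0 ?invr_gt0 ?exprn_gt0 // lnM ?posrE // lnV ?posrE ?exprn_gt0 //.
  by rewrite lnXn // mulr_natl.
have h1 : 0 <= (s + p) * (ln 2 + ln M - ln X) by rewrite mulr_ge0 ?subr_ge0 // addr_ge0 // (le_trans s0).
have h2 : 0 <= (p - s) * (ln 2 + ln M - ln Y) by rewrite mulr_ge0 ?subr_ge0.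
by move: h1 h2; clear; lra.
Qed.

Definition test_fun (r : R) b : Cx R -> Cx R :=
  fun w => ((1 - cmod b ^+ 2) `^ r)%:C / (1 - conjc b * w).

Lemma cmod_test_fun (r : R) b w :
  cmod (test_fun r b w) = (1 - cmod b ^+ 2) `^ r / cmod (1 - conjc b * w).
Proof.
transitivity (cmod (((1 - cmod b ^+ 2) `^ r)%:C / (1 - conjc b * w) : R[i])) => //.
by rewrite cmodf cmodR ger0_norm ?powR_ge0.
Qed.

Lemma cdiff_test_fun (r : R) b w : disc b -> disc w ->
  cdiff (test_fun r b) w
    (((1 - cmod b ^+ 2) `^ r)%:C * conjc b / (1 - conjc b * w) ^+ 2).
Proof.
move=> bd wd; have den := mobius_den bd wd.
have h1 := cdiffB (cdiff_cst 1 w) (cdiffZ (conjc b) (cdiff_id w)).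
have := cdiffZ (((1 - cmod b ^+ 2) `^ r)%:C) (cdiff_comp h1 (cdiff_inv den)).
set d := (X in cdiff _ _ X -> _).
suff -> : d = ((1 - cmod b ^+ 2) `^ r)%:C * conjc b / (1 - conjc b * w) ^+ 2 by [].
by rewrite /d; move: den; move: (conjc b) ((_ `^ _)%:C) => c k den; field.
Qed.

Lemma Hol_test_fun (r : R) b : disc b -> Hol (test_fun r b).
Proof. by move=> bd w wd; apply: cdiff_derivable; exact: cdiff_test_fun. Qed.

Lemma one_sub_cmod2_le a b : disc a -> disc b ->
  1 - cmod a ^+ 2 <= 2 * cmod (1 - conjc a * b) /\
  1 - cmod b ^+ 2 <= 2 * cmod (1 - conjc a * b).
Proof.
rewrite !discE => ad bd; have := cmod_ge_sub 1 (- (conjc a * b)).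
rewrite cmod1 cmodN cmodM cmodJ => h.
have a0 := cmod_ge0 a; have b0 := cmod_ge0 b.
have h1 : cmod a * cmod b <= cmod a by rewrite ler_piMr // ltW.
have h2 : cmod a * cmod b <= cmod b by rewrite ler_piMl // ltW.
by move: h h1 h2 ad bd a0 b0; clear => h h1 h2 ad bd a0 b0; split; nra.
Qed.

(** After the change of variables [mobius_kernel] merges the two denominators, and the integral is
    the Forelli-Rudin one at [c = phi a b], where [1 - |c|^2 = X Y / M^2]. The remaining powers are
    those of [test_function_powers], hence uniform in [a] and [b]. *)
Lemma energy_test_fun (p s : R) : 0 < p < 1 -> 0 <= s <= p ->
  exists2 K : R, 0 <= K & forall a b, disc a -> disc b ->
  (((1 - cmod a ^+ 2) `^ s)%:E * energy p (test_fun (1 - s / 2) b) a <= K%:E)%E.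
Proof.
move=> p01 sp; have [K K0 HK] := forelli_rudin p01.
exists (K * 4 `^ p); first by rewrite mulr_ge0 ?powR_ge0.
move=> a b ad bd; set r := 1 - s / 2.
have fH := @Hol_test_fun r b bd.
have [X0 Y0] := (one_sub_cmod2_gt0 ad, one_sub_cmod2_gt0 bd).
have M0 : 0 < cmod (1 - conjc a * b) by rewrite cmod_gt0 mobius_den.
have cd := phi_disc ad bd.
have [XM YM] := one_sub_cmod2_le ad bd.
have Hc := HK _ cd; rewrite one_sub_cmod_phi2 // in Hc.
set X := 1 - cmod a ^+ 2 in X0 XM Hc *.
set Y := 1 - cmod b ^+ 2 in Y0 YM Hc *.
set M := cmod (1 - conjc a * b) in M0 XM YM Hc *.
set A := Y `^ r ^+ 2 * X ^+ 2 / M ^+ 4.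
have A0 : 0 <= A.
  rewrite /A; apply: mulr_ge0; last by rewrite invr_ge0 exprn_ge0 // ltW.
  by apply: mulr_ge0; exact: sqr_ge0.
have mk : mdisc (fun z => (1 - cmod z ^+ 2) `^ p * (cmod (1 - conjc (phi a b) * z) ^+ 4)^-1).
  apply: mdiscM.
    by apply: mdisc_powR; apply: mdisc_one_sub; apply: mdisc_sqr; exact: mdisc_cmod.
  by apply: mdisc_inv; apply: measurable_funX; exact: mdisc_den.
have k0 z : 0 <= (1 - cmod z ^+ 2) `^ p * (cmod (1 - conjc (phi a b) * z) ^+ 4)^-1.
  by rewrite mulr_ge0 ?powR_ge0 // invr_ge0 exprn_ge0 // cmod_ge0.
have bound : (energy p (test_fun r b) a <= (A * (K * (X * Y / M ^+ 2) `^ (p - 2)))%:E)%E.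
  rewrite -energy_pullE // [leRHS]EFinM.
  apply: (@le_trans _ _ (A%:E * disc_integral (fun z => (1 - cmod z ^+ 2) `^ p *
      (cmod (1 - conjc (phi a b) * z) ^+ 4)^-1)%R)%E); last exact: lee_wpmul2l.
  rewrite -disc_integralZ //; apply: le_disc_integral.
  - apply: mdiscM.
      by apply: mdiscM; [exact: mdisc_deriv_phi|exact: mdisc_mobius_jac].
    by apply: mdisc_powR; apply: mdisc_one_sub; apply: mdisc_sqr; exact: mdisc_cmod.
  - by apply: mdiscM => //; exact: mdisc_cst.
  - by move=> z _; rewrite mulr_ge0 ?powR_ge0 // mulr_ge0 ?sqr_ge0 ?mobius_jac_ge0.
  move=> z zd; rewrite [leRHS]mulrCA [leRHS]mulrC.
  apply: ler_wpM2r; first exact: powR_ge0.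
  rewrite (cdiff_derive1 (cdiff_test_fun r bd (phi_disc ad zd))) cmodf cmodM cmodJ cmodX.
  rewrite cmodR ger0_norm ?powR_ge0 // -/Y /mobius_jac -/X.
  have mker := mobius_kernel ad bd zd; rewrite -/M in mker.
  set m := cmod (1 - conjc b * phi a z) in mker *.
  set n := cmod (1 - conjc a * z) in mker *.
  set k := cmod (1 - conjc (phi a b) * z) in mker *.
  have m0 : 0 < m by rewrite cmod_gt0; apply: mobius_den => //; exact: phi_disc.
  have n0 : 0 < n by rewrite cmod_gt0 mobius_den.
  have kp : 0 < k by rewrite cmod_gt0 mobius_den.
  have -> : (Y `^ r * cmod b / m ^+ 2) ^+ 2 * (X / n ^+ 2) ^+ 2 =
      cmod b ^+ 2 * (Y `^ r ^+ 2 * X ^+ 2 / (m * n) ^+ 4).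
    by field; rewrite !gt_eqF.
  have -> : cmod b ^+ 2 * (Y `^ r ^+ 2 * X ^+ 2 / (m * n) ^+ 4) = cmod b ^+ 2 * (A / k ^+ 4).
    by rewrite mker /A; field; rewrite !gt_eqF.
  apply: ler_piMl; first by rewrite divr_ge0 // exprn_ge0 // ltW.
  by rewrite expr_le1 ?cmod_ge0 // ltW.
apply: (@le_trans _ _ ((X `^ s)%:E * (A * (K * (X * Y / M ^+ 2) `^ (p - 2)))%:E)%E).
  by apply: lee_wpmul2l => //; rewrite lee_fin powR_ge0.
rewrite -EFinM lee_fin.
have -> : X `^ s * (A * (K * (X * Y / M ^+ 2) `^ (p - 2))) =
  K * (X `^ s * (A * (X * Y / M ^+ 2) `^ (p - 2))) by ring.
by apply: ler_wpM2l => //; exact: test_function_powers.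
Qed.

End TestFunctions.

(** * Morrey norms in terms of energies, and the conclusion *)

Section MorreyNorm.
Context {R : realType}.
Implicit Types (a b z w : R[i]) (f g : Cx R -> Cx R).

Lemma morrey_norm_le (p lam C : R) f : Hol f -> 0 <= C ->
  (forall a, disc a ->
     (((1 - cmod a ^+ 2) `^ (p / 2 * (1 - lam)) ^+ 2)%:E * energy p f a <= (C ^+ 2)%:E)%E) ->
  (dirichlet_morrey_norm p lam f <= (cmod (f 0) + C)%:E)%E.
Proof.
move=> fH C0 H; rewrite EFinD /dirichlet_morrey_norm; apply: leeD => //.
apply: ge_ereal_sup => _ [a ad <-]; rewrite dirichlet_norm_pull //.
apply/sqrte_mul_le => //; first by rewrite powR_gt0 // one_sub_cmod2_gt0.
  exact: energy_ge0.
exact: H.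
Qed.

Lemma le_morrey_norm (p lam C : R) f a : Hol f -> 0 <= C ->
  (dirichlet_morrey_norm p lam f <= C%:E)%E -> disc a ->
  (((1 - cmod a ^+ 2) `^ (p / 2 * (1 - lam)) ^+ 2)%:E * energy p f a <= (C ^+ 2)%:E)%E.
Proof.
move=> fH C0 H ad; apply/sqrte_mul_le => //.
- by rewrite powR_gt0 // one_sub_cmod2_gt0.
- exact: energy_ge0.
rewrite -dirichlet_norm_pull //; apply: le_trans H.
rewrite /dirichlet_morrey_norm; apply: le_trans (leeDr _ _); last first.
  by rewrite lee_fin cmod_ge0.
by apply: ereal_sup_ubound; exists a.
Qed.

Lemma morrey_norm_ge0 (p lam : R) f : (0 <= dirichlet_morrey_norm p lam f)%E.
Proof.
rewrite /dirichlet_morrey_norm; apply: adde_ge0; first by rewrite lee_fin cmod_ge0.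
(* A supremum of nonnegative terms is nonnegative once the index set is inhabited, here by 0. *)
apply: le_trans (_ : _ <= ((1 - cmod (0 : R[i]) ^+ 2) `^ (p / 2 * (1 - lam)))%:E *
  dirichlet_norm p (fun z => (f (phi 0 z) - f 0)%R))%E _.
  by rewrite mule_ge0 ?lee_fin ?powR_ge0 ?poweR_ge0.
by apply: ereal_sup_ubound; exists 0 => //; rewrite discE cmod0 ltr01.
Qed.

Lemma Qp_of_energy (p K : R) g : Hol g -> 0 <= K ->
  (forall a, disc a -> (energy p g a <= K%:E)%E) -> Qp p g.
Proof.
move=> gH K0 HK; split=> //; rewrite /Qp_norm.
apply: (@le_lt_trans _ _ ((cmod (g 0))%:E + (Num.sqrt K)%:E)%E); last by rewrite -EFinD ltry.
apply: leeD => //; apply: ge_ereal_sup => _ [a ad <-]; rewrite dirichlet_norm_pull //.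
have := sqrte_mul_le (E := 1) (C := Num.sqrt K) (P := energy p g a) ltr01 (sqrtr_ge0 K).
rewrite mul1e expr1n mul1e sqr_sqrtr // => /(_ (energy_ge0 p g a)) ->.
exact: HK.
Qed.

Lemma cmod_derive1_Jop_test (r : R) g a w : Hol g -> Hol (Jop g (test_fun r a)) ->
  disc a -> disc w ->
  cmod (derive1 (Jop g (test_fun r a)) w) =
  (1 - cmod a ^+ 2) `^ r / cmod (1 - conjc a * w) * cmod (derive1 g w).
Proof.
move=> gH JH ad wd; rewrite (derive1_Jop (Hol_test_fun (r := r) ad) gH JH wd).
rewrite -cmod_test_fun; exact: cmodM.
Qed.

End MorreyNorm.

Theorem theorem3 (R : realType) (p lam : R) (g : Cx R -> Cx R)
    (hp : 0 < p < 1) (hlam : 0 < lam < 1) (hg : Hol g)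
    (hJ : bounded_linear_on (dirichlet_morrey p lam)
            (dirichlet_morrey_norm p lam) (Jop g)) :
  Qp p g.
Proof.
have /andP[p0 p1] := hp; have /andP[l0 l1] := hlam.
pose s := p * (1 - lam).
have s0 : 0 <= s by rewrite mulr_ge0 ?subr_ge0 // ltW.
have sp : 0 <= s <= p by rewrite s0 ler_piMr ?ltW // gtrBl.
have sE : p / 2 * (1 - lam) = s / 2 by rewrite /s; ring.
have [K K0 HK] := energy_test_fun hp sp.
have powE (x : R) : x `^ (s / 2) ^+ 2 = x `^ s.
  by rewrite -powR_mulrn ?powR_ge0 // -powRrM divfK.
have [JX _ [M HM]] := hJ.
have fH b : disc b -> Hol (test_fun (1 - s / 2) b) by move=> bd; exact: Hol_test_fun.
(* 1 bounds the value of the test function at 0 and [Num.sqrt K] its seminorm part, both uniformly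
   in [b]. *)
pose C0 := 1 + Num.sqrt K.
have C00 : 0 <= C0 by rewrite addr_ge0 // sqrtr_ge0.
have fN b : disc b -> (dirichlet_morrey_norm p lam (test_fun (1 - s / 2) b) <= C0%:E)%E.
  move=> bd; apply: le_trans (@morrey_norm_le R p lam (Num.sqrt K) (test_fun (1 - s / 2) b) (fH b bd) (sqrtr_ge0 K) _) _.
    by move=> a ad; rewrite sE powE sqr_sqrtr //; exact: HK.
  rewrite lee_fin lerD2r cmod_test_fun mulr0 subr0 cmod1 divr1.
  have d0 := one_sub_cmod2_gt0 bd.
  apply: (@le_trans _ _ (1 `^ (1 - s / 2))); last by rewrite powR1.
  apply: ge0_ler_powR; rewrite ?nnegrE //.
  - by move: sp p1 => /andP[_]; lra.
  - exact: ltW.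
  - by rewrite gerBl sqr_ge0.
have fX b : disc b -> dirichlet_morrey p lam (test_fun (1 - s / 2) b).
  by move=> bd; split; [exact: fH|exact: le_lt_trans (fN b bd) (ltry _)].
have JH b : disc b -> Hol (Jop g (test_fun (1 - s / 2) b)) by move=> /fX /JX [].
(* The sign of [M] is unknown; its absolute value makes the multiplication monotone. *)
pose C := `|M| * C0.
have CC : 0 <= C by rewrite mulr_ge0.
have JN b : disc b -> (dirichlet_morrey_norm p lam (Jop g (test_fun (1 - s / 2) b)) <= C%:E)%E.
  move=> bd; apply: le_trans (HM _ (fX b bd)) _; rewrite /C EFinM.
  have N0 := @morrey_norm_ge0 R p lam (test_fun (1 - s / 2) b).
  apply: (@le_trans _ _ (`|M|%:E * dirichlet_morrey_norm p lam (test_fun (1 - s / 2) b))%E).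
    by apply: lee_wpmul2r => //; rewrite lee_fin ler_norm.
  by apply: lee_wpmul2l; [rewrite lee_fin|exact: fN].
suff [L L0 HL] : exists2 L : R, 0 <= L & forall a, disc a -> (energy p g a <= L%:E)%E.
  exact: Qp_of_energy L0 HL.
apply: (@energy_bounded R p (C ^+ 2) g p0 hg (sqr_ge0 C) _).
move=> a ad.
have CE := @le_morrey_norm R p lam C (Jop g (test_fun (1 - s / 2) a)) a (JH a ad) CC (JN a ad) ad.
apply: le_trans CE; rewrite /energy -disc_integralZ; last 3 first.
- exact: (mdisc_energy p (JH a ad) ad).
- by move=> z _; rewrite mulr_ge0 ?sqr_ge0 ?powR_ge0.
- exact: sqr_ge0.
(* The integrands coincide: the derivative of [J_g f_a] is [f_a g'], and the Morrey weight and the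
   numerator of [f_a] are complementary powers of [1 - |a|^2], so together they give the extra
   weight of [tested]. *)
rewrite le_eqVlt; apply/orP; left; apply/eqP; apply: eq_disc_integral => w wd.
rewrite [X in _ = _ * (X ^+ 2 * _)](cmod_derive1_Jop_test hg (JH a ad) ad wd).
rewrite sE.
have d0 := one_sub_cmod2_gt0 ad.
have m0 : cmod (1 - conjc a * w) != 0 by rewrite cmod_eq0 mobius_den.
have dE : 1 - cmod a ^+ 2 = (1 - cmod a ^+ 2) `^ (s / 2) * (1 - cmod a ^+ 2) `^ (1 - s / 2).
  rewrite -powRD; last by rewrite (gt_eqF d0) implybT.
  have -> : s / 2 + (1 - s / 2) = 1 by ring.
  by rewrite powRr1 // ltW.
rewrite {1}dE; move: (_ `^ (s / 2)) (_ `^ (1 - s / 2)) (_ `^ p) => x y u.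
by field.
Qed.
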